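(* Let $p$ be a prime and $m,d\geq 1$ integers, and let $$W_{m,d}=\mathbb{Z}_p^{(m)}\,\overline{\wr}\,\mathbb{Z}_p^{(d)}=\varprojlim_{n\to\infty} C_{p^n}^{(m)}\wr C_{p^n}^{(d)}$$ be the profinite wreath product. Then $W_{m,d}$ is finitely axiomatizable in the class of profinite groups: there is a first-order sentence $\sigma$ in the language of group theory such that $W_{m,d}\models\sigma$ and every profinite group satisfying $\sigma$ is (continuously) isomorphic to $W_{m,d}$.
   Context: $C_{p^n}$ denotes the cyclic group of order $p^n$ and $C_{p^n}^{(k)}$ the direct product of $k$ copies; $C_{p^n}^{(m)}\wr C_{p^n}^{(d)}$ is the (finite, standard) wreath product, and the inverse limit is over the natural quotient maps. Equivalently $W_{m,d}=M\rtimes X$ where $X\cong\mathbb{Z}_p^{d}$ is free abelian pro-$p$ and $M$ is a free module of rank $m$ over the completed group algebra $\mathbb{Z}_p[[X]]$. Sentences are in the first-order language of groups; isomorphism means continuous isomorphism. *)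

(* Defs.v *)
From HB Require Import structures.
From mathcomp Require Import all_boot all_order all_algebra.
From mathcomp Require Import all_classical all_reals all_analysis.
Set Implicit Arguments. Unset Strict Implicit. Unset Printing Implicit Defensive.
Import GRing.Theory.
Local Open Scope ring_scope.

(*    Level n of the inverse system is the wreath product with k = n+1       *)
(*    (the cofinal subsystem k >= 1; this avoids the degenerate 'Z_1, and    *)
(*    has the same inverse limit).                                           *)

Lemma Zp_modR (t N x : nat) : (t.+2 %| N)%N -> ((x %% N)%N%:R : 'I_t.+2) = x%:R.
Proof.
move=> /dvdnP[c ->].
rewrite {2}(divn_eq x (c * t.+2)) natrD !natrM.
by rewrite (@pchar_Zp t.+2) // !mulr0 add0r.
Qed.

Lemma Zp_red_add (t s : nat) (h : (t.+2 %| s.+2)%N) (a b : 'I_s.+2) :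
  ((nat_of_ord (a + b))%:R : 'I_t.+2) = (nat_of_ord a)%:R + (nat_of_ord b)%:R.
Proof.
rewrite -natrD; change (nat_of_ord (a+b)) with (((a:nat) + b) %% s.+2)%N.
exact: Zp_modR.
Qed.

Lemma Zp_trunc_dvd p n : ((Zp_trunc (p ^ n.+1)).+2 %| (Zp_trunc (p ^ n.+2)).+2)%N.
Proof.
case: p => [|[|q]]; rewrite ?exp0n ?exp1n //=.
have h k : (1 < k)%N -> k.-2.+2 = k by case: k => [|[|k]].
have g k : (1 < q.+2 ^ k.+1)%N.
  by rewrite (leq_trans _ (leq_pexp2l _ (ltn0Sn k))) ?expn1.
by rewrite /Zp_trunc !h ?g // dvdn_exp2l.
Qed.

Section Wreath.
Variables p m d : nat.

Definition Zl (n : nat) := 'Z_(p ^ n.+1).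
Definition Xl n := {ffun 'I_d -> Zl n}.
Definition Vl n := {ffun 'I_m -> Zl n}.
Definition Ml n := {ffun Xl n -> Vl n}.
Definition Ll n := (Ml n * Xl n)%type.

Definition wshift n (x : Xl n) (g : Ml n) : Ml n := [ffun z : Xl n => g (z - x)].
Definition wmul n (a b : Ll n) : Ll n := (a.1 + wshift a.2 b.1, a.2 + b.2).
Definition winv n (a : Ll n) : Ll n := (- wshift (- a.2) a.1, - a.2).
Definition wone n : Ll n := (0, 0).

Definition redZ n (a : Zl n.+1) : Zl n := (nat_of_ord a)%:R.
Definition redX n (x : Xl n.+1) : Xl n := [ffun i => redZ (x i)].
Definition redV n (v : Vl n.+1) : Vl n := [ffun i => redZ (v i)].
Definition redM n (f : Ml n.+1) : Ml n :=
  [ffun z : Xl n => \sum_(z' : Xl n.+1 | redX z' == z) redV (f z')].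
Definition wproj n (a : Ll n.+1) : Ll n := (redM a.1, redX a.2).

Section Proofs.
Variable n : nat.

Fact redZ_morph : nmod_morphism (@redZ n).
Proof. by split=> [|a b]; rewrite /redZ ?Zp_red_add ?Zp_trunc_dvd. Qed.
HB.instance Definition _ := GRing.isNmodMorphism.Build _ _ (@redZ n) redZ_morph.

Fact redX_morph : nmod_morphism (@redX n).
Proof. by split=> [|a b]; apply/ffunP=> i; rewrite !ffunE ?raddf0 ?raddfD ?ffunE. Qed.
HB.instance Definition _ := GRing.isNmodMorphism.Build _ _ (@redX n) redX_morph.

Fact redV_morph : nmod_morphism (@redV n).
Proof. by split=> [|a b]; apply/ffunP=> i; rewrite !ffunE ?raddf0 ?raddfD ?ffunE. Qed.
HB.instance Definition _ := GRing.isNmodMorphism.Build _ _ (@redV n) redV_morph.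

Fact redM_morph : nmod_morphism (@redM n).
Proof.
split=> [|a b]; apply/ffunP=> z; rewrite !ffunE.
  by rewrite big1 // => z' _; rewrite ffunE raddf0.
by rewrite -big_split; apply: eq_bigr => z' _; rewrite ffunE raddfD.
Qed.
HB.instance Definition _ := GRing.isNmodMorphism.Build _ _ (@redM n) redM_morph.

Lemma redM_shift (x : Xl n.+1) (g : Ml n.+1) :
  redM (wshift x g) = wshift (redX x) (redM g).
Proof.
apply/ffunP=> z; rewrite !ffunE.
rewrite (reindex_inj (addIr x)) /=.
apply: eq_big => [z'|z' _]; last by rewrite ffunE addrK.
by rewrite raddfD /= (can2_eq (addrK _) (subrK _)).
Qed.

Lemma wproj_mul (a b : Ll n.+1) : wproj (wmul a b) = wmul (wproj a) (wproj b).
Proof. by rewrite /wproj /wmul /= !raddfD /= redM_shift. Qed.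

Lemma wproj_inv (a : Ll n.+1) : wproj (winv a) = winv (wproj a).
Proof. by rewrite /wproj /winv /= !raddfN /= redM_shift raddfN. Qed.

Lemma wproj_one : wproj (wone n.+1) = wone n.
Proof. by rewrite /wproj /wone /= !raddf0. Qed.
End Proofs.
End Wreath.

(* Comments on the construction above:
   - Zl n = Z/p^(n+1), Xl n = C_{p^(n+1)}^(d) (the top group, written
     additively), Vl n = C_{p^(n+1)}^(m), Ml n = functions Xl n -> Vl n
     (the base group, i.e. the direct product of |Xl n| copies of Vl n).
   - Ll n = Ml n x Xl n is the wreath product Vl n wr Xl n, with
     multiplication (f,x)(g,y) = (f + x.g, x + y), where (x.g)(z) = g(z - x).
   - wproj : Ll (n+1) -> Ll n is the natural quotient map: reduction mod p^(n+1)
     on the top group, and on the base group the map induced on the group ring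
     (Z/p^(n+2))[X_(n+1)]^m -> (Z/p^(n+1))[X_n]^m, i.e. summing over fibres. *)

Section Limit.
Variables p m d : nat.

Definition Wprod := prod_topology (fun n : nat => discrete_topology (Ll p m d n)).

Definition Wset : set Wprod :=
  [set w : Wprod | forall n, @wproj p m d n (w n.+1) = w n].

Definition Wlim : Type := set_type Wset.

Lemma Wset_mul (a b : Wlim) :
  (fun n => wmul (val a n) (val b n) : discrete_topology (Ll p m d n)) \in Wset.
Proof.
apply/mem_set => n; rewrite wproj_mul.
by rewrite (set_valP a n) (set_valP b n).
Qed.

Lemma Wset_inv (a : Wlim) :
  (fun n => winv (val a n) : discrete_topology (Ll p m d n)) \in Wset.
Proof. by apply/mem_set => n; rewrite wproj_inv (set_valP a n). Qed.

Lemma Wset_one :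
  (fun n => wone p m d n : discrete_topology (Ll p m d n)) \in Wset.
Proof. by apply/mem_set => n; rewrite wproj_one. Qed.

Definition Wmul (a b : Wlim) : Wlim := SigSub (Wset_mul a b).
Definition Winv (a : Wlim) : Wlim := SigSub (Wset_inv a).
Definition Wone : Wlim := SigSub Wset_one.
End Limit.

HB.mixin Record Group_Topological_isTopologicalGroup G
    of Group G & Topological G := {
  mulg_continuous : continuous (fun xy : G * G => (xy.1 * xy.2)%g);
  invg_continuous : continuous (fun x : G => (x^-1)%g)
}.

#[short(type="topGroupType")]
HB.structure Definition TopologicalGroup :=
  {G of Group_Topological_isTopologicalGroup G & Group G & Topological G}.

Definition profinite (G : topGroupType) : Prop :=
  [/\ compact [set: G], hausdorff_space G & totally_disconnected [set: G]].

Inductive gterm : Type :=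
| TVar of nat
| TOne
| TMul of gterm & gterm
| TInv of gterm.

Inductive gformula : Type :=
| FEq of gterm & gterm
| FFalse
| FNot of gformula
| FAnd of gformula & gformula
| FOr of gformula & gformula
| FImp of gformula & gformula
| FAll of nat & gformula
| FEx of nat & gformula.

Fixpoint tvar_in (i : nat) (t : gterm) : bool :=
  match t with
  | TVar j => j == i
  | TOne => false
  | TMul t1 t2 => tvar_in i t1 || tvar_in i t2
  | TInv t1 => tvar_in i t1
  end.

Fixpoint free_in (i : nat) (f : gformula) : bool :=
  match f with
  | FEq t1 t2 => tvar_in i t1 || tvar_in i t2
  | FFalse => false
  | FNot f1 => free_in i f1
  | FAnd f1 f2 | FOr f1 f2 | FImp f1 f2 => free_in i f1 || free_in i f2
  | FAll j f1 | FEx j f1 => (j != i) && free_in i f1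
  end.

Definition sentence (f : gformula) : Prop := forall i, ~~ free_in i f.

Section Semantics.
Variables (T : Type) (mul : T -> T -> T) (inv : T -> T) (one : T).

Fixpoint teval (e : nat -> T) (t : gterm) : T :=
  match t with
  | TVar j => e j
  | TOne => one
  | TMul t1 t2 => mul (teval e t1) (teval e t2)
  | TInv t1 => inv (teval e t1)
  end.

Definition upd (e : nat -> T) (j : nat) (x : T) : nat -> T :=
  fun i => if i == j then x else e i.

Fixpoint holds (e : nat -> T) (f : gformula) : Prop :=
  match f with
  | FEq t1 t2 => teval e t1 = teval e t2
  | FFalse => False
  | FNot f1 => ~ holds e f1
  | FAnd f1 f2 => holds e f1 /\ holds e f2
  | FOr f1 f2 => holds e f1 \/ holds e f2
  | FImp f1 f2 => holds e f1 -> holds e f2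
  | FAll j f1 => forall x : T, holds (upd e j x) f1
  | FEx j f1 => exists x : T, holds (upd e j x) f1
  end.

(* Satisfaction of a sentence (its truth value does not depend on the
   assignment; we require it under every assignment). *)
Definition models (f : gformula) : Prop := forall e : nat -> T, holds e f.
End Semantics.

Definition group_models (G : groupType) (f : gformula) : Prop :=
  models (fun x y : G => (x * y)%g) (fun x : G => (x^-1)%g) 1%g f.

Definition W_models (p m d : nat) (f : gformula) : Prop :=
  models (@Wmul p m d) (@Winv p m d) (@Wone p m d) f.

Definition cont_iso_W (p m d : nat) (G : topGroupType) (phi : G -> Wlim p m d)
  : Prop :=
  [/\ bijective phi, continuous phi &
      forall x y : G, phi (x * y)%g = Wmul (phi x) (phi y)].

(* Main.v *)
(* The group W = M x| X, with X = Z_p^d and M free of rank m over the completed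
   group ring Z_p[[X]], is recognised as follows.  X and M are the centralizers
   of a basis element x_0 of X and of a basis element a_0 of M.  As the ring is
   regular local with parameters p, x_0 - 1, ..., x_(d-1) - 1, freeness of M on
   a_0, ..., a_(m-1) follows from two first-order conditions: these parameters
   form a regular sequence on M, and the a_j are a basis of the quotient of M by
   them.  The passage to M / (q, x_i^q - 1), with q a power of p, uses that
   (x_i - 1)^q is x_i^q - 1 modulo p.
   Two more axioms force a profinite model to be pro-p.  "[h, a_0] = [h^p, u]
   with u in M only for h = 1" kills the p-divisible part of X, since there h is
   a limit of powers h^(p^r) with r > 0.  "h - 1 is injective on M for h <> 1"
   kills the p-divisible part of M: an average over a pro-p group exists on it,
   so it lies in (h - 1)M for every h <> 1, and h can be taken close to 1. *)
Require Import Defs.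
From HB Require Import structures.
From mathcomp Require Import all_boot all_order all_algebra.
From mathcomp Require Import all_classical all_reals all_analysis.
From mathcomp Require Import zify.
Set Implicit Arguments. Unset Strict Implicit. Unset Printing Implicit Defensive.
Import GRing.Theory.
Local Open Scope ring_scope.

(** * Regular sequences on a module over a group ring *)

(** The completed group ring itself never occurs. Freeness is used only in the quotients of M by (q,
    x_i^q - 1): each of them is shown to be free on the a_j over the group ring of C_q^d with
    coefficients in Z/q, by finitely many division steps and without a limit. Compactness enters
    afterwards: it shows that these submodules are closed with trivial intersection, and that a
    compatible family of coordinates comes from an element of the group. For the wreath product the
    obstacle is that torsion-freeness and regularity fail at every finite level: M_n has p-torsion,
    and x_k - 1 kills the sum over a cycle of x_k. The transition map to the level below sends
    p-torsion to zero and adds up the elements fixed by a translation in orbits of size p, so that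
    these conditions hold after the loss of one level. Witnesses found at each level separately are
    made compatible by Koenig's lemma. *)

Module RegSeq.
Lemma subrACA (V : zmodType) (a b c d : V) : a - b - (c - d) = a - c - (b - d).
Proof. by rewrite !opprB [d - c]addrC addrACA [- b + d]addrC. Qed.

Section RegularSequences.
Variables (A H : zmodType) (act : H -> A -> A).
Hypothesis actB : forall h u v, act h (u - v) = act h u - act h v.
Hypothesis act0 : forall v, act 0 v = v.
Hypothesis actDl : forall h k v, act (h + k) v = act h (act k v).

Lemma act_0 h : act h 0 = 0.
Proof. by rewrite -[in LHS](subrr 0) actB subrr. Qed.
Lemma actN h v : act h (- v) = - act h v.
Proof. by rewrite -[- v]sub0r actB act_0 sub0r. Qed.
Lemma actD h u v : act h (u + v) = act h u + act h v.
Proof. by rewrite -{1}[v]opprK actB actN opprK. Qed.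
Lemma act_sum h (I : Type) (r : seq I) (P : pred I) (F : I -> A) :
  act h (\sum_(i <- r | P i) F i) = \sum_(i <- r | P i) act h (F i).
Proof. exact: (big_morph (act h) (actD h) (act_0 h)). Qed.
Lemma actMn h v n : act h (v *+ n) = act h v *+ n.
Proof. by elim: n => [|n IH]; rewrite ?mulr0n ?act_0 // !mulrS actD IH. Qed.
Lemma actMz h v (n : int) : act h (v *~ n) = act h v *~ n.
Proof. by case: n => n; rewrite ?NegzE ?mulrNz ?actN -!pmulrn actMn. Qed.
Lemma actC h k v : act h (act k v) = act k (act h v).
Proof. by rewrite -!actDl addrC. Qed.

Definition dif h v := act h v - v.
Lemma difB h u v : dif h (u - v) = dif h u - dif h v.
Proof. by rewrite /dif actB !opprD !opprK addrACA. Qed.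
Lemma dif_0 h : dif h 0 = 0.
Proof. by rewrite -[in LHS](subrr 0) difB subrr. Qed.
Lemma difN h v : dif h (- v) = - dif h v.
Proof. by rewrite -[- v]sub0r difB dif_0 sub0r. Qed.
Lemma difD h u v : dif h (u + v) = dif h u + dif h v.
Proof. by rewrite -{1}[v]opprK difB difN opprK. Qed.
Lemma difMn h v n : dif h (v *+ n) = dif h v *+ n.
Proof. by elim: n => [|n IH]; rewrite ?mulr0n ?dif_0 // !mulrS difD IH. Qed.
Lemma difC h k v : dif h (dif k v) = dif k (dif h v).
Proof. by rewrite /dif !actB actC !opprD !opprK addrACA. Qed.

Definition pdif h e v := iter e (dif h) v.
Lemma pdifB h e u v : pdif h e (u - v) = pdif h e u - pdif h e v.
Proof. by elim: e => //= e; rewrite /pdif /= => ->; rewrite difB. Qed.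
Lemma pdif_0 h e : pdif h e 0 = 0.
Proof. by rewrite -[in LHS](subrr 0) pdifB subrr. Qed.
Lemma pdifN h e v : pdif h e (- v) = - pdif h e v.
Proof. by rewrite -[- v]sub0r pdifB pdif_0 sub0r. Qed.
Lemma pdifD h e u v : pdif h e (u + v) = pdif h e u + pdif h e v.
Proof. by rewrite -{1}[v]opprK pdifB pdifN opprK. Qed.
Lemma pdif_act h e k v : pdif h e (act k v) = act k (pdif h e v).
Proof.
elim: e v => // e IH v; rewrite /pdif !iterSr -!/(pdif _ _ _).
by rewrite -IH /dif actB actC.
Qed.
Lemma pdifC h e k f v : pdif h e (pdif k f v) = pdif k f (pdif h e v).
Proof.
elim: f v => // f IH v; rewrite /pdif !iterSr -!/(pdif _ _ _) IH.
by rewrite /dif pdifB pdif_act.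
Qed.
Lemma pdifS h e v : pdif h e.+1 v = dif h (pdif h e v). Proof. by []. Qed.
Lemma pdifSr h e v : pdif h e.+1 v = pdif h e (dif h v).
Proof. exact: iterSr. Qed.

Record submod (N : A -> Prop) : Prop := Submod {
  sm0 : N 0; smB : forall u v, N u -> N v -> N (u - v);
  smA : forall h v, N v -> N (act h v) }.

Lemma smN N v : submod N -> N v -> N (- v).
Proof. by move=> sN Nv; rewrite -sub0r; apply: smB => //; apply: sm0. Qed.
Lemma smD N u v : submod N -> N u -> N v -> N (u + v).
Proof. by move=> sN Nu Nv; rewrite -[v]opprK; apply: smB => //; apply: smN. Qed.
Lemma sm_dif N h v : submod N -> N v -> N (dif h v).
Proof. by move=> sN Nv; apply: smB => //; apply: smA. Qed.
Lemma sm_pdif N h e v : submod N -> N v -> N (pdif h e v).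
Proof. by move=> sN Nv; elim: e => // e IH; rewrite pdifS; apply: sm_dif. Qed.
Lemma sm_sum N (I : Type) (r : seq I) (P : pred I) (F : I -> A) : submod N ->
  (forall i, P i -> N (F i)) -> N (\sum_(i <- r | P i) F i).
Proof. by move=> sN; apply: big_ind; [apply: sm0 | move=> *; apply: smD]. Qed.
Definition addsm (N : A -> Prop) h e v := exists n w, N n /\ v = n + pdif h e w.

Lemma addsm_sub N h e v : N v -> addsm N h e v.
Proof. by move=> Nv; exists v, 0; rewrite pdif_0 addr0. Qed.
Lemma addsm_pdif N h e v : submod N -> addsm N h e (pdif h e v).
Proof. by move=> sN; exists 0, v; rewrite add0r; split => //; apply: sm0. Qed.

Lemma addsm_submod N h e : submod N -> submod (addsm N h e).
Proof.
move=> sN; split; first by apply: addsm_sub; apply: sm0.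
  move=> _ _ [n [w [Nn ->]]] [n' [w' [Nn' ->]]]; exists (n - n'), (w - w').
  by split; [apply: smB | rewrite pdifB opprD addrACA].
move=> k _ [n [w [Nn ->]]]; exists (act k n), (act k w).
by rewrite actD pdif_act; split => //; apply: smA.
Qed.

Lemma addsm_mono N N' h e : (forall v, N v -> N' v) ->
  forall v, addsm N h e v -> addsm N' h e v.
Proof. by move=> NN' _ [n [w [Nn ->]]]; exists n, w; split => //; apply: NN'. Qed.

Lemma addsmC N h e k f v : addsm (addsm N h e) k f v -> addsm (addsm N k f) h e v.
Proof.
move=> [_ [w [[n [w' [Nn ->]] ->]]]]; exists (n + pdif k f w), w'.
by rewrite addrAC; split => //; exists n, w.
Qed.

Definition regular (N : A -> Prop) h := forall v, N (dif h v) -> N v.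

Lemma regular_ext N N' h : (forall v, N v <-> N' v) -> regular N h -> regular N' h.
Proof. by move=> NN' r v /NN' /r /NN'. Qed.

Lemma regular_pdif N h e v : regular N h -> N (pdif h e v) -> N v.
Proof. by move=> r; elim: e => //= e IH /r. Qed.

(** A weakly regular sequence on A / N: the last quotient may vanish. *)
Fixpoint regseq (N : A -> Prop) (l : seq H) : Prop :=
  if l is h :: l' then regular N h /\ regseq (addsm N h 1) l' else True.

Lemma regseq_ext N N' l : (forall v, N v <-> N' v) -> regseq N l -> regseq N' l.
Proof.
elim: l N N' => //= h l IH N N' NN' [r s]; split; first exact: regular_ext r.
by apply: IH s => v; split; apply: addsm_mono => w /NN'.
Qed.

(** Induction on e: v vanishes modulo N + (h - 1)A, so it is (h - 1)v' modulo N, and cancelling one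
    factor h - 1 leaves a relation for v' with exponent e. *)
Lemma regular_addsm N h e k : submod N -> regular N h ->
  regular (addsm N h 1) k -> regular (addsm N h e) k.
Proof.
move=> sN rh rk; elim: e => [|e IH] v.
  by move=> _; exists 0, v; rewrite add0r; split => //; apply: sm0.
move=> [n [w [Nn E]]].
have [|n' [v' [Nn' Ev]]] := rk v.
  by rewrite E; exists n, (pdif h e w).
have {}Ev : v = n' + dif h v' by [].
suff [n2 [w2 [Nn2 Ev']]] : addsm N h e v'.
  exists (n' + dif h n2), w2; rewrite pdifS -addrA -difD -Ev'; split => //.
  by apply: smD => //; apply: sm_dif.
apply: IH; exists (dif k v' - pdif h e w), w; split; last by rewrite subrK.
apply: rh; rewrite difB -pdifS.
have -> : dif h (dif k v') - pdif h e.+1 w = n - dif k n'.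
  have E' : dif k (dif h v') = n + pdif h e.+1 w - dif k n'.
    by rewrite -E Ev difD addrC addKr.
  by rewrite difC E' addrAC addrK.
by apply: smB => //; apply: sm_dif.
Qed.

(** The half of exchanging two members of a regular sequence that holds over any ring: in (h - 1)v =
    n + (k - 1)^e w, regularity of k makes w a multiple of h - 1 modulo N, and then h - 1
    cancels. *)
Lemma regular_swap N h k e : submod N -> regular N h ->
  regular (addsm N h 1) k -> regular (addsm N k e) h.
Proof.
move=> sN rh rk v [n [w [Nn E]]].
have [|n' [w' [Nn' Ew]]] := @regular_pdif _ _ e w rk.
  have -> : pdif k e w = dif h v - n by rewrite E addrC addKr.
  by apply: smB; [exact: addsm_submod | apply: (addsm_pdif h 1) | apply: addsm_sub].
have {}Ew : w = n' + dif h w' by [].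
exists (v - pdif k e w'), w'; split; last by rewrite subrK.
apply: rh; rewrite difB E Ew.
have -> : dif h (pdif k e w') = pdif k e (dif h w') by exact: (pdifC h 1).
rewrite pdifD addrA addrK; apply: smD => //; exact: sm_pdif.
Qed.

(** The later members are moved past h by [addsmC], and h stays regular modulo each of them by
    [regular_swap]; so [regular_addsm] applies at every stage. *)
Lemma regseq_addsm N h e l : submod N -> regular N h ->
  regseq (addsm N h 1) l -> regseq (addsm N h e) l.
Proof.
elim: l N => //= k l IH N sN rh [rk s]; split; first exact: regular_addsm.
apply: (@regseq_ext (addsm (addsm N k 1) h e)).
  by move=> v; split; apply: addsmC.
apply: IH; [exact: addsm_submod | exact: regular_swap |].
by apply: regseq_ext s => v; split; apply: addsmC.
Qed.

Definition addsms N (l : seq (H * nat)) := foldl (fun N he => addsm N he.1 he.2) N l.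

Lemma addsms_submod N l : submod N -> submod (addsms N l).
Proof. by elim: l N => //= h l IH N sN; apply: IH; apply: addsm_submod. Qed.
Lemma addsms_sub N l v : N v -> addsms N l v.
Proof. by elim: l N => //= h l IH N Nv; apply: IH; apply: addsm_sub. Qed.
Lemma addsms_mono N N' l : (forall v, N v -> N' v) ->
  forall v, addsms N l v -> addsms N' l v.
Proof. by elim: l N N' => //= h l IH N N' NN'; apply: IH; apply: addsm_mono. Qed.
Lemma addsms_cat N l l' : addsms N (l ++ l') = addsms (addsms N l) l'.
Proof. exact: foldl_cat. Qed.
Lemma addsmsC N h e l v : addsms (addsm N h e) l v <-> addsm (addsms N l) h e v.
Proof.
elim: l N v => //= k l IH N v; rewrite -IH.
by split; apply: addsms_mono => w; apply: addsmC.
Qed.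
Lemma addsms_split N l v : submod N ->
  addsms N l v <-> exists n z, [/\ N n, addsms (fun x => x = 0) l z & v = n + z].
Proof.
move=> sN; elim/last_ind: l v => [|l h IH] v.
  split=> [Nv|[n [z [Nn -> ->]]]]; last by rewrite addr0.
  by exists v, 0; rewrite addr0.
rewrite -cats1 !addsms_cat /=; split.
  move=> [n [w [/IH [n' [z [Nn' zz ->]] ->]]]].
  exists n', (z + pdif h.1 h.2 w); rewrite addrA; split => //.
  by exists z, w.
move=> [n [_ [Nn [z [w [Hz ->]]] ->]]]; exists (n + z), w; rewrite addrA.
by split => //; apply/IH; exists n, z.
Qed.

(** Repeated [regular_swap]; once k is adjoined with exponent q, the rest of the sequence is regular
    again by [regseq_addsm]. *)
Lemma regular_addsms N h l q : submod N -> regular N h ->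
  regseq (addsm N h 1) l -> regular (addsms N [seq (k, q) | k <- l]) h.
Proof.
elim: l N => //= k l IH N sN rh [rk s]; apply: IH.
- exact: addsm_submod.
- exact: regular_swap.
have := regseq_addsm q (addsm_submod h 1 sN) rk s.
by apply: regseq_ext => v; split; apply: addsmC.
Qed.

Lemma regseq_addsms N l l' q : submod N -> regseq N (l ++ l') ->
  regseq (addsms N [seq (k, q) | k <- l]) l'.
Proof.
elim: l N => //= h l IH N sN [rh s]; apply: IH; first exact: addsm_submod.
exact: regseq_addsm.
Qed.

(* The coefficients of a relation are found by synthetic division by [x - 1]. *)
Lemma sum_act_sub N V h k (v : nat -> A) : submod N -> regular N h ->
  (forall u w, V u -> V w -> V (u - w)) -> V 0 ->
  (forall w, V w -> addsm N h 1 w -> N w) ->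
  (forall b, V (v b)) ->
  addsm N h k (\sum_(0 <= b < k) act (h *+ b) (v b)) ->
  forall b, (b < k)%N -> N (v b).
Proof.
move=> sN rh VB V0 VN.
have VD u w : V u -> V w -> V (u + w).
  by move=> Vu Vw; rewrite -[w]opprK; apply: (VB) => //; rewrite -sub0r; apply: VB.
elim: k v => // k IH v Vv sumN.
(* Division by h - 1 has remainder s 0, the value at h = 1, and the tail sums s 1, ..., s k are the
   coefficients of the quotient. *)
pose s b := \sum_(b <= c < k.+1) v c.
have Vs b : V (s b) by rewrite /s; apply: big_ind => // *; exact: VD.
have Es : \sum_(0 <= b < k.+1) act (h *+ b) (v b) =
    s 0%N + dif h (\sum_(0 <= b < k) act (h *+ b) (s b.+1)).
  have sE b : (b < k.+1)%N -> v b = s b - s b.+1.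
    by move=> lb; rewrite /s (big_ltn lb) addrK.
  rewrite (eq_big_nat _ _ (F2 := fun b => act (h *+ b) (s b) - act (h *+ b) (s b.+1))); last first.
    by move=> b /andP[_ lb]; rewrite sE // actB.
  rewrite sumrB big_nat_recl // mulr0n act0 [X in _ - X]big_nat_recr //=.
  have -> : s k.+1 = 0 by rewrite /s big_geq.
  rewrite act_0 addr0 /dif act_sum -addrA; congr (_ + (_ - _)).
  by apply: eq_bigr => b _; rewrite -actDl mulrS.
have Ns0 : N (s 0%N).
  apply: VN => //.
  have -> : s 0%N = \sum_(0 <= b < k.+1) act (h *+ b) (v b) -
      dif h (\sum_(0 <= b < k) act (h *+ b) (s b.+1)) by rewrite Es addrK.
  apply: smB; first exact: addsm_submod; last exact: (addsm_pdif h 1).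
  by case: sumN => n [w [Nn ->]]; exists n, (pdif h k w).
(* As s 0 lies in N, cancelling h - 1 leaves a relation among s 1, ..., s k modulo (h - 1)^k, to
   which the induction hypothesis applies. *)
have Nsb b : (b < k.+1)%N -> N (s b).
  case: b => // b lb; apply: (IH (fun b => s b.+1)) => //.
  have [n [w [Nn]]] := sumN; rewrite Es => E.
  exists (\sum_(0 <= b0 < k) act (h *+ b0) (s b0.+1) - pdif h k w), w; rewrite subrK; split => //.
  apply: rh; rewrite difB -pdifS.
  have -> : dif h (\sum_(0 <= b0 < k) act (h *+ b0) (s b0.+1)) - pdif h k.+1 w = n - s 0%N.
    by apply/eqP; rewrite subr_eq addrAC -E addrC addKr.
  exact: smB.
move=> b lb; have -> : v b = s b - s b.+1 by rewrite /s (big_ltn lb) addrK.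
apply: smB => //; first exact: Nsb.
have [lb'|] := ltnP b.+1 k.+1; first exact: Nsb.
by move=> le; rewrite /s big_geq //; apply: sm0.
Qed.

End RegularSequences.
End RegSeq.
Import RegSeq.

(** * Freeness of the quotients modulo q and the x_i^q - 1 *)

Section FreeModules.
Variables (A H : zmodType) (act : H -> A -> A).
Hypothesis actB : forall h u v, act h (u - v) = act h u - act h v.
Hypothesis act0 : forall v, act 0 v = v.
Hypothesis actDl : forall h k v, act (h + k) v = act h (act k v).
Variable p : nat.
Hypothesis p_pr : prime p.
Notation dif := (dif act).
Notation pdif := (pdif act).
Notation submod := (submod act).
Notation addsm := (addsm act).
Notation addsms := (addsms act).
Notation regular := (regular act).
Notation regseq := (regseq act).

Local Notation smD := (@RegSeq.smD A H act _ _ _).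
Local Notation smB := (@RegSeq.smB A H act _ _ _ _).
Local Notation smN := (@RegSeq.smN A H act _ _).
Local Notation sm0 := (@RegSeq.sm0 A H act _).
Local Notation smA := (@RegSeq.smA A H act _ _ _ _).
Local Notation sm_dif := (@RegSeq.sm_dif A H act _ _ _).
Local Notation sm_sum := (@RegSeq.sm_sum A H act _ _ _ _ _).

Definition multiple q (v : A) := exists u, v = u *+ q.

Lemma multiple_submod q : submod (multiple q).
Proof.
split; first by exists 0; rewrite mul0rn.
  by move=> _ _ [u ->] [w ->]; exists (u - w); rewrite mulrnBl.
by move=> h _ [u ->]; exists (act h u); rewrite actMn.
Qed.
Hint Resolve multiple_submod : core.

Lemma act_binomial h n v :
  act (h *+ n) v = \sum_(i < n.+1) pdif h i v *+ 'C(n, i).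
Proof.
elim: n v => [|n IH] v; first by rewrite big_ord1 mulr0n act0.
have actE u : act h u = u + dif h u by rewrite /RegSeq.dif addrC subrK.
rewrite mulrSr actDl IH.
under eq_bigr => i _ do rewrite actE -/(pdif h 0 v) pdifD // -pdifSr mulrnDl.
rewrite big_split /= [RHS]big_ord_recl /= bin0 [X in X + _]big_ord_recl bin0 /= -addrA.
congr (_ + _); under [RHS]eq_bigr => i _ do rewrite binS mulrnDr.
rewrite big_split /= [X in _ + X = _]big_ord_recr [X in _ = X + _]big_ord_recr /=.
rewrite !binn bin_small // mulr0n addr0; congr (_ + _).
by rewrite big_ord_recr /= binn.
Qed.

Lemma dif_frobenius h v : multiple p (pdif h p v - dif (h *+ p) v).
Proof.
have [p' Ep] : exists p', p = p'.+1 by exists p.-1; rewrite prednK ?prime_gt0.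
rewrite Ep /RegSeq.dif act_binomial big_ord_recr big_ord_recl /= bin0 binn !mulr1n.
rewrite -pdifS; set S := \sum_(_ < _) _; set P := pdif _ _ _.
have -> : P - (v + S + P - v) = - S.
  by rewrite [v + S + P - v]addrAC [v + S]addrC addrK opprD addrCA subrr addr0.
apply: smN => //; apply: sm_sum => // i _.
have /dvdnP[c ->] : (p'.+1 %| 'C(p'.+1, bump 0 i))%N.
  by apply: prime_dvd_bin; [rewrite -Ep | rewrite /bump /= ltnS].
by exists (pdif h (bump 0 i) v *+ c); rewrite -mulrnA.
Qed.

Lemma dif_frobenius_exp h e v : multiple p (pdif h (p ^ e) v - dif (h *+ (p ^ e)) v).
Proof.
elim: e v => [|e IH] v; first by rewrite expn0 subrr; apply: sm0.
rewrite expnS /RegSeq.pdif iterM mulnC mulrnA.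
have cmp n u : multiple p (iter n (pdif h (p ^ e)) u - iter n (dif (h *+ (p ^ e))) u).
  elim: n => [|n IHn] /=; first by rewrite subrr; apply: sm0.
  set F := iter n _ u; set G := iter n _ u.
  rewrite -(subrK (dif (h *+ (p ^ e)) F) (pdif h (p ^ e) F)) -addrA -difB //.
  by apply: smD => //; apply: sm_dif.
rewrite -(subrK (iter p (dif (h *+ (p ^ e))) v) (iter p _ v)) -addrA.
by apply: smD => //; apply: dif_frobenius.
Qed.

Lemma addsm_frobenius N h e v : submod N -> (forall u, multiple p u -> N u) ->
  addsm N h (p ^ e) v <-> addsm N (h *+ (p ^ e)) 1 v.
Proof.
move=> sN pN; split=> -[n [w [Nn ->]]].
  exists (n + (pdif h (p ^ e) w - dif (h *+ (p ^ e)) w)), w.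
  split; last by rewrite -addrA (_ : pdif (h *+ (p ^ e)) 1 w = dif (h *+ (p ^ e)) w) // subrK.
  by apply: smD => //; apply: pN; apply: dif_frobenius_exp.
exists (n - (pdif h (p ^ e) w - dif (h *+ (p ^ e)) w)), w.
split; last by rewrite (_ : pdif (h *+ (p ^ e)) 1 w = dif (h *+ (p ^ e)) w) // opprB -addrA subrK.
by apply: smB => //; apply: pN; apply: dif_frobenius_exp.
Qed.

Variables (d m : nat) (x : nat -> H) (a : 'I_m -> A).
(** The parameter p comes first because (x_i - 1)^q and x_i^q - 1 agree only modulo p. *)
Fixpoint filtr k := if k is k'.+1 then addsm (filtr k') (x k') 1 else multiple p.

Hypothesis tf : forall v : A, v *+ p = 0 -> v = 0.
Hypothesis reg : forall k, (k < d)%N -> regular (filtr k) (x k).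

(** Coefficients are integers rather than residues, so that the same family makes sense modulo every
    power of p. *)
Definition comb (c : 'I_m -> int) := \sum_j a j *~ c j.
Hypothesis indep : forall c, filtr d (comb c) -> forall j, (p %| c j)%Z.
Hypothesis gen : forall v, exists c, filtr d (v - comb c).

Lemma filtr_submod k : submod (filtr k).
Proof. by elim: k => //= k IH; apply: addsm_submod. Qed.
Hint Resolve filtr_submod : core.

Lemma filtr_regseq k n : (k + n = d)%N -> regseq (filtr k) [seq x i | i <- iota k n].
Proof.
elim: n k => //= n IH k E; split; first by apply: reg; lia.
by apply: (IH k.+1); lia.
Qed.

Lemma filtr_multiple k v : multiple p v -> filtr k v.
Proof. by move=> pv; elim: k => //= k IH; apply: addsm_sub. Qed.

(** q is a successor so that ['I_q] is inhabited and can later be identified, by conversion, with a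
    ring of residues. *)
Variables (q' e : nat).
Let q := q'.+1.
Hypothesis qE : q = (p ^ e)%N.

Let X := {ffun 'I_d -> 'I_q}.
Definition mon (z : X) := \sum_(i < d) x i *+ z i.
(** Evaluation on the a_j of an element of the free module of rank m over the integral group ring of
    C_q^d, with exponents lifted to 0, ..., q - 1. *)
Definition Psi (c : X -> 'I_m -> int) := \sum_z act (mon z) (comb (c z)).

Definition powers k n := [seq (x i, q) | i <- iota k n].

(** Exponents of monomials in x_k, ..., x_(d-1) only; [repl] below sets the exponent of a single
    x_k. *)
Let low k (z : X) := [forall i : 'I_d, (i < k)%N ==> (z i == ord0)].
Let repl (z : X) (k : 'I_d) b : X := [ffun i => if i == k then b else z i].

Lemma lowS (k : 'I_d) (z : X) : low k.+1 z = low k z && (z k == ord0).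
Proof.
apply/forallP/andP=> [lz|[/forallP lz zk] i].
  split; last by have := lz k; rewrite ltnSn.
  by apply/forallP=> i; apply/implyP=> ik; have /implyP := lz i; apply; apply: ltnW.
rewrite ltnS leq_eqVlt; apply/implyP=> /orP[/eqP/val_inj -> //|ik].
by have /implyP := lz i; apply.
Qed.

Lemma low_repl (k : 'I_d) (z : X) b : low k (repl z k b) = low k z.
Proof.
apply: eq_forallb => i; rewrite ffunE; have [->|//] := eqVneq i k.
by rewrite ltnn.
Qed.

Lemma mon_repl (k : 'I_d) (z : X) b : z k = ord0 -> mon (repl z k b) = x k *+ b + mon z.
Proof.
move=> zk; rewrite /mon (bigD1 k) //= [in RHS](bigD1 k) //= zk mulr0n add0r.
rewrite ffunE eqxx; congr (_ + _); apply: eq_bigr => i ik.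
by rewrite ffunE (negPf ik).
Qed.

Lemma sum_low (k : 'I_d) (w : X -> A) :
  \sum_(z | low k z) act (mon z) (w z) =
  \sum_(0 <= b < q) act (x k *+ b)
     (\sum_(z | low k.+1 z) act (mon z) (w (repl z k (inord b)))).
Proof.
rewrite big_mkord (partition_big (fun z : X => z k) xpredT) //=.
apply: eq_bigr => b _; rewrite act_sum // inord_val.
rewrite (reindex_onto (fun z => repl z k b) (fun z => repl z k ord0)) /=.
  apply: eq_big => [z|z].
    rewrite low_repl lowS ffunE eqxx eqxx andbT; congr (_ && _).
    apply/eqP/eqP=> [<-|zk]; first by rewrite ffunE eqxx.
    by apply/ffunP=> i; rewrite !ffunE; have [->|] := eqVneq i k.
  move=> /andP[_ /eqP Ez]; rewrite mon_repl ?actDl //.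
  by rewrite -Ez ffunE eqxx.
move=> z /andP[_ /eqP zk]; apply/ffunP=> i; rewrite !ffunE.
by have [->|] := eqVneq i k.
Qed.

Definition spanned (v : A) := exists c, v = comb c.
Lemma spannedB u v : spanned u -> spanned v -> spanned (u - v).
Proof.
move=> [c ->] [c' ->]; exists (fun j => c j - c' j).
by rewrite /comb -sumrB; apply: eq_bigr => j _; rewrite mulrzBr.
Qed.
Lemma spanned0 : spanned 0.
Proof. by exists (fun _ => 0); rewrite /comb big1 // => j _; rewrite mulr0z. Qed.

Lemma comb_multiple c : (forall j, (p %| c j)%Z) -> multiple p (comb c).
Proof.
move=> pc; apply: sm_sum => // j _; have /dvdzP[k ->] := pc j.
by exists (a j *~ k); rewrite mulrzA.
Qed.

(** Descending induction on k, through n = d - k. A relation is read as a polynomial in x_k with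
    coefficients in the later variables; [sum_act_sub] kills each coefficient modulo [filtr k] and
    the later powers, and then the case k + 1 applies to it. *)
Lemma low_indep n k w : (k + n = d)%N -> (forall z, spanned (w z)) ->
  addsms (filtr k) (powers k n) (\sum_(z | low k z) act (mon z) (w z)) ->
  forall z, low k z -> multiple p (w z).
Proof.
elim: n k w => [|n IH] k w E sw /=.
  rewrite addn0 in E; subst k.
  have l0 z : low d z = (z == [ffun=> ord0]).
    apply/forallP/eqP=> [lz|-> i]; last by rewrite ffunE eqxx implybT.
    by apply/ffunP=> i; rewrite ffunE; apply/eqP; have /implyP := lz i; apply.
  rewrite (big_pred1 _ l0) => + z; rewrite l0 => + /eqP ->.
  have -> : mon [ffun=> ord0] = 0.
    by rewrite /mon big1 // => i _; rewrite ffunE mulr0n.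
  rewrite act0; have [c ->] := sw [ffun=> ord0].
  by move=> /indep; apply: comb_multiple.
have kd : (k < d)%N by lia.
have Ek : (k.+1 + n = d)%N by lia.
pose ki := Ordinal kd; rewrite (sum_low ki) => /(addsmsC _) Hs.
set N := addsms (filtr k) (powers k.+1 n) in Hs.
have sN : submod N by apply: addsms_submod.
have rN : regular N (x k).
  rewrite /N /powers (_ : [seq _ | i <- _] = [seq (h, q) | h <- [seq x i | i <- iota k.+1 n]]).
    by apply: regular_addsms => //; [exact: reg | apply: (filtr_regseq Ek)].
  by rewrite -map_comp.
(* The coefficients allowed in [sum_act_sub]. If one of them lies in N + (x_k - 1)A, the induction
   hypothesis makes its own coefficients multiples of p, so it lies in N. *)
pose V u := exists w', (forall z, spanned (w' z)) /\
  u = \sum_(z | low k.+1 z) act (mon z) (w' z).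
have V0 : V 0.
  exists (fun _ => 0); split=> [z|]; first exact: spanned0.
  by rewrite big1 // => z _; rewrite act_0.
have VB u v : V u -> V v -> V (u - v).
  move=> [w1 [s1 ->]] [w2 [s2 ->]]; exists (fun z => w1 z - w2 z).
  split=> [z|]; first exact: spannedB.
  by rewrite -sumrB; apply: eq_bigr => z _; rewrite actB.
have VN u : V u -> addsm N (x k) 1 u -> N u.
  move=> [w' [sw' ->]] /(addsmsC _) Hu.
  apply: addsms_sub => //; apply: sm_sum => // z lz.
  by apply: smA => //; apply: filtr_multiple; apply: (IH k.+1) lz.
have Vb (b : nat) : V (\sum_(z | low k.+1 z) act (mon z) (w (repl z ki (inord b)))).
  by exists (fun z => w (repl z ki (inord b))).
have Nb := sum_act_sub actB act0 actDl sN rN VB V0 VN Vb Hs.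
move=> z lz.
have -> : z = repl (repl z ki ord0) ki (inord (z ki)).
  by apply/ffunP=> i; rewrite !ffunE inord_val; have [->|] := eqVneq i ki.
apply: (IH k.+1 (fun y => w (repl y ki (inord (z ki))))) => //.
  apply/(addsmsC _); apply: addsm_sub => //; apply: Nb; exact: ltn_ord.
by rewrite (lowS ki) low_repl /= lz ffunE eqxx.
Qed.

Definition level k := [seq (x i *+ q, 1%N) | i <- iota 0 k].
Definition zlevel k := addsms (fun v => v = 0) (level k).
(** The modulus r is independent of q: independence is proved for r = p, p^2, ... with the relations
    x_i^q = 1 held fixed. *)
Definition Nq r v := exists u z, zlevel d z /\ v = u *+ r + z.

Lemma zero_submod : submod (fun v : A => v = 0).
Proof. by split=> [//|_ _ -> ->|h _ ->]; rewrite ?subrr ?act_0. Qed.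
Hint Resolve zero_submod : core.
Lemma zlevel_submod k : submod (zlevel k).
Proof. exact: addsms_submod. Qed.
Hint Resolve zlevel_submod : core.

Lemma zlevelS k : zlevel k.+1 = addsm (zlevel k) (x k *+ q) 1.
Proof. by rewrite /zlevel /level -[k.+1]addn1 iotaD map_cat addsms_cat. Qed.

Lemma NqP r v : Nq r v <-> addsms (multiple r) (level d) v.
Proof.
rewrite addsms_split //; split.
  by move=> [u [z [zz ->]]]; exists (u *+ r), z; split => //; exists u.
by move=> [_ [z [[u ->] zz ->]]]; exists u, z.
Qed.

Lemma Nq_submod r : submod (Nq r).
Proof.
have sN : submod (addsms (multiple r) (level d)) by apply: addsms_submod.
split; first by apply/NqP; apply: sm0.
  by move=> u v /NqP Nu /NqP Nv; apply/NqP; apply: smB.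
by move=> h v /NqP Nv; apply/NqP; apply: smA.
Qed.

Lemma powers_level k v : addsms (multiple p) (powers 0 k) v <->
  addsms (multiple p) (level k) v.
Proof.
elim: k v => [|k IH] v //.
rewrite /powers /level -[k.+1]addn1 iotaD !map_cat !addsms_cat /= add0n.
have -> : addsms (multiple p) [seq (x i, q) | i <- iota 0 k] =
          addsms (multiple p) (powers 0 k) by [].
have -> : addsms (multiple p) [seq (x i *+ q, 1%N) | i <- iota 0 k] =
          addsms (multiple p) (level k) by [].
rewrite {1}qE addsm_frobenius -?qE.
- by split; apply: addsm_mono => u /IH.
- exact: addsms_submod.
by move=> u; apply: addsms_sub.
Qed.

(** Modulo p both the submodule and the operator can be exchanged for q-th powers of the x_i - 1,
    and a power of a regular operator is regular. *)
Lemma regular_level k : (k < d)%N ->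
  regular (addsms (multiple p) (level k)) (x k *+ q).
Proof.
move=> kd; have Ed : (0 + d = d)%N by [].
have E : iota 0 d = iota 0 k ++ iota k (d - k) by rewrite -iotaD subnKC // ltnW.
have r : regular (addsms (multiple p) (powers 0 k)) (x k).
  have H0 := filtr_regseq Ed; rewrite E map_cat in H0.
  have := regseq_addsms actB actDl q (multiple_submod p) H0.
  by rewrite -(subnSK kd) /= -map_comp => -[].
move=> v /powers_level; set N := addsms _ _ in r *; move=> Nv.
have sN : submod N by apply: addsms_submod.
suff Np : N (pdif (x k) q v) by apply/powers_level; exact: regular_pdif r Np.
rewrite -(subrK (dif (x k *+ q) v) (pdif (x k) q v)); apply: smD => //.
by apply: addsms_sub => //; rewrite qE; apply: dif_frobenius_exp.
Qed.

(** Another exchange, now of p with the x_i^q - 1: in p v = z + (x_k^q - 1)u, [regular_level] gives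
    u = p w modulo [zlevel k], and the induction hypothesis applies to v - (x_k^q - 1)w. *)
Lemma zlevel_pure k v : (k <= d)%N -> zlevel k (v *+ p) -> zlevel k v.
Proof.
elim: k v => [|k IH] v kd; first exact: tf.
rewrite zlevelS => -[z [u [zz E]]].
have {}E : v *+ p = z + dif (x k *+ q) u by [].
have [|_ [s [[w ->] zs Eu]]] := iffLR (addsms_split _ _ (multiple_submod p)) (@regular_level _ kd u _) => //.
  apply/addsms_split => //; exists (v *+ p), (- z).
  split; [by exists v | exact: smN (zlevel_submod k) zz | by rewrite E [z + _]addrC addrK].
exists (v - dif (x k *+ q) w), w; split; last by rewrite subrK.
apply: IH; first exact: ltnW.
rewrite mulrnBl E Eu difD // difMn // addrA addrAC addrK.
by apply: smD => //; apply: sm_dif.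
Qed.

Lemma zlevel_dif k w : (k < d)%N -> zlevel d (dif (x k *+ q) w).
Proof.
move=> kd; rewrite /zlevel /level -(subnKC kd) iotaD map_cat addsms_cat.
apply: addsms_sub => //; rewrite -[addsms _ _]/(zlevel k.+1) zlevelS.
exact: (@addsm_pdif _ _ _ (zlevel k) (x k *+ q) 1 w (zlevel_submod k)).
Qed.

Lemma Nq_zlevel r v : zlevel d v -> Nq r v.
Proof. by move=> zv; exists 0, v; rewrite mul0rn add0r. Qed.
Lemma Nq_multiple r v : multiple r v -> Nq r v.
Proof. by move=> [u ->]; exists u, 0; rewrite addr0; split => //; apply: sm0. Qed.
Hint Resolve Nq_submod : core.

Lemma Psi_ext c c' : (forall z j, c z j = c' z j) -> Psi c = Psi c'.
Proof.
by move=> E; apply: eq_bigr => z _; congr act; apply: eq_bigr => j _; rewrite E.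
Qed.

Lemma PsiB c c' : Psi (fun z j => c z j - c' z j) = Psi c - Psi c'.
Proof.
rewrite /Psi -sumrB; apply: eq_bigr => z _; rewrite -actB; congr act.
by rewrite /comb -sumrB; apply: eq_bigr => j _; rewrite mulrzBr.
Qed.

Lemma comb_scale c n : comb (fun j => c j * n) = comb c *~ n.
Proof.
rewrite /comb (big_morph (fun v => v *~ n) (mulrzDl n) (mul0rz _ n)).
by apply: eq_bigr => j _; rewrite mulrzA.
Qed.

Lemma Psi_scale c n : Psi (fun z j => c z j * n) = Psi c *~ n.
Proof.
rewrite /Psi (big_morph (fun v => v *~ n) (mulrzDl n) (mul0rz _ n)).
by apply: eq_bigr => z _; rewrite -actMz // comb_scale.
Qed.

Lemma Psi_multiple r c : (forall z j, (r%:Z %| c z j)%Z) -> multiple r (Psi c).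
Proof.
move=> pc; rewrite (@Psi_ext _ (fun z j => (c z j %/ r)%Z * r)).
  by rewrite Psi_scale; exists (Psi (fun z j => (c z j %/ r)%Z)).
by move=> z j; rewrite divzK.
Qed.

Lemma Psi_indep_modp c : Nq p (Psi c) -> forall z j, (p %| c z j)%Z.
Proof.
move=> /NqP/powers_level Nc z.
have Ed : (0 + d = d)%N by [].
have lz y : low 0 y by apply/forallP.
have sp y : spanned (comb (c y)) by exists (c y).
have Hc : addsms (filtr 0) (powers 0 d) (\sum_(y | low 0 y) act (mon y) (comb (c y))).
  by rewrite (eq_bigl xpredT).
have [u E] := low_indep Ed sp Hc (lz z).
by apply: indep; apply: filtr_multiple; exists u.
Qed.

(** Once all coefficients are divisible by p, [zlevel_pure] allows the relation to be divided by
    p. *)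
Lemma Psi_indep_exp k c : Nq (p ^ k) (Psi c) -> forall z j, (p%:Z ^+ k %| c z j)%Z.
Proof.
elim: k c => [|k IH] c Nc z j; first by rewrite expr0 dvd1z.
have pc : forall z j, (p %| c z j)%Z.
  apply: Psi_indep_modp; have [u [y [zy ->]]] := Nc.
  by exists (u *+ (p ^ k)), y; rewrite -mulrnA -expnSr.
pose c' z j := (c z j %/ p)%Z.
have cE y i : c y i = c' y i * p by rewrite divzK.
rewrite cE exprSr dvdz_mul //; apply: IH.
have [u [y [zy]]] := Nc; rewrite (Psi_ext cE) Psi_scale -pmulrn => E.
exists u, (Psi c' - u *+ (p ^ k)); split; last by rewrite subrKC.
by apply: zlevel_pure => //; rewrite mulrnBl E -mulrnA -expnSr addrC addKr.
Qed.

Lemma Psi_indep c : Nq q (Psi c) -> forall z j, (q%:Z %| c z j)%Z.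
Proof. by rewrite qE => /Psi_indep_exp + z j => /(_ z j); rewrite -[(p ^ e)%N%:Z]natz natrX natz. Qed.

(** Reducing an exponent modulo q drops factors x_i^q, which act trivially modulo [zlevel d]. *)
Lemma act_mon_mod (n : 'I_d -> nat) (z : X) w :
  (forall i, z i = n i %% q :> nat)%N ->
  Nq q (act (\sum_(i < d) x i *+ n i) w - act (mon z) w).
Proof.
move=> zE; rewrite /mon; move: w.
apply: (big_ind2 (fun h h' => forall w, Nq q (act h w - act h' w))).
- by move=> w; rewrite subrr; apply: sm0.
- move=> h h' k k' IH IH' w; rewrite !actDl // -(subrK (act h (act k' w)) (act h (act k w))).
  by rewrite -addrA -actB; apply: smD => //; apply: smA.
move=> i _ w; rewrite zE {1}(divn_eq (n i) q) mulrnDr actDl //.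
set u := act _ w; elim: (n i %/ q)%N => [|k IH].
  by rewrite mul0n act0 subrr; apply: sm0.
rewrite mulSn mulrnDr actDl // -(subrK (act (x i *+ (k * q)) u) (act (x i *+ q) _)) -addrA.
by apply: smD => //; apply: Nq_zlevel; apply: zlevel_dif.
Qed.

Lemma act_mon_add (y z s : X) w : (forall i, s i = (y i + z i) %% q :> nat)%N ->
  Nq q (act (mon y) (act (mon z) w) - act (mon s) w).
Proof.
move=> sE; have := act_mon_mod w sE.
have E : \sum_(i < d) x i *+ (y i + z i)%N = mon y + mon z.
  by rewrite -big_split; apply: eq_bigr => i _; rewrite mulrnDr.
by rewrite E actDl.
Qed.

Definition Psi_span v := exists c, Nq q (v - Psi c).

Lemma Psi_spanB u v : Psi_span u -> Psi_span v -> Psi_span (u - v).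
Proof.
move=> [c Nc] [c' Nc']; exists (fun z j => c z j - c' z j).
by rewrite PsiB subrACA; apply: smB.
Qed.

Lemma Psi_span_Nq v : Nq q v -> Psi_span v.
Proof.
move=> Nv; exists (fun _ _ => 0); rewrite /Psi big1 ?subr0 // => z _.
by rewrite /comb big1 ?act_0 // => j _; rewrite mulr0z.
Qed.

Lemma Psi_span_sub u v : Nq q (u - v) -> Psi_span v -> Psi_span u.
Proof.
by move=> Nuv [c Nc]; exists c; rewrite -(subrK v u) -addrA; apply: smD.
Qed.

Lemma Psi_span0 : Psi_span 0.
Proof. by apply: Psi_span_Nq; apply: sm0. Qed.

Lemma Psi_spanD u v : Psi_span u -> Psi_span v -> Psi_span (u + v).
Proof.
move=> Su Sv; rewrite -[v]opprK; apply: Psi_spanB => //.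
by rewrite -sub0r; apply: Psi_spanB => //; exact: Psi_span0.
Qed.

Lemma Psi_span_mon z c : Psi_span (act (mon z) (comb c)).
Proof.
exists (fun y j => if y == z then c j else 0).
rewrite /Psi (bigD1 z) //= eqxx big1 ?addr0 ?subrr; first exact: sm0.
move=> y /negPf ->; rewrite /comb big1 ?act_0 // => j _; exact: mulr0z.
Qed.

Lemma Psi_span_act k v : (k < d)%N -> Psi_span v -> Psi_span (act (x k) v).
Proof.
move=> kd [c Nc]; apply: (@Psi_span_sub _ (act (x k) (Psi c))).
  by rewrite -actB; apply: smA.
rewrite act_sum //; apply: big_ind => [||z _]; [exact: Psi_span0 | exact: Psi_spanD |].
pose n (i : 'I_d) := ((i == k :> nat) + z i)%N.
have E : x k + mon z = \sum_(i < d) x i *+ n i.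
  rewrite /n; under [RHS]eq_bigr => i _ do rewrite mulrnDr.
  rewrite big_split; congr (_ + _).
  rewrite (bigD1 (Ordinal kd)) //= eqxx mulr1n big1 ?addr0 // => i /eqP ik.
  by case: eqP => // Ei; case: ik; apply: val_inj.
rewrite -actDl E; have lt i : (n i %% q < q)%N by rewrite ltn_pmod.
pose s : X := [ffun i => Ordinal (lt i)].
apply: (@Psi_span_sub _ (act (mon s) (comb (c z)))); last exact: Psi_span_mon.
by apply: act_mon_mod => i; rewrite ffunE.
Qed.

(** Descending induction on k. Each pass treats the remainder modulo [filtr k.+1] and gains a factor
    x_k - 1; after q passes (x_k - 1)^q is x_k^q - 1 modulo p, which [Nq q] absorbs. *)
Lemma Psi_span_filtr k v : (k <= d)%N ->
  exists s, Psi_span s /\ filtr k (v - s).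
Proof.
move=> kd; rewrite -(subKn kd); move: (d - k)%N (leq_subr k d) => n {k kd}.
elim: n v => [|n IH] v nd.
  rewrite subn0; have [c Fc] := gen v; exists (comb c); split => //.
  by have := Psi_span_mon [ffun=> ord0] c; rewrite /mon big1 ?act0 // => i _; rewrite ffunE mulr0n.
set k := (d - n.+1)%N; have kS : (d - n = k.+1)%N by rewrite /k; lia.
have kd : (k < d)%N by lia.
rewrite kS in IH.
have dS u r : Psi_span u -> Psi_span (pdif (x k) r u).
  elim: r => // r IHr Su; rewrite pdifS; apply: Psi_spanB; last exact: IHr.
  by apply: Psi_span_act => //; exact: IHr.
have step r : exists s f w, [/\ Psi_span s, filtr k f & v = s + f + pdif (x k) r w].
  elim: r => [|r [s [f [w [Ss Ff ->]]]]].
    exists 0, 0, v; rewrite !add0r; split => //; first exact: Psi_span0.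
    exact: sm0.
  have [s' [Ss' [f' [w' [Ff' E']]]]] := IH w (ltnW nd).
  exists (s + pdif (x k) r s'), (f + pdif (x k) r f'), w'; split.
  - by apply: Psi_spanD => //; apply: dS.
  - by apply: smD => //; apply: sm_pdif.
  have -> : w = s' + (f' + dif (x k) w') by rewrite -[dif _ _]/(pdif (x k) 1 w') -E' subrKC.
  by rewrite pdifSr // pdifD // [pdif _ _ (f' + _)]pdifD // -!addrA; congr (s + _); rewrite addrCA.
have [s [f [w [Ss Ff ->]]]] := step q.
exists (s + dif (x k *+ q) w); split.
  by apply: Psi_spanD => //; apply: Psi_span_Nq; apply: Nq_zlevel; apply: zlevel_dif.
rewrite opprD addrACA [s + f]addrC addrK; apply: smD => //.
by apply: filtr_multiple; rewrite qE; apply: dif_frobenius_exp.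
Qed.

(** The same iteration with p in place of x_k - 1; it stops after e rounds because p^e = q. *)
Lemma Psi_gen v : Psi_span v.
Proof.
suff step r : exists s w, Psi_span s /\ v = s + w *+ (p ^ r).
  have [s [w [Ss ->]]] := step e; apply: Psi_spanD => //.
  by apply: Psi_span_Nq; apply: Nq_multiple; rewrite qE; exists w.
elim: r => [|r [s [w [Ss ->]]]].
  by exists 0, v; rewrite add0r; split => //; exact: Psi_span0.
have [s' [Ss' [u E]]] := Psi_span_filtr w (leq0n d).
exists (s + s' *+ (p ^ r)), u; split.
  apply: Psi_spanD => //; elim: (p ^ r)%N => [|n IH]; first exact: Psi_span0.
  by rewrite mulrS; apply: Psi_spanD.
by rewrite -(subrK s' w) E mulrnDl -mulrnA -expnS [u *+ _ + _]addrC addrA.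
Qed.

End FreeModules.

(** * Profinite groups *)

Section Topology.
Local Close Scope ring_scope.
Local Open Scope classical_set_scope.
Section Compact.
Variable T : topologicalType.
Hypothesis cT : compact [set: T].

(** If no A lies in O, the sets A minus O generate a proper filter, and a cluster point of it lies
    in every A but not in O. *)
Lemma compact_directed (F : set (set T)) (O : set T) :
  F !=set0 -> (forall A, F A -> closed A) ->
  (forall A B, F A -> F B -> exists2 C, F C & C `<=` A `&` B) ->
  open O -> (forall y, (forall A, F A -> A y) -> O y) ->
  exists2 A, F A & A `<=` O.
Proof.
move=> F0 Fcl Fdir oO FO; apply: contrapT => nF.
pose B := filter_from F (fun A => A `&` ~` O).
have FB : Filter B.
  apply: filter_from_filter => // A A' FA FA'; have [C FC CA] := Fdir _ _ FA FA'.
  by exists C => // y [Cy nOy]; have [] := CA y Cy.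
have PB : ProperFilter B.
  apply: filter_from_proper => // A FA; apply: contrapT => AO.
  apply: nF; exists A => // y Ay; apply: contrapT => nOy.
  by apply: AO; exists y.
have [y [_ cly]] := cT PB filterT.
have in_cl A : closed A -> B A -> A y.
  by move=> clA BA; apply: clA => U Uy; exact: cly.
have nOy : (~` O) y.
  apply: in_cl; first exact: open_closedC.
  by have [A FA] := F0; exists A => // z [].
by apply: nOy; apply: FO => A FA; apply: in_cl; [exact: Fcl | exists A => // z []].
Qed.

Lemma compact_nested (C : nat -> set T) :
  (forall n, closed (C n)) -> (forall n, C n.+1 `<=` C n) ->
  (forall n, C n !=set0) -> exists y, forall n, C n y.
Proof.
move=> clC dec ne; apply: contrapT => nC.
have mono n k : C (n + k)%N `<=` C n.
  by elim: k => [|k IH]; rewrite ?addn0 ?addnS // => y /dec /IH.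
have [|||||_ [k _ <-] CE] := @compact_directed (range C) set0.
- by exists (C 0%N); exists 0%N.
- by move=> _ [n _ <-].
- move=> _ _ [n _ <-] [k _ <-]; exists (C (n + k)%N); first by exists (n + k)%N.
  by move=> y Cy; split; [exact: mono Cy | apply: (mono k n); rewrite addnC].
- exact: open0.
- by move=> y Hy; case: nC; exists y => n; apply: Hy; exists n.
by have [y /CE] := ne k.
Qed.

Hypothesis hT : hausdorff_space T.

Lemma closed_separation (A B : set T) : closed A -> closed B -> A `&` B = set0 ->
  exists U V, [/\ open U, open V, A `<=` U, B `<=` V & U `&` V = set0].
Proof.
move=> clA clB AB.
have [|C CA CB] := @compact_normal T hT cT A clA (~` B).
  move=> x Ax; apply: open_nbhs_nbhs; split; first exact: closed_openC.
  by move=> Bx; have : (A `&` B) x by []; rewrite AB.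
exists C^°, (~` closure C); split.
- exact: open_interior.
- by apply: closed_openC; exact: closed_closure.
- by move=> x /CA.
- by move=> x Bx /CB; apply.
by apply/seteqP; split => // x [/interior_subset/subset_closure].
Qed.

(** The intersection Q of the clopen neighbourhoods of x is connected: a splitting of Q extends to
    disjoint open sets U and V, some clopen neighbourhood K of x lies in their union, and U and V
    cut K into clopen pieces. Hence Q is the single point x. *)
Lemma disconnected_clopen (x : T) (O : set T) :
  totally_disconnected [set: T] -> open O -> O x ->
  exists C, [/\ clopen C, C x & C `<=` O].
Proof.
move=> tdT oO Ox.
pose F := [set C : set T | clopen C /\ C x].
have FT : F setT by split => //; exact: clopenT.
have FI A B : F A -> F B -> F (A `&` B).
  by move=> [cA Ax] [cB Bx]; split; [exact: clopenI | split].
pose Q := [set y | forall C, F C -> C y].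
have QO U : open U -> Q `<=` U -> exists2 C, F C & C `<=` U.
  move=> oU QU; apply: compact_directed => //.
  - by exists setT.
  - by move=> A [[]].
  - by move=> A B FA FB; exists (A `&` B) => //; exact: FI.
suff QE : Q `<=` [set x].
  have [|C [cC Cx] CO] := @QO O oO; first by move=> y /QE ->.
  by exists C.
have Qx : Q x by move=> C [].
have clQ : closed Q.
  have -> : Q = \bigcap_(C in F) C by apply/seteqP; split.
  by apply: closed_bigI => C [[]].
rewrite -(tdT x) //; apply: connected_component_max => //.
move=> B [b Bb] [C1 oC1 E1] [C2 clC2 E2].
have [U [V [oU oV AU AV UV]]] : exists U V,
    [/\ open U, open V, Q `&` C2 `<=` U, Q `&` ~` C1 `<=` V & U `&` V = set0].
  apply: closed_separation.
  - exact: closedI.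
  - by apply: closedI => //; exact: open_closedC.
  rewrite -E2 E1; apply/seteqP; split => // y [[_ ?] [_]]; exact.
have [||K [cK Kx] KUV] := QO (U `|` V); first exact: openU.
  move=> y Qy; have [Cy|nCy] := pselect (C1 y); last by right; apply: AV.
  by left; apply: AU; rewrite -E2 E1.
have clop U' V' : open U' -> open V' -> K `<=` U' `|` V' -> U' `&` V' = set0 -> clopen (K `&` U').
  move=> oU' oV' KU UV'; split; first by apply: openI => //; case: cK.
  have -> : K `&` U' = K `&` ~` V'.
    apply/seteqP; split => y [Ky]; last by case: (KU y Ky).
    by move=> Uy; split => // Vy; have : (U' `&` V') y by []; rewrite UV'.
  by apply: closedI; [case: cK | exact: open_closedC].
case: (KUV x Kx) => [Ux|Vx].
  have QU : Q `<=` U.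
    by move=> y /(_ (K `&` U)) [] //; split => //; exact: clop V oU oV KUV UV.
  apply/seteqP; split => y; first by rewrite E1 => -[].
  move=> Qy; rewrite E1; split => //; apply: contrapT => nCy.
  by have : (U `&` V) y; [split; [exact: QU | exact: AV] | rewrite UV].
have QV : Q `<=` V.
  move=> y /(_ (K `&` V)) [] //; split => //.
  by apply: (clop V U) => //; rewrite ?[V `|` _]setUC // setIC.
have : (U `&` V) b; last by rewrite UV.
split; first by apply: AU; rewrite -E2.
by apply: QV; move: Bb; rewrite E1 => -[].
Qed.

End Compact.

(** * Open normal subgroups and closed sets in a profinite group *)

Section Profinite.
Local Open Scope group_scope.
Variable G : topGroupType.

Lemma continuous_mul (T : topologicalType) (f g : T -> G) :
  continuous f -> continuous g -> continuous (fun t => f t * g t).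
Proof.
move=> cf cg t; apply: (@continuous_comp _ _ _ (fun t => (f t, g t)) (fun xy : G * G => xy.1 * xy.2)).
  by apply: cvg_pair; [exact: cf | exact: cg].
exact: mulg_continuous.
Qed.

Lemma continuous_inv (T : topologicalType) (f : T -> G) :
  continuous f -> continuous (fun t => (f t)^-1).
Proof.
move=> cf t; apply: (@continuous_comp _ _ _ f (fun x : G => x^-1)); first exact: cf.
exact: invg_continuous.
Qed.

Lemma continuous_exp (T : topologicalType) (f : T -> G) n :
  continuous f -> continuous (fun t => f t ^+ n).
Proof.
move=> cf; elim: n => [|n IH].
  by under eq_fun => t do rewrite expg0; exact: cst_continuous.
by under eq_fun => t do rewrite expgS; exact: continuous_mul.
Qed.

Definition open_normal (K : set G) :=
  [/\ nbhs 1 K, forall x y, K x -> K y -> K (x * y),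
      forall x, K x -> K x^-1 & forall x c, K x -> K (c * x * c^-1)].

Lemma open_normal1 K : open_normal K -> K 1.
Proof. by move=> [/nbhs_singleton]. Qed.

Lemma open_normal_coset K x : open_normal K -> nbhs x [set y | K (x^-1 * y)].
Proof.
move=> [nK _ _ _].
have := @continuous_mul G (fun=> x^-1) id (@cst_continuous _ _ _) (fun x => cvg_id) x.
by rewrite /continuous_at mulVg; apply.
Qed.

Lemma open_normal_open K : open_normal K -> open K.
Proof.
move=> oK; rewrite openE => x Kx; apply: filterS (open_normal_coset x oK) => y Ky.
by case: oK => _ Km _ _; rewrite -(mulVKg x y); exact: Km.
Qed.

Lemma open_normal_closed K : open_normal K -> closed K.
Proof.
move=> oK x clx; have [y [Ky /= Kxy]] := clx _ (open_normal_coset x oK).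
have -> : x = y * (x^-1 * y)^-1 by rewrite invgM invgK mulVKg.
by case: oK => _ Km Ki _; apply: Km => //; exact: Ki.
Qed.

Hypothesis pG : profinite G.

Lemma open_normal_basis (O : set G) : nbhs 1 O ->
  exists2 K, open_normal K & K `<=` O.
Proof.
rewrite nbhsE => -[W [oW W1] WO]; case: pG => cG hG tG.
have [V [[oV clV] V1 VO]] := disconnected_clopen cG hG tG oW W1.
(* The g all of whose conjugates preserve the clopen set V under right translation. Quantifying over
   conjugates makes K normal at once; compactness of G x G makes it a neighbourhood of 1. *)
pose K := [set g | forall c v : G, V v <-> V (v * (c * g * c^-1))].
exists K; last first.
  by move=> g /(_ 1 1); rewrite !mul1g invg1 mulg1 => -[+ _] => /(_ V1)/VO/WO.
split.
- have cGG : compact [set: G * G].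
    by rewrite -setXTT; exact: compact_setX.
  have /compact_near_coveringP/(_ G (nbhs (1 : G))) := cGG.
  move=> /(_ (fun g cv => V cv.2 <-> V (cv.2 * (cv.1 * g * cv.1^-1)))) H.
  apply: filterS (H _ _) => [g Hg c v|[c v] _]; first exact: (Hg (c, v)).
  pose f (t : G * G * G) := t.1.2 * (t.1.1 * t.2 * t.1.1^-1).
  have cfst : continuous (fun t : G * G * G => t.1.1).
    by move=> t; apply: continuous_comp; exact: cvg_fst.
  have csnd : continuous (fun t : G * G * G => t.1.2).
    by move=> t; apply: continuous_comp; [exact: cvg_fst|exact: cvg_snd].
  have cf : continuous f.
    apply: continuous_mul => //; apply: continuous_mul; last exact: continuous_inv.
    by apply: continuous_mul => // t; exact: cvg_snd.
  have f1 : f (c, v, 1) = v by rewrite /f /= mulg1 mulgV mulg1.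
  have near_const (U : set G) : open U -> U v ->
      nbhs (c, v, 1 : G) [set t : G * G * G | U t.1.2 /\ U (f t)].
    move=> oU Uv; apply: filterI.
      by apply: csnd; exact: open_nbhs_nbhs.
    by apply: cf; rewrite f1; exact: open_nbhs_nbhs.
  have [Vv|nVv] := pselect (V v).
    by apply: filterS (near_const V oV Vv) => t [].
  apply: filterS (near_const (~` V) (closed_openC clV) nVv) => t [n1 n2].
  by split.
- move=> x y Kx Ky c v.
  have -> : c * (x * y) * c^-1 = (c * x * c^-1) * (c * y * c^-1).
    by rewrite !mulgA mulgVK.
  by rewrite mulgA -Ky; exact: Kx.
- move=> x Kx c v; rewrite (Kx c (v * (c * x^-1 * c^-1))).
  have -> : v * (c * x^-1 * c^-1) * (c * x * c^-1) = v; last by [].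
  by rewrite -!mulgA mulKg mulKg mulgV mulg1.
move=> x c Kx c' v; have := Kx (c' * c) v.
by rewrite invgM !mulgA.
Qed.

(** The cosets of open normal subgroups are a base of neighbourhoods. *)
Lemma closed_mem (C : set G) x : closed C ->
  (forall K, open_normal K -> exists2 y, C y & K (x^-1 * y)) -> C x.
Proof.
move=> clC H; apply: clC => U Ux.
have : nbhs 1 [set y | U (x * y)].
  have := @continuous_mul G (fun=> x) id (@cst_continuous _ _ _) (fun x => cvg_id) 1.
  by rewrite /continuous_at mulg1; apply.
move=> /open_normal_basis [K oK KU]; have [y Cy Ky] := H K oK.
by exists y; split => //; rewrite -(mulVKg x y); exact: KU.
Qed.

Lemma open_normal_separated x : (forall K, open_normal K -> K x) -> x = 1.
Proof.
move=> H; case: pG => cG hG _.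
have cl1 : closed [set 1 : G] by apply: compact_closed => //; exact: compact_set1.
apply: (@closed_mem [set 1] x cl1) => K oK; exists 1 => //.
by rewrite mulg1; case: (oK) => _ _ Ki _; apply: Ki; exact: H.
Qed.

(** The coset of a cluster point is visited at arbitrarily late indices. *)
Lemma coset_pigeonhole (g : nat -> G) K : open_normal K ->
  exists n k, (n < k)%N /\ K ((g n)^-1 * g k).
Proof.
move=> oK; case: pG => cG _ _.
have [y [_ cly]] := cG (g @ \oo) _ filterT.
have nK := open_normal_coset y oK; case: (oK) => _ Km Ki _.
have fin N : exists2 n, (N <= n)%N & K (y^-1 * g n).
  have [|_ [[n /= Nn <-] Kn]] := cly (g @` [set n | (N <= n)%N]) _ _ nK; last by exists n.
  by exists N => // n /= Nn; exists n.
have [n _ Kn] := fin 0%N; have [k nk Kk] := fin n.+1.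
exists n, k; split => //; have := Km _ _ (Ki _ Kn) Kk.
by rewrite invgM invgK -mulgA mulVKg.
Qed.

(** Phrased through closed sets because the limits below are used only to pass closed conditions to
    them. *)
Lemma cluster_point (g : nat -> G) : exists y : G, forall C : set G, closed C ->
  (exists N, forall n, (N <= n)%N -> C (g n)) -> C y.
Proof.
case: pG => cG _ _; have [y [_ cly]] := cG (g @ \oo) _ filterT.
exists y => C clC [N HN]; apply: clC => U Uy.
have [|z [Cz Uz]] := cly C U _ Uy; last by exists z.
by exists N => // n /= Nn; exact: HN.
Qed.

Lemma closed_continuous_preimage (f : G -> G) (C : set G) :
  continuous f -> closed C -> closed [set g | C (f g)].
Proof. by move=> cf clC; apply: (@preimage_closed _ _ f C) => // x _; exact: cf. Qed.

Lemma closed_equalizer (f g : G -> G) :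
  continuous f -> continuous g -> closed [set x | f x = g x].
Proof.
move=> cf cg; case: pG => cG hG _.
have cl1 : closed [set 1 : G] by apply: compact_closed => //; exact: compact_set1.
have -> : [set x | f x = g x] = [set x | [set 1 : G] (f x * (g x)^-1)].
  apply/seteqP; split => x /= => [->|E]; first by rewrite mulgV.
  by rewrite -(mulgVK (g x) (f x)) E mul1g.
by apply: closed_continuous_preimage => //; apply: continuous_mul => //; exact: continuous_inv.
Qed.

Lemma closed_image (f : G -> G) (C : set G) :
  continuous f -> closed C -> closed (f @` C).
Proof.
move=> cf clC; case: pG => cG hG _; apply: compact_closed => //.
apply: continuous_compact; first exact: continuous_subspaceT.
exact: (subclosed_compact clC cG).
Qed.

Lemma closed_prod (A B : set G) : closed A -> closed B ->
  closed [set z | exists x y, [/\ A x, B y & z = x * y]].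
Proof.
move=> clA clB; case: pG => cG hG _; apply: compact_closed => //.
have -> : [set z | exists x y, [/\ A x, B y & z = x * y]] =
    (fun xy : G * G => xy.1 * xy.2) @` (A `*` B).
  apply/seteqP; split => [_ [x [y [Ax By ->]]]|_ [[x y] [/= Ax By] <-]]; last by exists x, y.
  by exists (x, y).
apply: continuous_compact.
  by apply: continuous_subspaceT => xy; exact: mulg_continuous.
by apply: compact_setX; [exact: (subclosed_compact clA cG)|exact: (subclosed_compact clB cG)].
Qed.

End Profinite.
End Topology.

(** * The axioms and the sentence encoding them *)

Section FirstOrder.
Local Close Scope ring_scope.
Section Characterization.
Variables (p m d : nat) (T : Type) (mul : T -> T -> T) (inv : T -> T) (one : T).
(* The parameters: [e 0, ..., e (d - 1)] is the basis of the top group and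
   [e d, ..., e (d + m - 1)] the basis of the base group. *)
Variable e : nat -> T.

Definition gcomm (u v : T) := mul u v = mul v u.
Definition in_base v := gcomm v (e d).
Definition in_top h := gcomm h (e 0).
Definition gpow x k := iter k (mul x) one.
Definition gconj g v := mul (mul g v) (inv g).
Definition gdif h v := mul (gconj h v) (inv v).

(** The multiplicative form of [filtr]. The recursion is on a fixed number, so it unfolds to a
    first-order formula. *)
Fixpoint in_filtr k v : Prop :=
  if k is k'.+1 then
    exists w u, [/\ in_filtr k' w, in_base u & v = mul w (gdif (e k') u)]
  else exists2 u, in_base u & v = gpow u p.

Fixpoint gprod i (c : seq nat) :=
  if c is k :: c' then mul (gpow (e i) k) (gprod i.+1 c') else one.

(** An explicit list, so that quantifying over vectors of residues modulo p becomes a finite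
    disjunction or conjunction. *)
Fixpoint exponents n : seq (seq nat) :=
  if n is n'.+1 then [seq k :: c | k <- iota 0 p, c <- exponents n'] else [:: [::]].

(** Each field is elementary: i, j, k and c range over fixed finite sets, and all other quantifiers
    range over group elements. *)
Record wreath_axioms : Prop := WreathAxioms {
  ax_base : forall j, j < m -> in_base (e (d + j));
  ax_top : forall i, i < d -> in_top (e i);
  ax_baseC : forall u v, in_base u -> in_base v -> gcomm u v;
  ax_topC : forall u v, in_top u -> in_top v -> gcomm u v;
  ax_baseJ : forall g v, in_base v -> in_base (gconj g v);
  ax_split : forall g, exists v h, [/\ in_base v, in_top h & g = mul v h];
  ax_disjoint : forall g, in_base g -> in_top g -> g = one;
  ax_top_tf : forall h, in_top h -> gpow h p = one -> h = one;
  ax_top_gen : forall h, in_top h -> exists2 c, c \in exponents d &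
    exists2 k, in_top k & h = mul (gprod 0 c) (gpow k p);
  ax_top_indep : forall c, c \in exponents d -> forall k, in_top k ->
    gprod 0 c = gpow k p -> all (pred1 0) c;
  ax_base_tf : forall v, in_base v -> gpow v p = one -> v = one;
  ax_base_reg : forall k, k < d -> forall v, in_base v ->
    in_filtr k (gdif (e k) v) -> in_filtr k v;
  ax_base_gen : forall v, in_base v -> exists2 c, c \in exponents m &
    exists2 w, in_filtr d w & v = mul (gprod d c) w;
  ax_base_indep : forall c, c \in exponents m -> in_filtr d (gprod d c) ->
    all (pred1 0) c;
  ax_faithful : forall h v, in_top h -> in_base v -> gdif h v = one ->
    h = one \/ v = one;
  ax_reduced : forall h u, in_top h -> in_base u ->
    gdif h (e d) = gdif (gpow h p) u -> h = one }.

End Characterization.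

Lemma mem_exponents p n c :
  (c \in exponents p n) = (size c == n) && all (fun k => k < p) c.
Proof.
elim: n c => [|n IH] [|k c] //=.
  by apply/allpairsP => -[[a b] [_ _]].
apply/allpairsP/idP => [[[a b] /= [+ + [-> ->]]]|].
  by rewrite IH mem_iota add0n eqSS => /= -> /andP[-> ->].
rewrite eqSS => /and3P[sc kp ac]; exists (k, c); split => //=.
  by rewrite mem_iota.
by rewrite IH sc.
Qed.

(** * Translation of the axioms into a first-order sentence *)

Section Formula.

Definition tbound N (t : gterm) := forall i, tvar_in i t -> i < N.
Definition fbound N (f : gformula) := forall i, free_in i f -> i < N.

Definition FTrue := FNot FFalse.
Definition FAnds (s : seq gformula) := foldr FAnd FTrue s.
Definition FOrs (s : seq gformula) := foldr FOr FFalse s.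
Definition FExs n f := foldr FEx f (iota 0 n).

Section Semantics.
Variables (T : Type) (mul : T -> T -> T) (inv : T -> T) (one : T).
Notation holds := (holds mul inv one).
Notation teval := (teval mul inv one).

Lemma teval_ext t e e' N : tbound N t -> (forall i, i < N -> e i = e' i) ->
  teval e t = teval e' t.
Proof.
move=> + E; elim: t => //= [i|t1 IH1 t2 IH2|t IH] bt.
- by apply: E; apply: bt => /=.
- by rewrite IH1 ?IH2 // => i ti; apply: bt => /=; rewrite ti ?orbT.
- by rewrite IH.
Qed.

Lemma teval_upd t e N x : tbound N t -> teval (upd e N x) t = teval e t.
Proof.
move=> bt; apply: teval_ext bt _ => i iN; rewrite /upd.
by case: eqP iN => // ->; rewrite ltnn.
Qed.

Lemma upd_eq e N (x : T) : upd e N x N = x. Proof. by rewrite /upd eqxx. Qed.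
Lemma upd_lt e N (x : T) i : i < N -> upd e N x i = e i.
Proof. by rewrite /upd; case: eqP => // ->; rewrite ltnn. Qed.

Lemma holds_ands e s : holds e (FAnds s) <-> (forall k, k < size s -> holds e (nth FTrue s k)).
Proof.
elim: s => [|f s IH] /=; first by split => // _ [].
rewrite IH; split=> [[Hf Hs] [|k] //= /Hs //|H].
by split=> [|k ks]; [exact: (H 0) | exact: (H k.+1)].
Qed.

Lemma holds_ands_map (I : eqType) e (s : seq I) (f : I -> gformula) :
  holds e (FAnds [seq f i | i <- s]) <-> (forall i, i \in s -> holds e (f i)).
Proof.
elim: s => [|i s IH] /=; first by split => // _ [].
rewrite IH; split=> [[Hf Hs] j|H].
  by rewrite inE => /predU1P[->|/Hs].
by split=> [|j js]; apply: H; rewrite inE ?eqxx // js orbT.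
Qed.

Lemma holds_ors_map (I : eqType) e (s : seq I) (f : I -> gformula) :
  holds e (FOrs [seq f i | i <- s]) <-> (exists2 i, i \in s & holds e (f i)).
Proof.
elim: s => [|i s IH] /=; first by split => // -[].
rewrite IH; split=> [[Hi|[j js Hj]]|[j]].
- by exists i; rewrite ?inE ?eqxx.
- by exists j; rewrite ?inE ?js ?orbT.
- by rewrite inE => /predU1P[->|js Hj]; [left | right; exists j].
Qed.

Lemma holds_exs n e f : holds e (FExs n f) <->
  exists2 e', (forall i, n <= i -> e' i = e i) & holds e' f.
Proof.
rewrite /FExs; elim: n f => [|n IH] f.
  split=> [H|[e' E H]]; first by exists e.
  by rewrite (_ : e = e') //; apply: boolp.funext => i; rewrite E.
rewrite -[n.+1]addn1 iotaD foldr_cat /= IH; split.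
  move=> [e' E [x Hx]]; exists (upd e' n x) => // i; rewrite addn1 => ni.
  by rewrite /upd gtn_eqF // E // ltnW.
move=> [e' E H]; exists (upd e' n (e n)).
  move=> i; rewrite leq_eqVlt /upd => /predU1P[->|ni]; first by rewrite eqxx.
  by rewrite gtn_eqF // E // addn1.
exists (e' n); rewrite (_ : upd _ _ _ = e') //; apply: boolp.funext => i.
by rewrite /upd; case: eqP => // ->.
Qed.
End Semantics.

Lemma fbound_exs n f : fbound n f -> sentence (FExs n f).
Proof.
suff H k g : fbound (k + n) g -> fbound k (foldr FEx g (iota k n)).
  by move=> bf i; apply/negP => /(H 0 f bf).
elim: n k g => [|n IH] k g bg /=; first by rewrite addn0 in bg.
have bi : fbound k.+1 (foldr FEx g (iota k.+1 n)) by apply: IH; rewrite addSnnS.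
by move=> i /= /andP[ki /bi]; rewrite ltnS leq_eqVlt eq_sym (negPf ki).
Qed.

Section Encoding.
Variables (p m d : nat).
Hypotheses (m_gt0 : 0 < m) (d_gt0 : 0 < d).
Let n := d + m.

Definition fbase t := FEq (TMul t (TVar d)) (TMul (TVar d) t).
Definition ftop t := FEq (TMul t (TVar 0)) (TMul (TVar 0) t).
Definition tpow t k := iter k (TMul t) TOne.
Definition tconj g v := TMul (TMul g v) (TInv g).
Definition tdif h v := TMul (tconj h v) (TInv v).
Fixpoint tprod i (c : seq nat) :=
  if c is k :: c' then TMul (tpow (TVar i) k) (tprod i.+1 c') else TOne.

(** New binders start at N, so t must use only variables below N. *)
Fixpoint ffiltr k N t :=
  if k is k'.+1 then
    FEx N (FEx N.+1 (FAnd (ffiltr k' N.+2 (TVar N)) (FAnd (fbase (TVar N.+1))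
      (FEq t (TMul (TVar N) (tdif (TVar k') (TVar N.+1)))))))
  else FEx N (FAnd (fbase (TVar N)) (FEq t (tpow (TVar N) p))).

Definition fcomm s t := FEq (TMul s t) (TMul t s).

(** In the order of the fields of [wreath_axioms]. Independence becomes one negation for each
    nonzero vector of exponents. *)
Definition axiom_formulas : seq gformula :=
  let u := TVar n in let v := TVar n.+1 in let w := TVar n.+2 in
  [:: FAnds [seq fbase (TVar (d + j)) | j <- iota 0 m];
      FAnds [seq ftop (TVar i) | i <- iota 0 d];
      FAll n (FAll n.+1 (FImp (fbase u) (FImp (fbase v) (fcomm u v))));
      FAll n (FAll n.+1 (FImp (ftop u) (FImp (ftop v) (fcomm u v))));
      FAll n (FAll n.+1 (FImp (fbase v) (fbase (tconj u v))));
      FAll n (FEx n.+1 (FEx n.+2 (FAnd (fbase v) (FAnd (ftop w) (FEq u (TMul v w))))));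
      FAll n (FImp (fbase u) (FImp (ftop u) (FEq u TOne)));
      FAll n (FImp (ftop u) (FImp (FEq (tpow u p) TOne) (FEq u TOne)));
      FAll n (FImp (ftop u) (FOrs [seq FEx n.+1 (FAnd (ftop v)
        (FEq u (TMul (tprod 0 c) (tpow v p)))) | c <- exponents p d]));
      FAnds [seq FAll n (FImp (ftop u) (FNot (FEq (tprod 0 c) (tpow u p))))
            | c <- [seq c <- exponents p d | ~~ all (pred1 0) c]];
      FAll n (FImp (fbase u) (FImp (FEq (tpow u p) TOne) (FEq u TOne)));
      FAnds [seq FAll n (FImp (fbase u) (FImp (ffiltr k n.+1 (tdif (TVar k) u))
         (ffiltr k n.+1 u))) | k <- iota 0 d];
      FAll n (FImp (fbase u) (FOrs [seq FEx n.+1 (FAnd (ffiltr d n.+2 v)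
        (FEq u (TMul (tprod d c) v))) | c <- exponents p m]));
      FAnds [seq FNot (ffiltr d n (tprod d c))
            | c <- [seq c <- exponents p m | ~~ all (pred1 0) c]];
      FAll n (FAll n.+1 (FImp (ftop u) (FImp (fbase v)
        (FImp (FEq (tdif u v) TOne) (FOr (FEq u TOne) (FEq v TOne))))));
      FAll n (FAll n.+1 (FImp (ftop u) (FImp (fbase v)
        (FImp (FEq (tdif u (TVar d)) (tdif (tpow u p) v)) (FEq u TOne)))))].

Definition wreath_sentence := FExs n (FAnds axiom_formulas).

Fixpoint tvars t := match t with
  | TVar i => i.+1 | TOne => 0
  | TMul s t => maxn (tvars s) (tvars t) | TInv t => tvars t end.
Lemma tbound_tvars N t : tvars t <= N -> tbound N t.
Proof.
elim: t => //= [i|s IHs t IHt].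
- by move=> iN j /eqP <-.
- by rewrite geq_max => /andP[/IHs bs /IHt bt] i /orP[/bs|/bt].
Qed.

Lemma tvars_pow t k : tvars (tpow t k) <= tvars t.
Proof. by elim: k => //= k IH; rewrite geq_max leqnn. Qed.
Lemma tvars_prod i c : tvars (tprod i c) <= i + size c.
Proof.
elim: c i => //= k c IH i; rewrite geq_max addnS -addSn IH andbT.
by rewrite (leq_trans (tvars_pow _ _)) //= addSn ltnS leq_addr.
Qed.

(** A computable sufficient condition for [fbound]: each binder takes exactly the first fresh index
    N, so variables are de Bruijn levels and nothing is captured. *)
Fixpoint bounded N (f : gformula) : bool := match f with
  | FEq s t => (tvars s <= N) && (tvars t <= N)
  | FFalse => true | FNot f => bounded N f
  | FAnd f g | FOr f g | FImp f g => bounded N f && bounded N g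
  | FAll j f | FEx j f => (N == j) && bounded N.+1 f end.

Lemma fbound_bounded N f : bounded N f -> fbound N f.
Proof.
elim: f N => //=.
- by move=> s t N /andP[/tbound_tvars bs /tbound_tvars bt] i /orP[/bs|/bt].
- by move=> f IHf g IHg N /andP[/IHf bf /IHg bg] i /orP[/bf|/bg].
- by move=> f IHf g IHg N /andP[/IHf bf /IHg bg] i /orP[/bf|/bg].
- by move=> f IHf g IHg N /andP[/IHf bf /IHg bg] i /orP[/bf|/bg].
- move=> j f IH N /andP[/eqP <- /IH bf] i /andP[ij /bf].
  by rewrite ltnS leq_eqVlt eq_sym (negPf ij).
- move=> j f IH N /andP[/eqP <- /IH bf] i /andP[ij /bf].
  by rewrite ltnS leq_eqVlt eq_sym (negPf ij).
Qed.

Lemma bounded_ands N (I : eqType) (s : seq I) f :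
  (forall i, i \in s -> bounded N (f i)) -> bounded N (FAnds [seq f i | i <- s]).
Proof.
elim: s => //= i s IH H; rewrite H ?inE ?eqxx //= IH // => j js.
by apply: H; rewrite inE js orbT.
Qed.
Lemma bounded_ors N (I : eqType) (s : seq I) f :
  (forall i, i \in s -> bounded N (f i)) -> bounded N (FOrs [seq f i | i <- s]).
Proof.
elim: s => //= i s IH H; rewrite H ?inE ?eqxx //= IH // => j js.
by apply: H; rewrite inE js orbT.
Qed.

Lemma bounded_filtr k N t : k <= d -> n <= N -> tvars t <= N -> bounded N (ffiltr k N t).
Proof.
move=> kd; elim: k kd N t => [|k IH] kd N t nN tN /=.
  have := tvars_pow (TVar N) p; rewrite !eqxx /= => H.
  by rewrite H; move: H; rewrite /n in nN *; lia.
by rewrite !eqxx /= IH /=; rewrite /n in nN *; lia.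
Qed.

Lemma wreath_sentence_closed : sentence wreath_sentence.
Proof.
apply: fbound_exs; apply: fbound_bounded.
have pw i k N : i < N -> tvars (tpow (TVar i) k) <= N.
  by move=> iN; apply: leq_trans (tvars_pow _ _) _.
have pr i k c N : c \in exponents p k -> i + k <= N -> tvars (tprod i c) <= N.
  rewrite mem_exponents => /andP[/eqP <- _] iN.
  by apply: leq_trans (tvars_prod _ _) _.
have fl k N t : k <= d -> n <= N -> tvars t <= N -> bounded N (ffiltr k N t).
  exact: bounded_filtr.
have md : d < n by rewrite /n; lia.
have dn : 0 < n by rewrite /n; lia.
have bs i : i < n -> bounded n (fbase (TVar i)) by rewrite /= !geq_max /=; lia.
have bt i : i < n -> bounded n (ftop (TVar i)) by rewrite /= !geq_max /=; lia.
rewrite /= !eqxx /=; repeat (apply/andP; split); rewrite ?geq_max /= ?pw //; try lia.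
- by apply: bounded_ands => j; rewrite mem_iota => jm; apply: bs; rewrite /n; lia.
- by apply: bounded_ands => i; rewrite mem_iota => id; apply: bt; rewrite /n; lia.
- apply: bounded_ors => c ce; rewrite /= eqxx !geq_max (pr _ _ _ _ ce) ?pw //=; rewrite /n; lia.
- apply: bounded_ands => c; rewrite mem_filter => /andP[_ ce].
  rewrite /= eqxx !geq_max (pr _ _ _ _ ce) ?pw //=; rewrite /n; lia.
- apply: bounded_ands => k; rewrite mem_iota => kd.
  rewrite /= eqxx !fl //=; rewrite ?geq_max /=; lia.
- apply: bounded_ors => c ce; rewrite /= eqxx !geq_max (pr _ _ _ _ ce) ?fl //=; rewrite /n; lia.
apply: bounded_ands => c; rewrite mem_filter => /andP[_ ce].
by rewrite /= fl // (pr _ _ _ _ ce).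
Qed.

Section Correct.
Variables (T : Type) (mul : T -> T -> T) (inv : T -> T) (one : T).
Notation holds := (holds mul inv one).
Notation teval := (teval mul inv one).

Lemma teval_pow e t k : teval e (tpow t k) = gpow mul one (teval e t) k.
Proof. by elim: k => //= k ->. Qed.

Lemma teval_prod N e e' i c : (forall i, i < N -> e' i = e i) -> i + size c <= N ->
  teval e' (tprod i c) = gprod mul one e i c.
Proof.
move=> E; elim: c i => //= k c IH i iN.
by rewrite teval_pow IH /= ?E //; lia.
Qed.

Lemma holds_filtr k N e e' t : k <= d -> n <= N -> tvars t <= N ->
  (forall i, i < n -> e' i = e i) ->
  holds e' (ffiltr k N t) <-> in_filtr p d mul inv one e k (teval e' t).
Proof.
elim: k N e' t => [|k IH] N e' t kd nN tN E /=.
  have dN : d < N by rewrite /n in nN; lia.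
  have tE x : teval (upd e' N x) t = teval e' t.
    by apply: teval_upd; exact: tbound_tvars.
  have dE x : upd e' N x d = e d by rewrite upd_lt // E // /n; lia.
  split=> [[x]|[x bx tx]].
    by rewrite teval_pow tE /= upd_eq dE => -[bx tx]; exists x.
  by exists x; rewrite teval_pow tE /= upd_eq dE.
have dN : d < N by rewrite /n in nN; lia.
have Ek x y i : i < n -> upd (upd e' N x) N.+1 y i = e i.
  by move=> ni; rewrite !upd_lt ?E //; lia.
have tE x y : teval (upd (upd e' N x) N.+1 y) t = teval e' t.
  by rewrite !(@teval_upd _ _ _ _ t) //; apply: tbound_tvars => //; lia.
have kE x y : upd (upd e' N x) N.+1 y k = e k by apply: Ek; rewrite /n; lia.
have dE x y : upd (upd e' N x) N.+1 y d = e d by apply: Ek; rewrite /n; lia.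
have NE x y : upd (upd e' N x) N.+1 y N = x by rewrite upd_lt // upd_eq.
have IH' x y : holds (upd (upd e' N x) N.+1 y) (ffiltr k N.+2 (TVar N)) <->
    in_filtr p d mul inv one e k x.
  by rewrite IH ?NE //=; [rewrite NE | lia | lia | exact: Ek].
split=> [[x [y [/IH' Hx []]]]|[x [y [/IH' Hx Hy tE']]]].
  rewrite kE dE NE upd_eq tE => Hy ->; by exists x, y.
by exists x, y; rewrite kE dE NE upd_eq tE.
Qed.

Theorem wreath_sentenceP e0 : holds e0 wreath_sentence <->
  exists e, wreath_axioms p m d mul inv one e.
Proof.
have nb e x i : i < n -> upd e n x i = e i by move=> ni; rewrite upd_lt.
have nb2 e x y i : i < n -> upd (upd e n x) n.+1 y i = e i.
  by move=> ni; rewrite !upd_lt //; lia.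
have nb3 e x y z i : i < n -> upd (upd (upd e n x) n.+1 y) n.+2 z i = e i.
  by move=> ni; rewrite !upd_lt //; lia.
have n2 e x y : upd (upd e n x) n.+1 y n = x by rewrite upd_lt // upd_eq.
have n3 e x y z : upd (upd (upd e n x) n.+1 y) n.+2 z n = x.
  by rewrite upd_lt ?n2 //; lia.
have n31 e x y z : upd (upd (upd e n x) n.+1 y) n.+2 z n.+1 = y.
  by rewrite upd_lt ?upd_eq //; lia.
have dn : d < n by rewrite /n; lia.
have on : 0 < n by rewrite /n; lia.
have pr e e' i k c : (forall i, i < n -> e' i = e i) -> i + k <= n ->
    c \in exponents p k -> teval e' (tprod i c) = gprod mul one e i c.
  move=> E ik; rewrite mem_exponents => /andP[/eqP sc _].
  by apply: teval_prod E _; rewrite sc.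
have fl1 e x k : k <= d -> holds (upd e n x) (ffiltr k n.+1 (TVar n)) <->
    in_filtr p d mul inv one e k x.
  by move=> kd; rewrite (@holds_filtr k n.+1 e) ?upd_eq //= ?upd_eq // => i ni; exact: nb.
have fl1' e x k : k < d ->
    holds (upd e n x) (ffiltr k n.+1 (tdif (TVar k) (TVar n))) <->
    in_filtr p d mul inv one e k (gdif mul inv (e k) x).
  move=> kd; rewrite (@holds_filtr k n.+1 e) ?upd_eq //= ?upd_eq ?nb //.
  - by rewrite /n; lia.
  - exact: ltnW.
  - by rewrite !geq_max /= /n; lia.
  - by move=> i ni; exact: nb.
have fl2 e x y : holds (upd (upd e n x) n.+1 y) (ffiltr d n.+2 (TVar n.+1)) <->
    in_filtr p d mul inv one e d y.
  by rewrite (@holds_filtr d n.+2 e) //= ?upd_eq //; [lia | move=> i ni; exact: nb2].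
have fl0 e c : c \in exponents p m -> holds e (ffiltr d n (tprod d c)) <->
    in_filtr p d mul inv one e d (gprod mul one e d c).
  move=> ce; rewrite (@holds_filtr d n e) //; first by rewrite (pr e e d m).
  by move: ce; rewrite mem_exponents /n => /andP[/eqP <- _]; exact: tvars_prod.
rewrite holds_exs; split=> [[e _ H]|[e He]]; last first.
  (* The axioms read only the parameters below n; from n on, [holds_exs] requires the given
     assignment. *)
  exists (fun i => if i < n then e i else e0 i).
    by move=> i ni; rewrite ltnNge ni.
  set e1 := (X in holds X _).
  have lt1 i : i < n -> e1 i = e i by rewrite /e1 => ->.
  have b1 x i : i < n -> upd e1 n x i = e i by move=> ni; rewrite nb // lt1.
  have b2 x y i : i < n -> upd (upd e1 n x) n.+1 y i = e i.
    by move=> ni; rewrite nb2 // lt1.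
  have b3 x y z i : i < n -> upd (upd (upd e1 n x) n.+1 y) n.+2 z i = e i.
    by move=> ni; rewrite nb3 // lt1.
  rewrite /axiom_formulas /=; split.
    by apply/holds_ands_map => j; rewrite mem_iota => jm /=; rewrite !lt1 ?/n; try lia; apply: (ax_base He).
  split.
    by apply/holds_ands_map => i; rewrite mem_iota => im /=; rewrite !lt1 ?/n; try lia; apply: (ax_top He).
  split; first by move=> u v; rewrite n2 upd_eq !b2 //; exact: (ax_baseC He).
  split; first by move=> u v; rewrite n2 upd_eq !b2 //; exact: (ax_topC He).
  split; first by move=> u v; rewrite n2 upd_eq !b2 //; exact: (ax_baseJ He).
  split.
    move=> g; have [v [h [bv th E]]] := ax_split He g; exists v, h.
    by rewrite n3 n31 upd_eq !b3.
  split; first by move=> g; rewrite upd_eq !b1 //; exact: (ax_disjoint He).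
  split; first by move=> h; rewrite teval_pow /= upd_eq !b1 //; exact: (ax_top_tf He).
  split.
    move=> h; rewrite upd_eq !b1 // => th; have [c ce [k tk E]] := ax_top_gen He th.
    apply/holds_ors_map; exists c => //; exists k => /=.
    rewrite teval_pow /= n2 upd_eq b2 // (pr e _ _ d) // ?leq_addr //; exact: b2.
  split.
    apply/holds_ands_map => c; rewrite mem_filter => /andP[nc ce] k /=.
    rewrite teval_pow /= upd_eq b1 // (pr e _ _ d) // ?leq_addr //; last exact: b1.
    by move=> tk E; move: nc; rewrite (ax_top_indep He ce tk E).
  split; first by move=> h; rewrite teval_pow /= upd_eq !b1 //; exact: (ax_base_tf He).
  split.
    apply/holds_ands_map => k; rewrite mem_iota => kd v /=.
    rewrite upd_eq b1 // => bv.
    have kd' : k <= d by lia.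
    have tk : tvars (tdif (TVar k) (TVar n)) <= n.+1 by rewrite /= !geq_max /=; lia.
    move=> /(@holds_filtr k n.+1 e (upd e1 n v) _ kd' (leqnSn n) tk (b1 v)) /=.
    rewrite upd_eq b1 => [Hv|]; last by lia.
    apply/(@holds_filtr k n.+1 e (upd e1 n v) (TVar n) kd' (leqnSn n) (leqnn _) (b1 v)) => /=.
    by rewrite upd_eq; apply: (ax_base_reg He) Hv.
  split.
    move=> v; rewrite upd_eq b1 // => bv; have [c ce [w Hw E]] := ax_base_gen He bv.
    apply/holds_ors_map; exists c => //; exists w => /=.
    rewrite (@holds_filtr d n.+2 e) //=; [|lia|exact: b2].
    by rewrite upd_eq n2 (pr e _ _ m) //; exact: b2.
  split.
    apply/holds_ands_map => c; rewrite mem_filter => /andP[nc ce] /=.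
    have sc : tvars (tprod d c) <= n.
      by move: ce; rewrite mem_exponents /n => /andP[/eqP <- _]; exact: tvars_prod.
    rewrite (@holds_filtr d n e) // (pr e _ _ m) // => Hc.
    by move: nc; rewrite (ax_base_indep He ce Hc).
  split; first by move=> h v; rewrite n2 upd_eq !b2 //; exact: (ax_faithful He).
  split; first by move=> h v; rewrite teval_pow /= n2 upd_eq !b2 //; exact: (ax_reduced He).
  by [].
exists e; move/holds_ands: H => H.
have ax k : k < size axiom_formulas -> holds e (nth FTrue axiom_formulas k) := H k.
split.
- by move=> j jm; have /holds_ands_map/(_ j) /= := ax 0 isT; rewrite mem_iota; apply; lia.
- by move=> i id; have /holds_ands_map/(_ i) /= := ax 1 isT; rewrite mem_iota; apply; lia.
- move=> u v bu bv; have := ax 2 isT u v; rewrite /= n2 upd_eq !nb2 //; exact.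
- move=> u v bu bv; have := ax 3 isT u v; rewrite /= n2 upd_eq !nb2 //; exact.
- move=> g v bv; have := ax 4 isT g v; rewrite /= n2 upd_eq !nb2 //; exact.
- move=> g; have [v [h]] := ax 5 isT g; rewrite /= n3 n31 upd_eq !nb3 //.
  by move=> [bv [th E]]; exists v, h.
- move=> g bg tg; have := ax 6 isT g; rewrite /= upd_eq !nb //; exact.
- move=> h th; have := ax 7 isT h; rewrite /= teval_pow /= upd_eq !nb //; exact.
- move=> h th; have := ax 8 isT h; rewrite /= upd_eq nb // => /(_ th).
  move=> /holds_ors_map[c ce [k]] /=; rewrite teval_pow /= n2 upd_eq nb2 //.
  by rewrite (pr e _ _ d) //; [move=> [tk E]; exists c => //; exists k | exact: nb2 | rewrite leq_addr].
- move=> c ce k tk E; apply: contraT => nc.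
  have /holds_ands_map/(_ c) := ax 9 isT.
  rewrite mem_filter nc => /(_ ce k) /=.
  by rewrite teval_pow /= upd_eq nb // (pr e _ _ d) //; [move/(_ tk) | exact: nb | rewrite leq_addr].
- move=> h th; have := ax 10 isT h; rewrite /= teval_pow /= upd_eq !nb //; exact.
- move=> k kd v bv Hv; have /holds_ands_map/(_ k) := ax 11 isT.
  rewrite mem_iota => /(_ kd v) /=; rewrite upd_eq nb // => /(_ bv).
  by move=> Hk; apply/(fl1 e v k (ltnW kd))/Hk/(fl1' e v k kd).
- move=> v bv; have := ax 12 isT v; rewrite /= upd_eq nb // => /(_ bv).
  move=> /holds_ors_map[c ce [w]] /= [/fl2 Hw]; rewrite n2 upd_eq.
  by rewrite (pr e _ _ m) //; [move=> E; exists c => //; exists w | exact: nb2].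
- move=> c ce Hc; apply: contraT => nc.
  have /holds_ands_map/(_ c) := ax 13 isT.
  by rewrite mem_filter nc => /(_ ce) /=; case; apply/fl0.
- move=> h v th bv; have := ax 14 isT h v; rewrite /= n2 upd_eq !nb2 //; exact.
- move=> h u th bu; have := ax 15 isT h u; rewrite /= teval_pow /= n2 upd_eq !nb2 //; exact.
Qed.
End Correct.

End Encoding.

End Formula.
End FirstOrder.

(** * The wreath product satisfies the axioms *)

Section Koenig.
Variables (T : nat -> finType) (pi : forall n, T n.+1 -> T n) (P : forall n, T n -> Prop).
Hypothesis P_pi : forall n t, P t -> P (@pi n t).
Hypothesis P_ex : forall n, exists t : T n, P t.

Fixpoint extends k n (t : T n) : Prop :=
  if k is k'.+1 then exists2 t', pi t' = t & @extends k' n.+1 t' else P t.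

Lemma extends_anti k l n (t : T n) : (k <= l)%N -> extends l t -> extends k t.
Proof.
elim: l k n t => [|l IH] [|k] n t //= kl.
  by move=> [t' <- /(IH 0%N)] => /(_ isT); exact: P_pi.
by move=> [t' <- Et]; exists t' => //; exact: IH Et.
Qed.

(** By finiteness: if every t in D failed at some depth, all of them would fail at the maximum of
    these depths. *)
Lemma extends_all n (D : T n -> Prop) :
  (forall k, exists2 t, D t & extends k t) -> exists2 t, D t & forall k, extends k t.
Proof.
move=> H; apply: contrapT => nH.
have /choice[f Hf] t : exists k, D t -> ~ extends k t.
  have [Dt|nDt] := pselect (D t); last by exists 0%N.
  apply: contrapT => nk; apply: nH; exists t => // k.
  by apply: contrapT => nE; apply: nk; exists k.
have [t Dt Et] := H (\max_t f t)%N.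
by apply: (Hf t Dt); apply: extends_anti Et; exact: leq_bigmax.
Qed.

Lemma extends_ex k n : exists t : T n, extends k t.
Proof. by elim: k n => [|k IH] n; [exact: P_ex | have [t] := IH n.+1; exists (pi t), t]. Qed.

Lemma koenig : exists s : forall n, T n, (forall n, pi (s n.+1) = s n) /\ forall n, P (s n).
Proof.
have [t0 _ Et0] : exists2 t : T 0%N, True & forall k, extends k t.
  by apply: extends_all => k; have [t] := extends_ex k 0; exists t.
have step n (t : {t : T n | forall k, extends k t}) :
    {t' : {t : T n.+1 | forall k, extends k t} | pi (sval t') = sval t}.
  apply: cid; have [t' E Et'] : exists2 t', pi t' = sval t & forall k, extends k t'.
    by apply: extends_all => k; exact: (svalP t k.+1).
  by exists (exist _ t' Et').
pose s := nat_rect (fun n => {t : T n | forall k, extends k t}) (exist _ t0 Et0)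
  (fun n t => sval (step n t)).
exists (fun n => sval (s n)); split=> n; first exact: (svalP (step n (s n))).
exact: (svalP (s n) 0%N).
Qed.
End Koenig.

(** * Sums over the orbits of a translation of order p *)

Section Orbits.
Variables (A : finZmodType) (V : nmodType) (p : nat).
Hypothesis p_pr : prime p.

Lemma mulrn_coprime_inj (mu : A) k l : mu != 0 -> mu *+ p = 0 ->
  (k < p)%N -> (l < p)%N -> mu *+ k = mu *+ l -> k = l.
Proof.
move=> mu0 mup; wlog kl : k l / (k <= l)%N.
  by move=> W kp lp E; case: (leqP k l) => [/W->//|/ltnW/W<-].
move=> kp lp E; apply/eqP; rewrite eqn_leq kl /= leqNgt; apply/negP => lk.
have {}E : mu *+ (l - k) = 0 by rewrite mulrnBr // E subrr.
have co : coprime p (l - k).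
  by rewrite prime_coprime // gtnNdvd; lia.
have : mu *+ gcdn p (l - k) = 0.
  have lk0 : (0 < p)%N by rewrite prime_gt0.
  have [a _ /dvdnP[b Eb]] := Bezoutl (l - k) lk0.
  have := congr1 (fun x => mu *+ x) Eb; rewrite mulrnDr => /esym.
  by rewrite [(a * _)%N]mulnC [(b * _)%N]mulnC !mulrnA E mup !mul0rn addr0 => <-.
by rewrite (eqP co) mulr1n => /eqP; rewrite (negPf mu0).
Qed.

(** All orbits in F have size p, and s lists one representative of each. The list is kept in the
    conclusion because a divisibility of the values of g has to pass to the sum over s. *)
Lemma sum_orbits (mu : A) (F : {set A}) (g : A -> V) :
  mu != 0 -> mu *+ p = 0 ->
  (forall y, y \in F -> y + mu \in F) -> (forall y, y \in F -> g (y + mu) = g y) ->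
  exists s : seq A, \sum_(y in F) g y = (\sum_(y <- s) g y) *+ p.
Proof.
move=> mu0 mup; have [n] := ubnP #|F|; elim: n F => // n IH F.
rewrite ltnS => Fn stF invF.
have [->|[y yF]] := set_0Vmem F.
  by exists [::]; rewrite big_set0 big_nil mul0rn.
pose O := [set y + mu *+ k | k : 'I_p].
have OF k : y + mu *+ k \in F /\ g (y + mu *+ k) = g y.
  elim: k => [|k [kF kE]]; first by rewrite addr0.
  by rewrite mulrSr addrA; split; [exact: stF | rewrite invF].
have memO k : y + mu *+ k \in O.
  have lt : (k %% p < p)%N by rewrite ltn_mod prime_gt0.
  apply/imsetP; exists (Ordinal lt) => //=; rewrite {1}(divn_eq k p).
  by rewrite mulrnDr mulnC mulrnA mup mul0rn add0r.
have OsF : O \subset F by apply/fintype.subsetP => _ /imsetP[k _ ->]; case: (OF k).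
have yO : y \in O by have := memO 0%N; rewrite addr0.
have [|z|z|s Es] := IH (F :\: O).
- apply: leq_trans Fn; apply: proper_card; rewrite finset.properEneq finset.subsetDl andbT.
  by apply/eqP => E; move: yF; rewrite -E inE yO.
- rewrite !inE => /andP[zO zF]; rewrite stF // andbT; apply: contra zO.
  move=> /imsetP[k _ E].
  have -> : z = y + mu *+ (k + p.-1).
    rewrite mulrnDr addrA -E -addrA -mulrS prednK ?prime_gt0 // mup addr0 //.
  exact: memO.
- by rewrite inE => /andP[_ zF]; exact: invF.
exists (y :: s); rewrite big_cons mulrnDl -Es (big_setID O) /= (finset.setIidPr OsF).
congr (_ + _); rewrite /O big_imset /=; last first.
  move=> k l _ _ /addrI E; apply: val_inj; exact: mulrn_coprime_inj mu0 mup _ _ E.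
rewrite (eq_bigr (fun=> g y)) ?sumr_const ?card_ord // => k _.
by case: (OF k).
Qed.
End Orbits.

(** Joins the finite and the additive structure, so that [sum_orbits] applies to the groups
    [Xl n]. *)
HB.instance Definition _ (aT : finType) (rT : finZmodType) :=
  GRing.Zmodule.on {ffun aT -> rT}.

(** * The finite levels of the wreath product *)

Section Levels.
Variables (p m d : nat).
Hypothesis p_pr : prime p.
Notation Zl := (Zl p). Notation Xl := (Xl p d). Notation Vl := (Vl p m). Notation Ml := (Ml p m d).
Notation redZ := (@redZ p _).
Notation redX := (@redX p d _).
Notation redM := (@redM p m d _).
Notation redV := (@redV p m _).
Notation shift := (@wshift p m d _).

Lemma Zl_modulus n : (Zp_trunc (p ^ n.+1)).+2 = (p ^ n.+1)%N.
Proof. by apply: Zp_cast; rewrite -(expn0 p) ltn_exp2l // prime_gt1. Qed.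

Lemma Zl_natr n (a : Zl n) : (nat_of_ord a)%:R = a.
Proof. exact: natr_Zp. Qed.

Lemma Zl_nat n x : nat_of_ord (x%:R : Zl n) = (x %% p ^ n.+1)%N.
Proof. by rewrite val_Zp_nat // -(expn0 p) ltn_exp2l // prime_gt1. Qed.

Lemma Zl_natr_eq0 n x : ((x%:R : Zl n) == 0) = (p ^ n.+1 %| x)%N.
Proof. by rewrite -val_eqE /= Zl_nat. Qed.

Lemma Zl_mulrn_eq0 n (a : Zl n) k : (a *+ k == 0) = (p ^ n.+1 %| a * k)%N.
Proof. by rewrite -[in LHS](Zl_natr a) -mulrnA Zl_natr_eq0. Qed.

Lemma Zl_mulrn_exp n (a : Zl n) : a *+ (p ^ n.+1) = 0.
Proof. by apply/eqP; rewrite Zl_mulrn_eq0 dvdn_mull. Qed.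

(** Both sides say that p^(n+1) divides a. This is why p-torsion disappears one level down. *)
Lemma redZ_eq0 n (a : Zl n.+1) : (redZ a == 0) = (a *+ p == 0).
Proof.
rewrite /Defs.redZ Zl_natr_eq0 Zl_mulrn_eq0; move: (nat_of_ord a) => x.
rewrite [(p ^ n.+2)%N]expnSr.
by rewrite dvdn_pmul2r // prime_gt0.
Qed.

Definition res n (a : Zl n) : 'Z_p := (nat_of_ord a)%:R.

Lemma Zp_modulus : (Zp_trunc p).+2 = p.
Proof. by apply: Zp_cast; rewrite prime_gt1. Qed.

Fact res_morph n : nmod_morphism (@res n).
Proof.
split=> [|a b]; rewrite /res //; apply: Zp_red_add.
by rewrite Zp_modulus Zl_modulus expnS dvdn_mulr.
Qed.
HB.instance Definition _ n := GRing.isNmodMorphism.Build _ _ (@res n) (@res_morph n).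

Lemma Zp_natr_eq0 x : ((x%:R : 'Z_p) == 0) = (p %| x)%N.
Proof. by rewrite -val_eqE /= val_Zp_nat ?prime_gt1. Qed.

Lemma res_eq0 n (a : Zl n) : res a = 0 -> exists k, a = k *+ p.
Proof.
move=> /eqP; rewrite Zp_natr_eq0 => /dvdnP[k E]; exists k%:R.
by rewrite -mulrnA -E Zl_natr.
Qed.

Lemma res_natr n x : res (x%:R : Zl n) = x%:R.
Proof.
rewrite /res Zl_nat; apply: Zp_modR.
by rewrite Zp_modulus expnS dvdn_mulr.
Qed.

Lemma res_mulrn n (a : Zl n) : res (a *+ p) = 0.
Proof. by rewrite raddfMn /=; apply/eqP; rewrite -[res a]natr_Zp -mulrnA Zp_natr_eq0 dvdn_mull. Qed.

Lemma Zp_mulrn (a : 'Z_p) : a *+ p = 0.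
Proof. by apply/eqP; rewrite -[a]natr_Zp -mulrnA Zp_natr_eq0 dvdn_mull. Qed.

Lemma redZ_natr n x : redZ (x%:R : Zl n.+1) = x%:R :> Zl n.
Proof.
rewrite /Defs.redZ Zl_nat; apply: Zp_modR.
by rewrite Zl_modulus [(p ^ n.+2)%N]expnS dvdn_mull.
Qed.

Lemma res_red n (a : Zl n.+1) : res (redZ a) = res a.
Proof. by rewrite -(Zl_natr a) redZ_natr !res_natr. Qed.

Lemma shiftD n (x : Xl n) (f g : Ml n) : shift x (f + g) = shift x f + shift x g.
Proof. by apply/ffunP=> z; rewrite !ffunE. Qed.
Lemma shift0 n (x : Xl n) : shift x (0 : Ml n) = 0.
Proof. by apply/ffunP=> z; rewrite !ffunE. Qed.
Lemma shiftN n (x : Xl n) (f : Ml n) : shift x (- f) = - shift x f.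
Proof. by apply/ffunP=> z; rewrite !ffunE. Qed.
Lemma shift0x n (f : Ml n) : shift 0 f = f.
Proof. by apply/ffunP=> z; rewrite !ffunE subr0. Qed.
Lemma shift_shift n (x y : Xl n) (f : Ml n) : shift x (shift y f) = shift (x + y) f.
Proof. by apply/ffunP=> z; rewrite !ffunE opprD addrA. Qed.

Definition unitX n (i : nat) : Xl n := [ffun k : 'I_d => (k == i :> nat)%:R].
Definition unitV n (j : nat) : Vl n := [ffun k : 'I_m => (k == j :> nat)%:R].
Definition delta n (x : Xl n) (v : Vl n) : Ml n := [ffun z => if z == x then v else 0].

Lemma red_unitX n i : redX (unitX n.+1 i) = unitX n i.
Proof. by apply/ffunP=> k; rewrite !ffunE redZ_natr. Qed.
Lemma red_unitV n j : redV (unitV n.+1 j) = unitV n j.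
Proof. by apply/ffunP=> k; rewrite !ffunE redZ_natr. Qed.
Lemma red_delta n (x : Xl n.+1) (v : Vl n.+1) : redM (delta x v) = delta (redX x) (redV v).
Proof.
apply/ffunP=> z; rewrite !ffunE eq_sym.
have [<-|xz] := eqVneq (redX x) z.
  rewrite (bigD1 x) //= ffunE eqxx big1 ?addr0 // => y /andP[_ /negPf yx].
  by rewrite ffunE yx raddf0.
rewrite big1 // => y /eqP yz; rewrite ffunE; case: eqP => [E|]; last by rewrite raddf0.
by rewrite -E yz eqxx in xz.
Qed.
Lemma shift_delta n (x y : Xl n) (v : Vl n) : shift x (delta y v) = delta (x + y) v.
Proof. by apply/ffunP=> z; rewrite !ffunE subr_eq addrC. Qed.

(* Sums over the cosets of the subgroup generated by the first [k] coordinates. *)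
Definition agree n k (z y : Xl n) := [forall i : 'I_d, (k <= i)%N ==> (y i == z i)].
Definition csum k n (f : Ml n) (z : Xl n) (j : 'I_m) : 'Z_p :=
  \sum_(y | agree k z y) res (f y j).
(** The canonical representative of the coset of z. *)
Definition low k n (z : Xl n) : Xl n := [ffun i : 'I_d => if (i < k)%N then 0 else z i].

Lemma agreeP n k (z y : Xl n) : reflect (forall i : 'I_d, (k <= i)%N -> y i = z i) (agree k z y).
Proof.
apply: (iffP forallP) => H i; first by move=> ki; have := H i; rewrite ki => /eqP.
by apply/implyP => /H ->.
Qed.

Lemma csumD k n (f g : Ml n) z j : csum k (f + g) z j = csum k f z j + csum k g z j.
Proof. by rewrite /csum -big_split; apply: eq_bigr => y _; rewrite !ffunE raddfD. Qed.
Lemma csumN k n (f : Ml n) z j : csum k (- f) z j = - csum k f z j.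
Proof. by rewrite /csum -sumrN; apply: eq_bigr => y _; rewrite !ffunE raddfN. Qed.
Lemma csum_mulrn k n (f : Ml n) z j : csum k (f *+ p) z j = 0.
Proof. by rewrite /csum big1 // => y _; rewrite !ffunMnE res_mulrn. Qed.

Lemma csum_shift k n i (f : Ml n) z j :
  csum k (shift (unitX n i) f) z j = csum k f (z - unitX n i) j.
Proof.
rewrite /csum (reindex_inj (addIr (unitX n i))) /=; apply: eq_big => [y|y _].
  by apply/agreeP/agreeP => H l kl; have := H l kl; rewrite !ffunE; [move=> <-|move=> ->];
    rewrite ?addrK ?subrK.
by rewrite !ffunE addrK.
Qed.

Lemma csum_shift_lt k n i (f : Ml n) z j : (i < k)%N ->
  csum k (shift (unitX n i) f) z j = csum k f z j.
Proof.
move=> ik; rewrite csum_shift /csum; apply: eq_bigl => y.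
apply/agreeP/agreeP => H l kl; have := H l kl; rewrite !ffunE => ->.
  by rewrite gtn_eqF ?subr0 //; exact: leq_trans kl.
by rewrite gtn_eqF ?subr0 //; exact: leq_trans kl.
Qed.

Lemma low_agree k n (z y : Xl n) : low k z = z -> (low k y == z) = agree k z y.
Proof.
move=> Ez; apply/eqP/agreeP => [<- i ki|H].
  by rewrite ffunE ltnNge ki.
rewrite -Ez; apply/ffunP=> i; rewrite !ffunE; case: ltnP => // ki; exact: H.
Qed.

Lemma low_low k n (z : Xl n) : low k (low k z) = low k z.
Proof. by apply/ffunP=> i; rewrite !ffunE; case: (i < k)%N. Qed.

Lemma csum_red k n (g : Ml n.+1) z j : csum k (redM g) z j =
  \sum_(c in [set c | agree k z (redX c) & low k c == c]%SET) csum k g c j.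
Proof.
transitivity (\sum_(y | agree k z (redX y)) res (g y j)).
  rewrite /csum (eq_bigr (fun x => \sum_(y | redX y == x) res (g y j))); last first.
    move=> x _; rewrite ffunE sum_ffunE raddf_sum; apply: eq_bigr => y _.
    by rewrite /Defs.redV ffunE; exact: res_red.
  rewrite (exchange_big_dep (fun y => agree k z (redX y))) /=.
    apply: eq_bigr => y Hy; rewrite (big_pred1 (redX y)) // => x /=.
    by rewrite [RHS]eq_sym; case: eqP => [<-|]; rewrite ?andbF // andbT Hy.
  by move=> x y Hx /eqP ->.
rewrite (partition_big (low k (n := n.+1)) (fun c => c \in [set c | agree k z (redX c) & low k c == c]%SET)) /=.
  apply: eq_bigr => c; rewrite inE => /andP[Hc /eqP Ec]; rewrite /csum; apply: eq_bigl => y.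
  rewrite low_agree //; apply: andb_idl => /agreeP Hy; apply/agreeP => i ki.
  by rewrite -(agreeP _ _ _ Hc i ki) !ffunE Hy.
move=> y /agreeP Hy; rewrite inE low_low eqxx andbT; apply/agreeP=> i ki.
by rewrite -(Hy i ki) !ffunE ltnNge ki.
Qed.

Lemma csum_total n (g : Ml n.+1) z y j : csum d (redM g) z j = csum d g y j.
Proof.
have low0 (c : Xl n.+1) : low d c = 0 by apply/ffunP=> i; rewrite !ffunE ltn_ord.
have agT l (u v : Xl l) : agree d u v by apply/agreeP => i; rewrite leqNgt ltn_ord.
rewrite csum_red (big_pred1 (0 : Xl n.+1)) => [|c]; last by rewrite inE agT low0 eq_sym.
by apply: eq_bigl => x; rewrite !agT.
Qed.

(** The k-th filtration step at level n, with its witnesses named. They are indexed by all of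
    ['I_d], so that they form a finite type whatever k is, as [koenig] requires. *)
Definition combination k n (f u0 : Ml n) (u : {ffun 'I_d -> Ml n}) :=
  f = u0 *+ p + \sum_(i < d | (i < k)%N) (shift (unitX n i) (u i) - u i).

Lemma combinationD k n (f g u0 v0 : Ml n) u v :
  combination k f u0 u -> combination k g v0 v -> combination k (f + g) (u0 + v0) (u + v).
Proof.
move=> -> ->; rewrite /combination mulrnDl addrACA -big_split; congr (_ + _).
by apply: eq_bigr => i _; rewrite ffunE shiftD opprD addrACA.
Qed.

Lemma combination0 k n : combination k (0 : Ml n) 0 0.
Proof.
by rewrite /combination mul0rn add0r big1 // => i _; rewrite ffunE shift0 subrr.
Qed.

Definition combinable k n (f : Ml n) := exists u0 u, combination k f u0 u.

Lemma combinableD k n (f g : Ml n) : combinable k f -> combinable k g -> combinable k (f + g).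
Proof. by move=> [u0 [u Cu]] [v0 [v Cv]]; exists (u0 + v0), (u + v); exact: combinationD. Qed.

Lemma combinable0 k n : combinable k (0 : Ml n).
Proof. by exists 0, 0; exact: combination0. Qed.

Lemma combinable_mulrn k n (u : Ml n) : combinable k (u *+ p).
Proof.
exists u, 0; rewrite /combination big1 ?addr0 // => i _.
by rewrite ffunE shift0 subrr.
Qed.

Lemma combinable_dif k n (i : 'I_d) (u : Ml n) : (i < k)%N ->
  combinable k (shift (unitX n i) u - u).
Proof.
move=> ik; exists 0, [ffun l => if l == i then u else 0].
rewrite /combination mul0rn add0r (bigD1 i) //= ffunE eqxx big1 ?addr0 // => l /andP[_ /negPf li].
by rewrite ffunE li shift0 subrr.
Qed.

Lemma combinable_sum k n (I : Type) (r : seq I) (P : pred I) (F : I -> Ml n) :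
  (forall i, P i -> combinable k (F i)) -> combinable k (\sum_(i <- r | P i) F i).
Proof. by move=> H; apply: big_ind => //; [exact: combinable0 | exact: combinableD]. Qed.

(** A point mass can be moved along x_0, ..., x_(k-1) at the cost of multiples of the x_i - 1;
    zeroing one coordinate after another brings it to the coset representative. *)
Lemma combinable_delta k n (z : Xl n) (v : Vl n) :
  combinable k (delta z v - delta (low k z) v).
Proof.
suff H l : (l <= k)%N -> combinable k (delta z v - delta (low l z) v) by exact: H.
elim: l => [|l IH] lk.
  have -> : low 0 z = z by apply/ffunP=> i; rewrite !ffunE.
  by rewrite subrr; exact: combinable0.
rewrite -(subrK (delta (low l z) v) (delta z v)) -addrA.
apply: combinableD; first by apply: IH; exact: ltnW.
have [ld|dl] := ltnP l d; last first.
  have -> : low l.+1 z = low l z.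
    by apply/ffunP=> i; rewrite !ffunE !(leq_trans (ltn_ord i)) // (leq_trans dl).
  by rewrite subrr; exact: combinable0.
have -> : low l z = unitX n l *+ z (Ordinal ld) + low l.+1 z.
  apply/ffunP=> i; rewrite !ffunE ffunMnE !ffunE [(i < l.+1)%N]ltnS [(i <= l)%N]leq_eqVlt.
  have [E|il] := eqVneq (i : nat) l.
    rewrite /= E ltnn addr0 -[LHS]Zl_natr; congr ((nat_of_ord (z _))%:R).
    exact: val_inj.
  by rewrite mul0rn add0r.
elim: (nat_of_ord _) => [|c IHc]; first by rewrite mulr0n add0r subrr; exact: combinable0.
rewrite mulrS -addrA -shift_delta.
set D := delta (_ + _) v in IHc *.
rewrite -(subrK D (shift _ D)) -addrA; apply: combinableD => //.
exact: (@combinable_dif k n (Ordinal ld) D).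
Qed.

Lemma sum_delta n (f : Ml n) : f = \sum_z delta z (f z).
Proof.
apply/ffunP=> z; rewrite sum_ffunE (bigD1 z) //= ffunE eqxx big1 ?addr0 // => y /negPf yz.
by rewrite ffunE eq_sym yz.
Qed.

(** All the mass of a coset is moved to its representative, where it becomes the coset sum. This is
    zero modulo p, so what remains is a multiple of p. *)
Lemma combinable_csum k n (f : Ml n) :
  (forall z j, csum k f z j = 0) -> combinable k f.
Proof.
move=> f0; pose g := \sum_z delta (low k z) (f z).
rewrite -(subrK g f); apply: combinableD.
  rewrite {1}(sum_delta f) -sumrB; apply: combinable_sum => z _; exact: combinable_delta.
have /(_ _ _)/res_eq0/cid H : forall z j, res (g z j) = 0.
  move=> z j; rewrite sum_ffunE sum_ffunE raddf_sum /=.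
  have [Ez|nz] := eqVneq (low k z) z.
    transitivity (csum k f z j); last exact: f0.
    rewrite /csum [RHS]big_mkcond; apply: eq_bigr => y _.
    rewrite ffunE -low_agree // [in RHS]eq_sym; case: eqP => // _.
    by rewrite ffunE raddf0.
  rewrite big1 // => y _; rewrite ffunE; case: eqP => [E|]; last by rewrite ffunE raddf0.
  by rewrite E low_low eqxx in nz.
have -> : g = ([ffun z => [ffun j => sval (H z j)]] : Ml n) *+ p.
  apply/ffunP=> z; apply/ffunP=> j; rewrite !ffunMnE !ffunE.
  exact: (svalP (H z j)).
exact: combinable_mulrn.
Qed.

Lemma combination_red k n (f u0 : Ml n.+1) u : combination k f u0 u ->
  combination k (redM f) (redM u0) [ffun i => redM (u i)].
Proof.
move=> ->; rewrite /combination raddfD raddfMn raddf_sum; congr (_ + _).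
by apply: eq_bigr => i _; rewrite ffunE raddfB /= redM_shift red_unitX.
Qed.

Lemma csum_combination k n (f u0 : Ml n) u z j : combination k f u0 u -> csum k f z j = 0.
Proof.
move=> ->; rewrite csumD csum_mulrn add0r.
apply: (big_rec (fun g => csum k g z j = 0)) => [|i g ik IH].
  by rewrite /csum big1 // => y _; rewrite !ffunE raddf0.
by rewrite csumD IH csumD csumN csum_shift_lt // subrr addr0.
Qed.

(* The coset sums one level up are invariant under a translation of order [p] in
   the kernel of the reduction, so they add up to a multiple of [p]. *)
Lemma csum_regular k n (g : Ml n.+1) z j : (k < d)%N ->
  (forall y, csum k (shift (unitX n.+1 k) g - g) y j = 0) -> csum k (redM g) z j = 0.
Proof.
move=> kd inv; rewrite csum_red; set F := [set c | _]%SET.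
(* [mu] generates the kernel of the reduction in coordinate k, so translation by it permutes the
   representatives in F. *)
pose mu : Xl n.+1 := unitX n.+1 k *+ (p ^ n.+1).
have muE (i : 'I_d) : mu i = if i == k :> nat then (p ^ n.+1)%:R else 0.
  by rewrite ffunMnE ffunE; case: eqP => _; rewrite ?mul0rn.
have mu0 : mu != 0.
  apply/eqP => /ffunP/(_ (Ordinal kd))/eqP; rewrite muE eqxx ffunE Zl_natr_eq0.
  by rewrite dvdn_Pexp2l ?prime_gt1 // ltnn.
have mup : mu *+ p = 0.
  by apply/ffunP=> i; rewrite -mulrnA -expnSr ffunMnE Zl_mulrn_exp ffunE.
have redmu : redX mu = 0.
  apply/ffunP=> i; rewrite !ffunE; apply/eqP; rewrite redZ_eq0.
  by have /ffunP/(_ i) := mup; rewrite ffunMnE ffunE => ->.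
have invE y : csum k g (y + unitX n.+1 k) j = csum k g y j.
  have := inv (y + unitX n.+1 k); rewrite csumD csumN csum_shift addrK.
  by move=> /eqP; rewrite subr_eq0 => /eqP ->.
have [||s ->] := @sum_orbits _ _ p p_pr mu F (fun c => csum k g c j) mu0 mup.
- move=> y; rewrite !inE raddfD /= redmu addr0 => /andP[-> /eqP/ffunP Ey] /=.
  apply/eqP/ffunP => i; have := Ey i; rewrite !ffunE muE.
  by case: ltnP => // ik; rewrite ltn_eqF // addr0.
- move=> y _; rewrite /mu; elim: (p ^ n.+1)%N => [|c IH]; first by rewrite addr0.
  by rewrite mulrSr addrA invE.
exact: Zp_mulrn.
Qed.

Lemma redX_eq0 n (x : Xl n.+1) : redX x = 0 <-> x *+ p = 0.
Proof.
split=> /ffunP E; apply/ffunP=> i; have := E i; rewrite !ffunE ?ffunMnE => /eqP.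
  by rewrite redZ_eq0 => /eqP.
by rewrite -redZ_eq0 => /eqP.
Qed.

Lemma redM_torsion n (f : Ml n.+1) : f *+ p = 0 -> redM f = 0.
Proof.
move=> /ffunP E; apply/ffunP=> z; rewrite !ffunE big1 // => y _.
apply/ffunP=> j; have /ffunP/(_ j) := E y; rewrite !ffunMnE !ffunE => /eqP.
by rewrite -redZ_eq0 => /eqP.
Qed.

(** Some multiple of x has order p, hence lies in the kernel of [redX]. Each fibre sum then splits
    into orbits of size p and gains a factor p. *)
Lemma redM_invariant n (x : Xl n.+1) (f : Ml n.+1) e : x != 0 -> shift x f = f ->
  (forall y, exists v : Vl n.+1, f y = v *+ (p ^ e)) ->
  forall z, exists v : Vl n, redM f z = v *+ (p ^ e.+1).
Proof.
move=> x0 fx fe z.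
have [c [xc xcp]] : exists c, x *+ (p ^ c) != 0 /\ x *+ (p ^ c.+1) = 0.
  have ex : exists c, x *+ (p ^ c) == 0.
    exists n.+2; apply/eqP/ffunP=> i; by rewrite ffunMnE Zl_mulrn_exp ffunE.
  have [[|c] Hc min] := ex_minnP ex; first by rewrite expn0 mulr1n (negPf x0) in Hc.
  by exists c; split; [apply/negP => /min; rewrite ltnn | exact/eqP].
pose mu := x *+ (p ^ c).
have mup : mu *+ p = 0 by rewrite -mulrnA -expnSr.
have fmu y : f (y + mu) = f y.
  rewrite /mu; elim: (p ^ c)%N => [|k IH]; first by rewrite addr0.
  by rewrite mulrSr addrA -[in RHS]IH -[in LHS]fx ffunE addrK.
have [||s Es] := @sum_orbits _ _ p p_pr mu [set y | redX y == z]%SET (fun y => f y) xc mup.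
- by move=> y; rewrite !inE raddfD /= (iffRL (redX_eq0 _) mup) addr0.
- by move=> y _; exact: fmu.
have [h Eh] : exists h : Vl n.+1, \sum_(y <- s) f y = h *+ (p ^ e).
  elim: s {Es} => [|y s [h IH]]; first by exists 0; rewrite big_nil mul0rn.
  by have [v Ev] := fe y; exists (v + h); rewrite big_cons mulrnDl IH Ev.
exists (redV h); rewrite ffunE -raddf_sum.
have -> : \sum_(y | redX y == z) f y = h *+ (p ^ e.+1).
  by rewrite [(p ^ e.+1)%N]expnSr mulrnA -Eh -Es; apply: eq_bigl => y; rewrite inE.
by rewrite raddfMn.
Qed.

End Levels.

(** * The axioms in the inverse limit *)

Section WreathLimit.
Variables (p m d : nat).
Hypotheses (p_pr : prime p) (m_gt0 : (0 < m)%N) (d_gt0 : (0 < d)%N).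
Notation W := (Wlim p m d).
Notation Xl := (Xl p d). Notation Ml := (Ml p m d).
Notation redX := (@redX p d _).
Notation redM := (@redM p m d _).
Notation shift := (@wshift p m d _).
Notation unitX := (@unitX p d).
Notation unitV := (@unitV p m).
Notation mul := (@Wmul p m d).
Notation inv := (@Winv p m d).
Notation one := (@Wone p m d).

Definition base n (w : W) : Ml n := (val w n).1.
Definition top n (w : W) : Xl n := (val w n).2.

Lemma W_ext (v w : W) : (forall n, base n v = base n w) -> (forall n, top n v = top n w) -> v = w.
Proof.
move=> Eb Et; apply: val_inj; apply: functional_extensionality_dep => n.
by have := Eb n; have := Et n; rewrite /base /top; case: (val v n) (val w n) => ? ? [? ?] /= -> ->.
Qed.

Lemma redM_base n w : redM (base n.+1 w) = base n w.
Proof. exact: (congr1 fst (set_valP w n)). Qed.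
Lemma redX_top n w : redX (top n.+1 w) = top n w.
Proof. exact: (congr1 snd (set_valP w n)). Qed.

Lemma W_exists (f : forall n, Ml n) (x : forall n, Xl n) :
  (forall n, redM (f n.+1) = f n) -> (forall n, redX (x n.+1) = x n) ->
  exists w : W, (forall n, base n w = f n) /\ (forall n, top n w = x n).
Proof.
move=> Ef Ex.
have H : ((fun n => (f n, x n) : discrete_topology (Ll p m d n)) : Wprod p m d) \in @Wset p m d.
  by apply/mem_set => n; rewrite /wproj Ef Ex.
by exists (SigSub H).
Qed.

Lemma base_mul n v w : base n (mul v w) = base n v + shift (top n v) (base n w).
Proof. by []. Qed.
Lemma top_mul n v w : top n (mul v w) = top n v + top n w.
Proof. by []. Qed.
Lemma base_inv n v : base n (inv v) = - shift (- top n v) (base n v).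
Proof. by []. Qed.
Lemma top_inv n v : top n (inv v) = - top n v.
Proof. by []. Qed.
Lemma base_one n : base n one = 0. Proof. by []. Qed.
Lemma top_one n : top n one = 0. Proof. by []. Qed.

Definition is_base (w : W) := forall n, top n w = 0.
Definition is_top (w : W) := forall n, base n w = 0.

Lemma is_base_mul v w : is_base v -> is_base w -> is_base (mul v w).
Proof. by move=> bv bw n; rewrite top_mul bv bw addr0. Qed.
Lemma is_base_inv v : is_base v -> is_base (inv v).
Proof. by move=> bv n; rewrite top_inv bv oppr0. Qed.
Lemma base_mulE n v w : is_base v -> base n (mul v w) = base n v + base n w.
Proof. by move=> bv; rewrite base_mul bv shift0x. Qed.
Lemma base_invE n v : is_base v -> base n (inv v) = - base n v.
Proof. by move=> bv; rewrite base_inv bv oppr0 shift0x. Qed.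
Lemma is_top_mul v w : is_top v -> is_top w -> is_top (mul v w).
Proof. by move=> tv tw n; rewrite base_mul tv tw shift0 addr0. Qed.
Lemma is_base_one : is_base one. Proof. by []. Qed.
Lemma is_top_one : is_top one. Proof. by []. Qed.

Lemma top_pow n w k : top n (gpow mul one w k) = top n w *+ k.
Proof. by elim: k => //= k IH; rewrite top_mul IH mulrS. Qed.
Lemma is_base_pow w k : is_base w -> is_base (gpow mul one w k).
Proof. by move=> bw n; rewrite top_pow bw mul0rn. Qed.
Lemma is_top_pow w k : is_top w -> is_top (gpow mul one w k).
Proof. by move=> tw; elim: k => //= k IH; exact: is_top_mul. Qed.
Lemma base_pow n w k : is_base w -> base n (gpow mul one w k) = base n w *+ k.
Proof. by move=> bw; elim: k => //= k IH; rewrite base_mulE // IH mulrS. Qed.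

Lemma is_base_conj g v : is_base v -> is_base (gconj mul inv g v).
Proof. by move=> bv n; rewrite !top_mul top_inv bv addr0 subrr. Qed.
Lemma base_conj n g v : is_base v -> base n (gconj mul inv g v) = shift (top n g) (base n v).
Proof.
move=> bv; rewrite !base_mul top_mul bv addr0 base_inv shiftN shift_shift subrr shift0x.
by rewrite addrAC subrr add0r.
Qed.
Lemma is_base_dif h v : is_base v -> is_base (gdif mul inv h v).
Proof. by move=> bv; apply: is_base_mul; [exact: is_base_conj | exact: is_base_inv]. Qed.
Lemma base_dif n h v : is_base v ->
  base n (gdif mul inv h v) = shift (top n h) (base n v) - base n v.
Proof. by move=> bv; rewrite base_mulE ?base_conj ?base_invE //; exact: is_base_conj. Qed.

Lemma top_generator i : {w : W | (forall n, base n w = 0) /\ (forall n, top n w = unitX n i)}.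
Proof.
by apply/cid/W_exists => n; [rewrite raddf0 | rewrite red_unitX].
Qed.
Lemma base_generator j :
  {w : W | (forall n, base n w = delta 0 (unitV n j)) /\ (forall n, top n w = 0)}.
Proof.
by apply/cid/W_exists => n; [rewrite red_delta raddf0 red_unitV | rewrite raddf0].
Qed.

Definition par i : W := if (i < d)%N then sval (top_generator i) else sval (base_generator (i - d)).
Lemma par_top i : (i < d)%N -> is_top (par i) /\ forall n, top n (par i) = unitX n i.
Proof. by rewrite /par => ->; exact: (svalP (top_generator i)). Qed.
Lemma par_base j : is_base (par (d + j)) /\ forall n, base n (par (d + j)) = delta 0 (unitV n j).
Proof.
rewrite /par ltnNge leq_addr addKn /=.
by have [Eb Et] := svalP (base_generator j); split.
Qed.
Lemma par_d : is_base (par d) /\ forall n, base n (par d) = delta 0 (unitV n 0).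
Proof. by have := par_base 0; rewrite addn0. Qed.

Lemma unitV0_neq0 n : unitV n 0 != 0.
Proof.
apply/eqP => /ffunP/(_ (Ordinal m_gt0))/eqP.
by rewrite !ffunE eqxx Zl_natr_eq0 // dvdn1 -(expn0 p) eqn_exp2l ?prime_gt1.
Qed.

Lemma delta_fixed n (x : Xl n) : shift x (delta 0 (unitV n 0)) = delta 0 (unitV n 0) -> x = 0.
Proof.
rewrite shift_delta addr0 => /ffunP/(_ x); rewrite !ffunE eqxx; case: eqP => // _ /eqP.
by rewrite (negPf (unitV0_neq0 n)).
Qed.

(** At each level a_0 is a nonzero point mass at the origin, which no nonzero translation fixes. *)
Lemma in_baseP v : in_base d mul par v <-> is_base v.
Proof.
have [bd Ed] := par_d; rewrite /in_base /gcomm; split=> [E n|bv].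
  have := congr1 (base n) E; rewrite !base_mul bd shift0x addrC => /addIr.
  by rewrite Ed; exact: delta_fixed.
by apply: W_ext => n; rewrite ?base_mulE ?top_mul // addrC.
Qed.

(** From some level on h is nontrivial, and it fixes v at every level. By [redM_invariant] each step
    down gains a factor p, so starting high enough makes v at a given level divisible by any p^e. *)
Lemma W_faithful h v : is_top h -> is_base v -> gdif mul inv h v = one -> h = one \/ v = one.
Proof.
move=> th bv E; have [|nh] := pselect (h = one); [by left | right].
have fix_v n : shift (top n h) (base n v) = base n v.
  by have /eqP := congr1 (base n) E; rewrite base_dif // subr_eq0 => /eqP.
have [n0 Hn0] : exists n0, forall n, (n0 <= n)%N -> top n h != 0.
  apply: contrapT => nn; apply: nh; apply: W_ext => n; first by rewrite th.
  apply: contrapT => /eqP hn; apply: nn; exists n.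
  elim=> [|k IH]; first by rewrite leqn0 => /eqP <-.
  rewrite leq_eqVlt => /predU1P[<- //|/IH]; apply: contra_neq => hk.
  by rewrite -redX_top hk raddf0.
have Hdiv e n : (n0 <= n)%N -> forall z, exists u, base n v z = u *+ (p ^ e).
  elim: e n => [|e IH] n nn z; first by exists (base n v z).
  rewrite -redM_base; apply: (redM_invariant p_pr (Hn0 n.+1 (leqW nn)) (fix_v _)).
  by apply: IH; exact: leqW.
have v0 n : (n0 <= n)%N -> base n v = 0.
  move=> nn; apply/ffunP=> z; have [u ->] := Hdiv n.+1 n nn z.
  by apply/ffunP=> j; rewrite ffunMnE Zl_mulrn_exp // !ffunE.
apply: W_ext => n //.
suff H k l : base (k + l) v = 0 -> base l v = 0.
  by apply: (H n0 n); apply: v0; exact: leq_addr.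
elim: k l => [|k IH] l; first by rewrite add0n.
by rewrite addSnnS => /IH E'; rewrite -redM_base E' raddf0.
Qed.

(** If h commutes with x_0, its base part is fixed by x_0, hence trivial by [W_faithful]. *)
Lemma in_topP h : in_top mul par h <-> is_top h.
Proof.
have [t0 E0] := par_top d_gt0; rewrite /in_top /gcomm; split=> [E|th]; last first.
  by apply: W_ext => n; rewrite ?base_mul ?top_mul ?t0 ?th ?shift0 // addrC.
have [v [Eb Et]] := @W_exists (base ^~ h) (fun=> 0) (redM_base ^~ h) (fun n => raddf0 _).
have bv : is_base v by [].
have [|E'|v1] := @W_faithful (par 0) v t0 bv.
- apply: W_ext => n; last by rewrite is_base_dif.
  rewrite base_dif // Eb base_one.
  have := congr1 (base n) E; rewrite !base_mul t0 shift0 addr0 add0r => <-.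
  by rewrite subrr.
- have := congr1 (top 0) E'; rewrite E0 => /ffunP/(_ (Ordinal d_gt0))/eqP.
  by rewrite !ffunE eqxx Zl_natr_eq0 // dvdn1 -(expn0 p) eqn_exp2l ?prime_gt1.
by move=> n; rewrite -Eb v1.
Qed.

Lemma in_filtr_base k v : in_filtr p d mul inv one par k v -> is_base v.
Proof.
elim: k v => [|k IH] v /=.
  by move=> [u /in_baseP bu ->]; exact: is_base_pow.
move=> [w [u [/IH bw /in_baseP bu ->]]]; apply: is_base_mul => //.
exact: is_base_dif.
Qed.

Lemma in_filtr_combination k v : (k <= d)%N ->
  in_filtr p d mul inv one par k v -> forall n, combinable k (base n v).
Proof.
elim: k v => [|k IH] v kd /=.
  by move=> [u /in_baseP bu ->] n; rewrite base_pow //; exact: combinable_mulrn.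
move=> [w [u [Hw /in_baseP bu ->]]] n; have bw := in_filtr_base Hw.
rewrite base_mulE //; apply: combinableD.
  have [u0 [u1 ->]] := IH w (ltnW kd) Hw n.
  apply: combinableD; first exact: combinable_mulrn.
  by apply: combinable_sum => i ik; apply: combinable_dif; exact: leqW.
rewrite base_dif // (par_top kd).2.
exact: (@combinable_dif p m d k.+1 n (Ordinal kd)).
Qed.

Lemma combination_in_filtr k v (u0 : forall n, Ml n) (u : forall n, {ffun 'I_d -> Ml n}) :
  (k <= d)%N -> is_base v ->
  (forall n, redM (u0 n.+1) = u0 n) -> (forall n i, redM (u n.+1 i) = u n i) ->
  (forall n, combination k (base n v) (u0 n) (u n)) ->
  in_filtr p d mul inv one par k v.
Proof.
move=> + + Eu0 Eu; elim: k v => [|k IH] v kd bv Cv.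
  have [w [Eb Et]] := @W_exists u0 (fun=> 0) Eu0 (fun n => raddf0 _).
  exists w; first by apply/in_baseP.
  apply: W_ext => n; last by rewrite bv is_base_pow.
  by rewrite base_pow // Eb Cv big1 ?addr0.
have [w [Eb Et]] := @W_exists (fun n => u n (Ordinal kd)) (fun=> 0)
  (fun n => Eu n (Ordinal kd)) (fun n => raddf0 _).
have bw : is_base w by [].
have bD := is_base_dif (par k) bw.
have bvi := is_base_mul bv (is_base_inv bD).
exists (mul v (inv (gdif mul inv (par k) w))), w; split; last 2 first.
- exact/in_baseP.
- apply: W_ext => n; first by rewrite base_mulE // base_mulE // base_invE // subrK.
  by rewrite top_mul bvi bD bv addr0.
apply: IH => //; first exact: ltnW.
move=> n; rewrite base_mulE // base_invE // base_dif // Eb (par_top kd).2 /combination.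
rewrite Cv -addrA; congr (_ + _).
rewrite (bigD1 (Ordinal kd)) //= addrAC subrr add0r; apply: eq_bigl => i.
by rewrite ltnS [(i < k)%N]ltn_neqAle andbC.
Qed.

(** Vanishing coset sums give witnesses at each level separately; [koenig] makes them compatible, so
    that they come from elements of the limit. *)
Lemma in_filtr_csum k v : (k <= d)%N -> is_base v ->
  in_filtr p d mul inv one par k v <-> forall n z j, csum k (base n v) z j = 0.
Proof.
move=> kd bv; split=> [Hv n z j|Hv].
  have [u0 [u Cv]] := in_filtr_combination kd Hv n; exact: csum_combination Cv.
have [s [Es Ps]] := @koenig (fun n => (Ml n * {ffun 'I_d -> Ml n})%type)
  (fun n t => (redM t.1, [ffun i => redM (t.2 i)]))
  (fun n t => combination k (base n v) t.1 t.2)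
  (fun n t Ct => eq_ind _ (fun f => combination k f _ _) (combination_red p_pr Ct) _ (redM_base n v))
  (fun n => let: ex_intro u0 (ex_intro u C) := combinable_csum p_pr (Hv n) in ex_intro _ (u0, u) C).
apply: (@combination_in_filtr k v (fun n => (s n).1) (fun n => (s n).2)) => // n.
  exact: (congr1 fst (Es n)).
by move=> i; rewrite -(Es n) /= ffunE.
Qed.

Lemma top_gprod i c : (i + size c <= d)%N -> is_top (gprod mul one par i c) /\
  forall n (l : 'I_d), top n (gprod mul one par i c) l = if (i <= l)%N then (nth 0 c (l - i))%:R else 0.
Proof.
elim: c i => [|k c IH] i /= ic.
  by split=> // n l; rewrite top_one ffunE nth_nil if_same.
have id : (i < d)%N by lia.
have [tc Ec] : _ := IH i.+1 ltac:(lia).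
have [ti Ei] := par_top id; split; first by apply: is_top_mul => //; exact: is_top_pow.
move=> n l; rewrite top_mul top_pow Ei !ffunE ffunMnE ffunE Ec.
case: (ltngtP i l) => [il|li|->].
- by rewrite mul0rn add0r -(subnSK il).
- by rewrite mul0rn addr0.
- by rewrite subnn addr0.
Qed.

Lemma base_gprod j c : (j + size c <= m)%N -> is_base (gprod mul one par (d + j) c) /\
  forall n, base n (gprod mul one par (d + j) c) =
    delta 0 [ffun l : 'I_m => if (j <= l)%N then (nth 0 c (l - j))%:R else 0].
Proof.
elim: c j => [|k c IH] j /= jc.
  split=> // n; apply/ffunP=> z; rewrite !ffunE; case: ifP => // _.
  by apply/ffunP=> l; rewrite !ffunE nth_nil if_same.
have [bc Ec] : _ := IH j.+1 ltac:(lia).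
have [bj Ej] := par_base j; have bp := is_base_pow k bj; rewrite addnS in bc Ec.
split=> [|n]; first exact: is_base_mul.
rewrite base_mulE // base_pow // Ej Ec; apply/ffunP=> z; rewrite !ffunE ffunMnE !ffunE.
case: eqP => [_|_]; last by rewrite mul0rn addr0.
apply/ffunP=> l; rewrite !ffunE ffunMnE !ffunE [(l == j :> nat)]eq_sym.
case: (ltngtP j l) => [jl|lj|->].
- by rewrite mul0rn add0r -(subnSK jl).
- by rewrite mul0rn addr0.
- by rewrite subnn addr0.
Qed.

Lemma exponents_eq0 k c : c \in exponents p k ->
  (forall i, (i < k)%N -> (p %| nth 0 c i)%N) -> all (pred1 0%N) c.
Proof.
rewrite mem_exponents => /andP[/eqP <- /all_nthP lt] dv.
apply/(all_nthP 0%N) => i ic /=; have := dv i ic.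
by case: (nth _ _ _) (lt 0%N i ic) => // x xp /(dvdn_leq (ltn0Sn x)); rewrite leqNgt xp.
Qed.

Lemma exponents_mkseq k (f : nat -> nat) : (forall i, (f i < p)%N) -> mkseq f k \in exponents p k.
Proof.
by move=> fp; rewrite mem_exponents size_mkseq eqxx; apply/allP => _ /mapP[i _ ->].
Qed.

Lemma res_top n w l : res (top n w l) = res (top 0 w l).
Proof. by elim: n => // n IH; rewrite -IH -(redX_top n) ffunE (res_red p_pr). Qed.

Lemma csum_base n w z y j : csum d (base n w) z j = csum d (base 0 w) y j.
Proof.
elim: n z => [|n IH] z; last by rewrite -(IH 0) -(redM_base n) (csum_total p_pr _ 0 z).
by apply: eq_bigl => x; apply/agreeP/agreeP => _ i; rewrite leqNgt ltn_ord.
Qed.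

Lemma csum_delta n (v : Vl p m n) z j : csum d (delta (0 : Xl n) v) z j = res (v j).
Proof.
rewrite /csum (bigD1 0) /=; last by apply/agreeP => i; rewrite leqNgt ltn_ord.
rewrite ffunE eqxx big1 ?addr0 // => y /andP[_ /negPf y0].
by rewrite ffunE y0 ffunE raddf0.
Qed.

Lemma Zp_ltn (a : 'Z_p) : (a < p)%N.
Proof. by have := ltn_ord a; rewrite [X in (_ < X)%N](Zp_modulus p_pr). Qed.

Lemma W_top_gen h : is_top h -> exists2 c, c \in exponents p d &
  exists2 k, is_top k & h = mul (gprod mul one par 0 c) (gpow mul one k p).
Proof.
move=> th.
(* The exponent of x_i is the i-th coordinate modulo p, which is the same at every level by
   [res_top]; the default 0 is not reached for i < d. *)
pose f i := if insub i is Some l then nat_of_ord (res (top 0 h l)) else 0%N.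
have fp i : (f i < p)%N.
  rewrite /f; case: insubP => [l _ _|_]; last exact: prime_gt0.
  exact: Zp_ltn.
pose c := mkseq f d; have ce : c \in exponents p d by exact: exponents_mkseq.
exists c => //.
have [tc Ec] := @top_gprod 0 c ltac:(by rewrite size_mkseq).
have ex n : exists k : Xl n, top n h = top n (gprod mul one par 0 c) + k *+ p.
  have /(_ _)/(res_eq0 p_pr)/cid H : forall l, res ((top n h - top n (gprod mul one par 0 c)) l) = 0.
    move=> l; rewrite !ffunE raddfB /= Ec leq0n subn0 nth_mkseq // (res_natr p_pr) res_top.
    by rewrite /f insubT //= => ltl; rewrite natr_Zp (_ : Sub _ _ = l) ?subrr //; exact: val_inj.
  exists [ffun l => sval (H l)]; rewrite addrC; apply/eqP; rewrite -subr_eq; apply/eqP/ffunP=> l.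
  by rewrite [RHS]ffunMnE [in RHS]ffunE; exact: svalP (H l).
have [s [Es Ps]] := @koenig (fun n => Xl n) (fun n => redX) 
  (fun n k => top n h = top n (gprod mul one par 0 c) + k *+ p)
  (fun n k Ck => etrans (esym (redX_top n h)) (etrans (congr1 redX Ck) ltac:(by rewrite raddfD raddfMn /= redX_top))) ex.
have [k [Eb Et]] := @W_exists (fun=> 0) s (fun n => raddf0 _) Es.
have tk : is_top k by [].
exists k => //; apply: W_ext => n; last by rewrite top_mul top_pow Et.
by rewrite th base_mul tc is_top_pow // shift0 addr0.
Qed.

Lemma W_base_gen v : is_base v -> exists2 c, c \in exponents p m &
  exists2 w, in_filtr p d mul inv one par d w & v = mul (gprod mul one par d c) w.
Proof.
move=> bv.
(* The exponent of a_j is the total sum of the j-th component modulo p, which is the same at every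
   level by [csum_base]. *)
pose f i := if insub i is Some l then nat_of_ord (csum d (base 0 v) 0 l) else 0%N.
have fp i : (f i < p)%N.
  rewrite /f; case: insubP => [l _ _|_]; last exact: prime_gt0.
  exact: Zp_ltn.
pose c := mkseq f m; have ce : c \in exponents p m by exact: exponents_mkseq.
exists c => //.
have [bc Ec] := @base_gprod 0 c ltac:(by rewrite size_mkseq).
rewrite addn0 in bc Ec; set g := gprod _ _ _ _ _ in bc Ec *.
have big : is_base (mul (inv g) v) by apply: is_base_mul => //; exact: is_base_inv.
exists (mul (inv g) v).
  apply/in_filtr_csum => // n z j.
  rewrite base_mulE ?base_invE //; last exact: is_base_inv.
  rewrite (csumD p_pr) (csumN p_pr) (csum_base v z 0) Ec csum_delta ffunE leq0n subn0.
  rewrite nth_mkseq // (res_natr p_pr) /f insubT //= => ltj.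
  by rewrite natr_Zp (_ : Sub _ _ = j) ?addNr //; exact: val_inj.
apply: W_ext => n; last by rewrite top_mul bc big bv addr0.
by rewrite base_mulE // base_mulE ?base_invE ?addNKr ?addKr ?addrA ?subrr ?add0r //; exact: is_base_inv.
Qed.

(** Induction over the levels: if h^p is trivial at level n, so is the right-hand commutator; then h
    fixes the point mass a_0 there and is trivial at level n, which makes it p-torsion at level n +
    1. *)
Lemma W_reduced h u : is_top h -> is_base u ->
  gdif mul inv h (par d) = gdif mul inv (gpow mul one h p) u -> h = one.
Proof.
move=> th bu E; have [bd Ed] := par_d; apply: W_ext => n; first by rewrite th.
rewrite top_one; suff hp : top n h *+ p = 0.
  have := congr1 (base n) E; rewrite !base_dif // top_pow hp shift0x subrr Ed.
  by move/eqP; rewrite subr_eq0 => /eqP /delta_fixed.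
elim: n => [|n IH].
  by apply/ffunP=> l; rewrite ffunMnE -[p in _ *+ p]expn1 Zl_mulrn_exp // ffunE.
apply/(redX_eq0 p_pr); rewrite redX_top.
have := congr1 (base n) E; rewrite !base_dif // top_pow IH shift0x subrr Ed.
by move/eqP; rewrite subr_eq0 => /eqP /delta_fixed.
Qed.

Theorem Wlim_axioms : wreath_axioms p m d mul inv one par.
Proof.
have one_top := is_top_one; have one_base := is_base_one.
split.
- by move=> j _; apply/in_baseP; case: (par_base j).
- by move=> i id; apply/in_topP; case: (par_top id).
- move=> u v /in_baseP bu /in_baseP bv; apply: W_ext => n.
    by rewrite !base_mulE // addrC.
  by rewrite !top_mul bu bv.
- move=> u v /in_topP bu /in_topP bv; apply: W_ext => n.
    by rewrite !base_mul bu bv !shift0.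
  by rewrite !top_mul addrC.
- by move=> g v /in_baseP bv; apply/in_baseP; exact: is_base_conj.
- move=> g.
  have [v [Eb Et]] := @W_exists (base ^~ g) (fun=> 0) (redM_base ^~ g) (fun n => raddf0 _).
  have [h [Fb Ft]] := @W_exists (fun=> 0) (top ^~ g) (fun n => raddf0 _) (redX_top ^~ g).
  exists v, h; split; [exact/in_baseP | exact/in_topP |].
  apply: W_ext => n; first by rewrite base_mul Eb Fb shift0 addr0.
  by rewrite top_mul Et Ft add0r.
- by move=> g /in_baseP bg /in_topP tg; apply: W_ext.
- move=> h /in_topP th E; apply: W_ext => n; first by rewrite th.
  by rewrite -(redX_top n) top_one; apply/(redX_eq0 p_pr); rewrite -top_pow E.
- move=> h /in_topP /W_top_gen [c ce [k tk E]]; exists c => //; exists k => //.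
  exact/in_topP.
- move=> c ce k /in_topP tk E; apply: (exponents_eq0 ce) => i id.
  have sc : size c = d by move: ce; rewrite mem_exponents => /andP[/eqP].
  have [_ Ec] := @top_gprod 0 c ltac:(by rewrite sc).
  have := congr1 (fun w => res (top 0 w (Ordinal id))) E.
  rewrite Ec leq0n subn0 top_pow ffunMnE (res_mulrn p_pr) (res_natr p_pr).
  by move/eqP; rewrite (Zp_natr_eq0 p_pr).
- move=> v /in_baseP bv E; apply: W_ext => n; last by rewrite bv.
  rewrite -(redM_base n) base_one; apply: (redM_torsion p_pr).
  by rewrite -base_pow // E.
- move=> k kd v /in_baseP bv; have [tk Ek] := par_top kd.
  have bD := is_base_dif (par k) bv.
  move/(in_filtr_csum (ltnW kd) bD) => H; apply/(in_filtr_csum (ltnW kd) bv) => n z j.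
  rewrite -(redM_base n); apply: (csum_regular p_pr _ kd) => y.
  by rewrite -(H n.+1 y j) base_dif // Ek.
- by move=> v /in_baseP; exact: W_base_gen.
- move=> c ce Hc; apply: (exponents_eq0 ce) => i im.
  have sc : size c = m by move: ce; rewrite mem_exponents => /andP[/eqP].
  have [bc Ec] := @base_gprod 0 c ltac:(by rewrite sc).
  rewrite addn0 in bc Ec.
  have /(_ 0%N 0 (Ordinal im)) := (in_filtr_csum (leqnn d) bc).1 Hc.
  by rewrite Ec csum_delta ffunE leq0n subn0 (res_natr p_pr) => /eqP; rewrite (Zp_natr_eq0 p_pr).
- by move=> h v /in_topP th /in_baseP bv; exact: W_faithful.
- by move=> h u /in_topP th /in_baseP bu; exact: W_reduced.
Qed.

End WreathLimit.

(** * Profinite models of the axioms *)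

(** Base and top of a model are rewritten additively, so that the module theory above applies to
    them. *)
Record abelian_subgroup (G : groupType) := AbelianSubgroup {
  asg_mem : G -> Prop;
  asg1 : asg_mem 1%g;
  asgM : forall x y, asg_mem x -> asg_mem y -> asg_mem (x * y)%g;
  asgV : forall x, asg_mem x -> asg_mem (x^-1)%g;
  asgC : forall x y, asg_mem x -> asg_mem y -> (x * y = y * x)%g }.

Section AbelianSubgroup.
Variables (G : groupType) (B : abelian_subgroup G).

Definition asg := {x : G | `[< asg_mem B x >]}.
HB.instance Definition _ := Choice.on asg.

Definition asg_val (u : asg) : G := val u.
Definition asg_mk x (Bx : asg_mem B x) : asg := exist _ x (asboolT Bx).
Lemma asg_valP u : asg_mem B (asg_val u). Proof. by apply/asboolP; exact: (valP u). Qed.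
Lemma asg_val_inj : injective asg_val. Proof. exact: val_inj. Qed.

Definition asg_zero := asg_mk (asg1 B).
Definition asg_add u v := asg_mk (asgM (asg_valP u) (asg_valP v)).
Definition asg_opp u := asg_mk (asgV (asg_valP u)).

Fact asg_addA : associative asg_add.
Proof. by move=> u v w; apply: val_inj; exact: mulgA. Qed.
Fact asg_addC : commutative asg_add.
Proof. by move=> u v; apply: val_inj; apply: (@asgC _ B); exact: asg_valP. Qed.
Fact asg_add0 : left_id asg_zero asg_add.
Proof. by move=> u; apply: val_inj; exact: mul1g. Qed.
Fact asg_addN : left_inverse asg_zero asg_opp asg_add.
Proof. by move=> u; apply: val_inj; exact: mulVg. Qed.
HB.instance Definition _ := GRing.isZmodule.Build asg asg_addA asg_addC asg_add0 asg_addN.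

Lemma asg_val0 : asg_val 0 = 1%g. Proof. by []. Qed.
Lemma asg_valD u v : asg_val (u + v) = (asg_val u * asg_val v)%g. Proof. by []. Qed.
Lemma asg_valN u : asg_val (- u) = ((asg_val u)^-1)%g. Proof. by []. Qed.
Lemma asg_valMn u n : asg_val (u *+ n) = (asg_val u ^+ n)%g.
Proof. by elim: n => [|n IH]; rewrite ?mulrS ?expgS ?asg_valD ?IH. Qed.
End AbelianSubgroup.

Lemma gpowE (G : groupType) (x : G) n : gpow (fun x y : G => x * y)%g 1%g x n = (x ^+ n)%g.
Proof. by elim: n => //= n ->; rewrite expgS. Qed.

(** * The base of a model as a module over its top group *)

Section Model.
Variables (p m d : nat).
Hypotheses (p_pr : prime p) (m_gt0 : (0 < m)%N) (d_gt0 : (0 < d)%N).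
Variables (G : topGroupType) (e : nat -> G).
Hypothesis pG : profinite G.
Notation gmul := (fun x y : G => (x * y)%g).
Notation ginv := (fun x : G => (x^-1)%g).
Notation gone := (1%g : G).
Hypothesis axG : wreath_axioms p m d gmul ginv gone e.
Notation inB := (in_base d gmul e).
Notation inX := (in_top gmul e).

Lemma commute_mul (c x y : G) : (x * c = c * x)%g -> (y * c = c * y)%g -> (x * y * c = c * (x * y))%g.
Proof. by move=> cx cy; rewrite -mulgA cy !mulgA cx. Qed.
Lemma commute_inv (c x : G) : (x * c = c * x)%g -> (x^-1 * c = c * x^-1)%g.
Proof. by move=> cx; apply: (@mulgI _ x); rewrite mulVKg mulgA cx mulgK. Qed.

Definition baseG : abelian_subgroup G := {|
  asg_mem := inB;
  asg1 := etrans (mul1g _) (esym (mulg1 _));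
  asgM := fun x y => @commute_mul (e d) x y;
  asgV := fun x => @commute_inv (e d) x;
  asgC := fun x y => @ax_baseC _ _ _ _ _ _ _ _ axG x y |}.
Definition topG : abelian_subgroup G := {|
  asg_mem := inX;
  asg1 := etrans (mul1g _) (esym (mulg1 _));
  asgM := fun x y => @commute_mul (e 0%N) x y;
  asgV := fun x => @commute_inv (e 0%N) x;
  asgC := fun x y => @ax_topC _ _ _ _ _ _ _ _ axG x y |}.

Notation A := (asg baseG).
Notation X := (asg topG).

Definition actG (h : X) (v : A) : A :=
  asg_mk (B := baseG) (ax_baseJ axG (asg_val h) (asg_valP v)).
Lemma actGE h v : asg_val (actG h v) = (asg_val h * asg_val v * (asg_val h)^-1)%g.
Proof. by []. Qed.

Lemma actGB h u v : actG h (u - v) = actG h u - actG h v.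
Proof.
apply: asg_val_inj; rewrite !asg_valD !asg_valN !actGE asg_valD asg_valN.
by rewrite !invgM invgK !mulgA mulgVK.
Qed.
Lemma actG0 v : actG 0 v = v.
Proof. by apply: asg_val_inj; rewrite actGE asg_val0 mul1g invg1 mulg1. Qed.
Lemma actGD h k v : actG (h + k) v = actG h (actG k v).
Proof. by apply: asg_val_inj; rewrite !actGE asg_valD invgM !mulgA. Qed.

Notation dif := (dif actG).
Notation addsm := (addsm actG).
Notation submod := (submod actG).

Lemma val_dif h v : asg_val (dif h v) = gdif gmul ginv (asg_val h) (asg_val v).
Proof. by []. Qed.

(** Matching on [idP] supplies the proof of i < d that [ax_top] asks for; the 0 beyond d is a
    dummy. *)
Definition genX (i : nat) : X :=
  if @idP (i < d)%N is ReflectT id then asg_mk (B := topG) (ax_top axG id) else 0.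
Definition genA (j : nat) : A :=
  if @idP (j < m)%N is ReflectT jm then asg_mk (B := baseG) (ax_base axG jm) else 0.
Lemma val_genX i : (i < d)%N -> asg_val (genX i) = e i.
Proof. by rewrite /genX; case: {-}_ / idP => [id _|/[swap] ->]. Qed.
Lemma val_genA j : (j < m)%N -> asg_val (genA j) = e (d + j).
Proof. by rewrite /genA; case: {-}_ / idP => [jm _|/[swap] ->]. Qed.

Lemma val_gprod (B : abelian_subgroup G) (y : nat -> asg B) i c :
  (forall j, (j < size c)%N -> asg_val (y j) = e (i + j)) ->
  asg_val (\sum_(j < size c) y j *+ nth 0%N c j) = gprod gmul gone e i c.
Proof.
elim: c i y => [|k c IH] i y Ey; first by rewrite big_ord0.
rewrite big_ord_recl asg_valD asg_valMn /= gpowE Ey // addn0; congr (_ * _)%g.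
by rewrite -(IH _ (y \o succn)) => [|j jc] //=; rewrite Ey // addSnnS.
Qed.

Notation filtrG := (filtr actG p genX).

Lemma in_filtrE k v : (k <= d)%N ->
  in_filtr p d gmul ginv gone e k v <-> exists2 u, filtrG k u & v = asg_val u.
Proof.
elim: k v => [|k IH] v kd /=; split.
- move=> [u bu ->]; exists (asg_mk (B := baseG) bu *+ p); last by rewrite asg_valMn gpowE.
  by exists (asg_mk (B := baseG) bu).
- move=> [_ [u ->] ->]; exists (asg_val u); first exact: (asg_valP u).
  by rewrite asg_valMn gpowE.
- move=> [w [u [/(IH _ (ltnW kd))[w' Fw ->] bu ->]]].
  exists (w' + dif (genX k) (asg_mk (B := baseG) bu)); last by rewrite asg_valD val_dif val_genX.
  by exists w', (asg_mk (B := baseG) bu).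
move=> [_ [w [u [Fw ->]]] ->]; exists (asg_val w), (asg_val u); split.
- by apply/(IH _ (ltnW kd)); exists w.
- exact: (asg_valP u).
by rewrite asg_valD -[pdif _ _ _ _]/(dif (genX k) u) val_dif val_genX.
Qed.

Lemma in_filtr_val k (v : A) : (k <= d)%N ->
  in_filtr p d gmul ginv gone e k (asg_val v) <-> filtrG k v.
Proof. by move=> kd; rewrite in_filtrE //; split=> [[u Fu /asg_val_inj ->]|Fv] //; exists v. Qed.

Lemma base_tf (v : A) : v *+ p = 0 -> v = 0.
Proof.
move=> E; apply: asg_val_inj; apply: (ax_base_tf axG (asg_valP v)).
by rewrite gpowE -asg_valMn E.
Qed.
Lemma top_tf (h : X) : h *+ p = 0 -> h = 0.
Proof.
move=> E; apply: asg_val_inj; apply: (ax_top_tf axG (asg_valP h)).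
by rewrite gpowE -asg_valMn E.
Qed.

Lemma filtr_regular k : (k < d)%N -> regular actG (filtrG k) (genX k).
Proof.
move=> kd v /(in_filtr_val _ (ltnW kd)) Fv; apply/(in_filtr_val _ (ltnW kd)).
by apply: (ax_base_reg axG kd (asg_valP v)); rewrite -(val_genX kd) -val_dif.
Qed.

Let aA (j : 'I_m) : A := genA j.
Let aX (i : 'I_d) : X := genX i.

Definition residues k (c : 'I_k -> int) : seq nat :=
  mkseq (fun i => if insub i is Some j then `|(c j %% p)%Z|%N else 0%N) k.

Lemma residues_exponents k (c : 'I_k -> int) : residues c \in exponents p k.
Proof.
rewrite mem_exponents size_mkseq eqxx; apply/allP => _ /mapP[i _ ->].
have p0 : p%:Z != 0 by rewrite eqz_nat -lt0n prime_gt0.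
case: insubP => [j _ _|_]; last exact: prime_gt0.
by rewrite -ltz_nat gez0_abs ?modz_ge0 // ltz_pmod // ltz_nat prime_gt0.
Qed.

Lemma residues_nth k (c : 'I_k -> int) (j : 'I_k) : (nth 0%N (residues c) j)%:Z = (c j %% p)%Z.
Proof.
rewrite nth_mkseq // insubT //= => jk; have -> : Sub (nat_of_ord j) jk = j by exact: val_inj.
by rewrite gez0_abs // modz_ge0 // eqz_nat -lt0n prime_gt0.
Qed.

Lemma comb_residues (V : zmodType) k (a : 'I_k -> V) (c : 'I_k -> int) :
  multiple p (comb a c - comb a (fun j => (nth 0%N (residues c) j)%:Z)).
Proof.
exists (comb a (fun j => (c j %/ p)%Z)); rewrite /comb -sumrB -sumrMnl.
apply: eq_bigr => j _; rewrite -mulrzBr residues_nth {1}(divz_eq (c j) p) addrK.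
by rewrite mulrzA.
Qed.

Lemma residues_dvd k (c : 'I_k -> int) j : all (pred1 0%N) (residues c) -> (p %| c j)%Z.
Proof.
move/(all_nthP 0%N)/(_ j); rewrite size_mkseq => /(_ (ltn_ord j))/eqP E.
by apply/dvdz_mod0P; rewrite -residues_nth E.
Qed.

Lemma val_combA c : c \in exponents p m ->
  asg_val (comb aA (fun j => (nth 0%N c j)%:Z)) = gprod gmul gone e d c.
Proof.
rewrite mem_exponents => /andP[/eqP sc _].
rewrite -(val_gprod (y := genA)); last by rewrite sc; exact: val_genA.
by rewrite /comb sc.
Qed.
Lemma val_combX c : c \in exponents p d ->
  asg_val (comb aX (fun j => (nth 0%N c j)%:Z)) = gprod gmul gone e 0 c.
Proof.
rewrite mem_exponents => /andP[/eqP sc _].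
rewrite -(val_gprod (y := genX)); last by rewrite sc; exact: val_genX.
by rewrite /comb sc.
Qed.

(** The axiom speaks of exponents below p; passing from integers to their residues changes the
    combination by a multiple of p, which lies in every filtration step. *)
Lemma base_indep c : filtrG d (comb aA c) -> forall j, (p %| c j)%Z.
Proof.
move=> Fc j; apply: residues_dvd; apply: (ax_base_indep axG (residues_exponents c)).
rewrite -val_combA ?residues_exponents //; apply/in_filtr_val => //.
have sF : submod (filtrG d) := filtr_submod actGB actGD p genX d.
rewrite -[comb _ _](subKr (comb aA c)); apply: (smB sF) => //.
by apply: (filtr_multiple actGB genX d); exact: comb_residues.
Qed.

Lemma base_gen v : exists c, filtrG d (v - comb aA c).
Proof.
have [c ce [w Fw E]] := ax_base_gen axG (asg_valP v).
exists (fun j => (nth 0%N c j)%:Z); have [u Fu Eu] := (in_filtrE w (leqnn d)).1 Fw.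
suff -> : v - comb aA (fun j => (nth 0%N c j)%:Z) = u by [].
apply/eqP; rewrite subr_eq addrC; apply/eqP/asg_val_inj.
by rewrite asg_valD val_combA // E Eu.
Qed.

Lemma top_gen (h : X) : exists c u, h = comb aX c + u *+ p.
Proof.
have [c ce [k tk E]] := ax_top_gen axG (asg_valP h).
exists (fun j => (nth 0%N c j)%:Z), (asg_mk (B := topG) tk); apply: asg_val_inj.
by rewrite asg_valD asg_valMn val_combX // E gpowE.
Qed.

Lemma top_indep c u : comb aX c = u *+ p -> forall i, (p %| c i)%Z.
Proof.
move=> E i; apply: residues_dvd.
have [w Ew] := comb_residues aX c.
apply: (@ax_top_indep _ _ _ _ _ _ _ _ axG _ (residues_exponents c) (asg_val (u - w))).
  exact: (asg_valP (u - w)).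
rewrite gpowE -asg_valMn -val_combX ?residues_exponents // mulrnBl -E -Ew.
by rewrite subKr.
Qed.

Lemma top_gen_exp n (h : X) : exists c u, h = comb aX c + u *+ (p ^ n).
Proof.
elim: n => [|n [c [u ->]]]; first by exists (fun=> 0), h; rewrite /comb big1 ?add0r // => i _; rewrite mulr0z.
have [c' [u' ->]] := top_gen u; exists (fun i => c i + c' i * (p ^ n)%N%:Z), u'.
rewrite mulrnDl -mulrnA -expnS addrA; congr (_ + _).
have -> : comb aX c' *+ (p ^ n) = comb aX (fun i => c' i * (p ^ n)%N%:Z).
  by rewrite comb_scale pmulrn.
by rewrite /comb -big_split; apply: eq_bigr => i _; rewrite mulrzDr.
Qed.

Lemma top_indep_exp n c u : comb aX c = u *+ (p ^ n) -> forall i, ((p ^ n)%N%:Z %| c i)%Z.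
Proof.
elim: n c u => [|n IH] c u E i; first by rewrite expn0 dvd1z.
have pc : forall i, (p %| c i)%Z by apply: (@top_indep _ (u *+ (p ^ n))); rewrite -mulrnA -expnSr.
pose c' i := (c i %/ p)%Z; have cE l : c l = c' l * p by rewrite divzK.
rewrite cE expnSr PoszM dvdz_mul //; apply: (IH c' u).
apply/eqP; rewrite -subr_eq0; apply/eqP/top_tf; rewrite mulrnBl -mulrnA -expnSr -E.
apply/eqP; rewrite subr_eq0; apply/eqP; rewrite pmulrn -comb_scale.
by apply: eq_bigr => l _; rewrite cE.
Qed.

Lemma continuous_id : continuous (fun g : G => g).
Proof. by move=> x; exact: cvg_id. Qed.
Lemma continuous_cst (c : G) : continuous (fun _ : G => c).
Proof. by move=> x; exact: cst_continuous. Qed.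

Lemma closed_base : closed [set g | inB g]%classic.
Proof.
apply: (@closed_equalizer G pG (fun g => g * e d)%g (fun g => e d * g)%g);
  apply: continuous_mul; by [exact: continuous_id | exact: continuous_cst].
Qed.
Lemma closed_top : closed [set g | inX g]%classic.
Proof.
apply: (@closed_equalizer G pG (fun g => g * e 0%N)%g (fun g => e 0%N * g)%g);
  apply: continuous_mul; by [exact: continuous_id | exact: continuous_cst].
Qed.

Lemma continuous_gdifr (h : G) : continuous (fun g => gdif gmul ginv h g).
Proof.
apply: continuous_mul; last by apply: continuous_inv; exact: continuous_id.
apply: continuous_mul; last exact: continuous_cst.
by apply: continuous_mul; [exact: continuous_cst | exact: continuous_id].
Qed.
Lemma continuous_gdifl (v : G) : continuous (fun g => gdif gmul ginv g v).
Proof.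
apply: continuous_mul; last exact: continuous_cst.
apply: continuous_mul; last by apply: continuous_inv; exact: continuous_id.
by apply: continuous_mul; [exact: continuous_id | exact: continuous_cst].
Qed.

Lemma open_normal_gdif K h v : open_normal K -> K h -> K (gdif gmul ginv h v).
Proof.
move=> [_ Km Ki Kc] Kh; rewrite /gdif /gconj -!mulgA; apply: Km => //.
by rewrite mulgA; apply: Kc; exact: Ki.
Qed.
Lemma open_normal_exp K (h : G) n : open_normal K -> K h -> K (h ^+ n)%g.
Proof.
move=> oK Kh; elim: n => [|n IH]; first by rewrite expg0; exact: open_normal1 oK.
by rewrite expgS; case: oK => _ Km _ _; exact: Km.
Qed.

Lemma difDh h k v : dif (h + k) v = dif h (actG k v) + dif k v.
Proof. by rewrite /RegSeq.dif actGD addrA subrK. Qed.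
Lemma dif0h v : dif 0 v = 0.
Proof. by rewrite /RegSeq.dif actG0 subrr. Qed.

Lemma dif_mulrn h n v : exists w, dif (h *+ n) v = dif h w.
Proof.
elim: n => [|n [w E]]; first by exists 0; rewrite mulr0n dif0h dif_0 //; exact: actGB.
exists (actG (h *+ n) v + w).
rewrite mulrS difDh E difD //; exact: actGB.
Qed.

Lemma top_divisible (h : X) : (forall n, exists k : X, h = k *+ (p ^ n)) -> h = 0.
Proof.
move=> /choice[k Ek]; apply: asg_val_inj.
pose im := ((fun u => gdif gmul ginv (asg_val (h *+ p)) u) @` [set g | inB g])%classic.
have clim : closed im.
  by apply: closed_image => //; [exact: continuous_gdifr | exact: closed_base].
suff [u bu E] : im (gdif gmul ginv (asg_val h) (e d)).
  apply: (ax_reduced axG (asg_valP h) bu).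
  by rewrite gpowE -asg_valMn.
pose C := [set g : G | im (gdif gmul ginv g (e d))]%classic.
have clC : closed C by apply: closed_continuous_preimage => //; exact: continuous_gdifl.
apply: (closed_mem pG clC) => K oK.
(* The p^l-th powers of k_n and k_l are h^(p^(l-n)) and h, so these two lie in one coset of K. *)
have [n [l [nl Knl]]] := coset_pigeonhole pG (fun n => asg_val (k n)) oK.
pose hr := h *+ (p ^ (l - n)); exists (asg_val hr); rewrite {}/hr.
  (* As n < l, the exponent contains a factor p, which puts the commutator in the image of h^p -
     1. *)
  have -> : (p ^ (l - n) = p * p ^ (l - n.+1))%N by rewrite -expnS subnSK.
  have [w Ew] := dif_mulrn (h *+ p) (p ^ (l - n.+1)) (genA 0).
  exists (asg_val w); first exact: (asg_valP w).
  by rewrite -val_dif -Ew val_dif -mulrnA val_genA // addn0.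
have := open_normal_exp (p ^ l) oK Knl.
have -> : ((asg_val (k n))^-1 * asg_val (k l))%g = asg_val (- k n + k l) by [].
have Ekn : k n *+ (p ^ l) = h *+ (p ^ (l - n)).
  by rewrite [in RHS](Ek n) -mulrnA -expnD subnKC // ltnW.
rewrite -asg_valMn mulrnDl mulNrn -(Ek l) Ekn.
set hr := h *+ _; move=> Kd.
have -> : ((asg_val h)^-1 * asg_val hr)%g = (asg_val (- hr + h))^-1%g.
  by rewrite -[RHS]asg_valN opprD opprK [in RHS]addrC.
by case: oK => _ _ Ki _; exact: Ki.
Qed.

(** The p^n-th powers tend to 1 uniformly: the closed sets S n decrease, their intersection is
    trivial by [top_divisible], and compactness puts one of them inside K. *)
Lemma top_small K : open_normal K ->
  exists N, forall n (u : X), (N <= n)%N -> K (asg_val (u *+ (p ^ n))).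
Proof.
move=> oK; have [cG _ _] := pG.
pose S n := ((fun g : G => g ^+ (p ^ n))%g @` [set g | inX g])%classic.
have decS n k : (S (n + k)%N `<=` S n)%classic.
  move=> _ [g xg <-]; exists (asg_val (asg_mk (B := topG) xg *+ (p ^ k))).
    exact: (asg_valP (asg_mk (B := topG) xg *+ (p ^ k))).
  by rewrite -asg_valMn -mulrnA -expnD addnC asg_valMn.
have [|||||_ [N _ <-] SK] := @compact_directed G cG (range S) K.
- by exists (S 0%N); exists 0%N.
- move=> _ [n _ <-]; apply: closed_image => //; last exact: closed_top.
  by apply: continuous_exp; exact: continuous_id.
- move=> _ _ [n _ <-] [k _ <-]; exists (S (n + k)%N); first by exists (n + k)%N.
  by move=> y Sy; split; [exact: decS Sy | apply: (decS k n); rewrite addnC].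
- exact: open_normal_open.
- move=> y Hy; have [g xg Eg] : S 0%N y by apply: Hy; exists 0%N.
  pose h : X := asg_mk (B := topG) xg.
  have Ey : y = asg_val h by rewrite -Eg expn0 expg1.
  rewrite Ey (@top_divisible h) ?asg_val0; first exact: open_normal1 oK.
  move=> n; have [g' xg' Eg'] : S n y by apply: Hy; exists n.
  by exists (asg_mk (B := topG) xg'); apply: asg_val_inj; rewrite asg_valMn -Ey -Eg'.
exists N => n u Nn; apply: SK; rewrite -(subnKC Nn) addnC expnD mulrnA.
exists (asg_val (u *+ p ^ (n - N))); first exact: (asg_valP (u *+ p ^ (n - N))).
by rewrite -asg_valMn.
Qed.

Lemma genX0_neq0 N : genX 0 *+ (p ^ N) != 0.
Proof.
apply/eqP; elim: N => [|N IH].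
  rewrite expn0 mulr1n => E.
  have := @top_indep (fun i => (i == 0%N :> nat)%:Z) 0 _ (Ordinal d_gt0).
  rewrite /comb big1 ?mul0rn /=.
    by move=> /(_ erefl) /dvdzP[c /(congr1 absz)]; rewrite abszM /= => /esym/eqP;
      rewrite muln_eq1 => /andP[_ /eqP p1]; move: p_pr; rewrite p1.
  by move=> i _; case: eqP => [E0|_]; rewrite ?mulr0z // /aX E0 E mul0rz.
by rewrite expnSr mulrnA => /top_tf.
Qed.

(* A [p]-divisible element [v = p^n u_n] is, modulo [(h - 1)A], the limit of the
   averages of [u_n] under [h], and such limits are fixed by [h]. *)
Lemma base_divisible (v : A) : (forall n, exists u : A, v = u *+ (p ^ n)) -> v = 0.
Proof.
move=> /choice[u Eu]; apply: asg_val_inj; apply: (open_normal_separated pG) => K oK.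
have [N KN] := top_small oK.
(* A nontrivial element of X inside K: all commutators with it lie in K, so it is enough to show
   that v is one of them. *)
pose h := genX 0 *+ (p ^ N).
suff [w bw ->] : exists2 w, inB w & asg_val v = gdif gmul ginv (asg_val h) w.
  by apply: open_normal_gdif => //; exact: KN.
(* Since v = p^n u_n, this is the mean of v over the first p^n powers of h, with the division by p^n
   carried out inside A. *)
pose B n := \sum_(0 <= i < p ^ n) actG (h *+ i) (u n).
have difB n : dif h (B n) = dif (h *+ (p ^ n)) (u n).
  rewrite /B; elim: (p ^ n)%N => [|k IH].
    by rewrite big_geq // mulr0n dif0h dif_0 //; exact: actGB.
  rewrite big_nat_recr //= difD //; last exact: actGB.
  by rewrite IH mulrS difDh addrC.
have subB n : exists w, v - B n = dif h w.
  rewrite (Eu n) /B; elim: (p ^ n)%N => [|k [w E]].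
    by exists 0; rewrite big_geq // mulr0n subrr dif_0 //; exact: actGB.
  have [w' Ew'] := dif_mulrn h k (u n).
  exists (w - w'); rewrite big_nat_recr //= mulrSr RegSeq.difB; last exact: actGB.
  by rewrite -E -Ew' /RegSeq.dif opprB opprD addrACA.
have [y Hy] := cluster_point pG (fun n => asg_val (B n)).
have by_ : inB y by apply: (Hy _ closed_base); exists 0%N => n _; exact: (asg_valP (B n)).
(* h - 1 sends B n to (h^(p^n) - 1)u_n, which tends to 1; so the cluster point is fixed by h, and
   [ax_faithful] makes it trivial. *)
have y1 : y = 1%g.
  have [|E|//] := ax_faithful axG (asg_valP h) by_.
    apply: (open_normal_separated pG) => L oL; have [l Ll] := top_small oL.
    apply: (Hy [set g | L (gdif gmul ginv (asg_val h) g)]%classic).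
      apply: closed_continuous_preimage; [exact: continuous_gdifr | exact: open_normal_closed].
    exists l => n ln /=; rewrite -val_dif difB val_dif.
    by apply: open_normal_gdif => //; exact: Ll.
  by have /eqP := genX0_neq0 N; case; exact: asg_val_inj.
have [||w bw] := Hy [set g | ((fun w => gdif gmul ginv (asg_val h) w) @` [set g | inB g]) (asg_val v * g^-1)%g]%classic.
- apply: closed_continuous_preimage.
    apply: continuous_mul; first exact: continuous_cst.
    by apply: continuous_inv; exact: continuous_id.
  by apply: closed_image => //; [exact: continuous_gdifr | exact: closed_base].
- exists 0%N => n _ /=; have [w Ew] := subB n.
  by exists (asg_val w); [exact: (asg_valP w) | rewrite -val_dif -Ew].
by rewrite y1 invg1 mulg1 => E; exists w.
Qed.

(** * Closedness and separation of the submodules defining the finite quotients *)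

Definition closedN (N : A -> Prop) := closed (@asg_val _ baseG @` [set v | N v])%classic.

Lemma closedN_multiple q : closedN (multiple q).
Proof.
rewrite /closedN.
have -> : (@asg_val _ baseG @` [set v | multiple q v] = (fun g : G => g ^+ q)%g @` [set g | inB g])%classic.
  apply/seteqP; split=> [_ [_ [u ->] <-]|_ [g bg <-]].
    by exists (asg_val u); [exact: (asg_valP u) | rewrite asg_valMn].
  by exists (asg_mk (B := baseG) bg *+ q); [exists (asg_mk (B := baseG) bg) | rewrite asg_valMn].
by apply: closed_image; [| apply: continuous_exp; exact: continuous_id | exact: closed_base].
Qed.

Lemma closedN_addsm N h : closedN N -> closedN (addsm N h 1).
Proof.
move=> clN; rewrite /closedN.
have -> : (@asg_val _ baseG @` [set v | addsm N h 1 v] =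
    [set z | exists x y, [/\ (@asg_val _ baseG @` [set v | N v]) x,
      ((fun w => gdif gmul ginv (asg_val h) w) @` [set g | inB g]) y & z = (x * y)%g]])%classic.
  apply/seteqP; split=> [_ [_ [n [w [Nn ->]]] <-]|_ [_ [_ [[n Nn <-] [g bg <-] ->]]]].
    exists (asg_val n), (asg_val (dif h w)); split => //.
    by exists (asg_val w); first exact: (asg_valP w).
  by exists (n + dif h (asg_mk (B := baseG) bg)) => //; exists n, (asg_mk (B := baseG) bg).
apply: closed_prod => //.
by apply: closed_image => //; [exact: continuous_gdifr | exact: closed_base].
Qed.

(** Chosen so that ['I_(q' n).+1] is convertible to [Zl p n]: exponent vectors of monomials are then
    literally elements of [Xl n]. *)
Let q' n := (Zp_trunc (p ^ n.+1)).+1.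
Notation Nn n := (Nq actG d genX (q' n) (p ^ n.+1)).

Lemma q'E n : (q' n).+1 = (p ^ n.+1)%N. Proof. exact: Zl_modulus. Qed.

Lemma Nn_submod n : submod (Nn n).
Proof. exact: (Nq_submod actGB actGD). Qed.

Lemma closedN_Nn n : closedN (Nn n).
Proof.
have -> : Nn n = addsms actG (multiple (p ^ n.+1)) (level genX (q' n) d).
  by apply: funext => v; apply: propext; exact: NqP actGB _ _ _ _ _.
suff H N l : closedN N -> closedN (addsms actG N [seq (x, 1%N) | x <- l]).
  rewrite /level (_ : [seq _ | i <- _] = [seq (x, 1%N) | x <- [seq genX i *+ (q' n).+1 | i <- iota 0 d]]).
    by apply: H; exact: closedN_multiple.
  by rewrite -map_comp.
by elim: l N => //= x l IH N clN; apply: IH; exact: closedN_addsm.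
Qed.

Lemma zlevel_small K n k z : open_normal K ->
  (forall u : X, K (asg_val (u *+ (p ^ n.+1)))) -> zlevel actG genX (q' n) k z -> K (asg_val z).
Proof.
move=> oK Ku; elim: k z => [|k IH] z.
  by move=> ->; exact: open_normal1 oK.
rewrite zlevelS q'E => -[z' [w [/IH Kz ->]]]; rewrite asg_valD.
case: (oK) => _ Km _ _; apply: Km => //.
by rewrite -[pdif _ _ _ _]/(dif _ w) val_dif; apply: open_normal_gdif.
Qed.

(** In an element of [Nn n] the part from the x_i^q - 1 tends to 1 by [top_small]. So v is a limit
    of elements of p^k A, which is closed, and [base_divisible] applies. *)
Lemma Nn_separated v : (forall n, Nn n v) -> v = 0.
Proof.
move=> Nv; apply: base_divisible => k.
suff [u [w ->] E] : (@asg_val _ baseG @` [set v | multiple (p ^ k) v])%classic (asg_val v).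
  by exists w; apply: asg_val_inj; rewrite E.
have clk : closed (@asg_val _ baseG @` [set v | multiple (p ^ k) v])%classic := @closedN_multiple _.
apply: (closed_mem pG clk) => K oK; have [N KN] := top_small oK.
(* Deep enough both for z to lie in K and for p^k to divide the other term. *)
have [u [z [zz E]]] := Nv (N + k)%N.
exists (asg_val (u *+ (p ^ (N + k).+1))).
  exists (u *+ (p ^ (N + k).+1)) => //; exists (u *+ (p ^ N.+1)).
  by rewrite -mulrnA -expnD addSn.
have -> : ((asg_val v)^-1 * asg_val (u *+ (p ^ (N + k).+1)))%g = asg_val (- z).
  by rewrite -asg_valN -asg_valD E opprD addrAC addNr add0r.
rewrite asg_valN; case: (oK) => _ _ Ki _; apply: Ki.
apply: (zlevel_small oK _ zz) => h; apply: KN; lia.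
Qed.

Lemma Nn_dif_gen n c w : Nn n (dif (comb aX c *+ (p ^ n.+1)) w).
Proof.
have sN := Nn_submod n.
have D h k : (forall w, Nn n (dif h w)) -> (forall w, Nn n (dif k w)) -> forall w, Nn n (dif (h + k) w).
  by move=> Hh Hk u; rewrite difDh; apply: (smD sN).
have V h : (forall w, Nn n (dif h w)) -> forall w, Nn n (dif (- h) w).
  move=> Hh u; have -> : dif (- h) u = - dif h (actG (- h) u).
    by apply/eqP; rewrite -subr_eq0 opprK addrC -difDh subrr dif0h.
  exact: (smN sN).
have Z : forall w, Nn n (dif 0 w) by move=> u; rewrite dif0h; exact: (sm0 sN).
have M h k : (forall w, Nn n (dif h w)) -> forall w, Nn n (dif (h *+ k) w).
  by move=> Hh; elim: k => [|k IH]; [rewrite mulr0n | rewrite mulrS; exact: D].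
rewrite /comb -sumrMnl; move: w.
apply: (big_ind (fun h => forall w, Nn n (dif h w))) => // i _.
have Hi : forall w, Nn n (dif (genX i *+ (p ^ n.+1)) w).
  move=> u; rewrite -q'E; apply: Nq_zlevel; apply: (zlevel_dif actGB actGD) => //.
case: (c i) => k; first by rewrite -pmulrn mulrnAC; exact: M.
by rewrite NegzE mulrNz mulNrn -pmulrn mulrnAC; apply: V; exact: M.
Qed.

(** For integral combinations of the x_i this is [Nn_dif_gen]; these are dense in X, and [Nn n] is
    closed. *)
Lemma Nn_dif n (u : X) w : Nn n (dif (u *+ (p ^ n.+1)) w).
Proof.
suff [v Nv /asg_val_inj <-] : (@asg_val _ baseG @` [set v | Nn n v])%classic
    (asg_val (dif (u *+ (p ^ n.+1)) w)) by [].
have clN : closed (@asg_val _ baseG @` [set v | Nn n v])%classic := @closedN_Nn n.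
apply: (closed_mem pG clN) => K oK; have [N KN] := top_small oK.
have [c [u' ->]] := top_gen_exp N u.
rewrite mulrnDl -mulrnA difDh; set a := dif _ (actG _ _); set b := dif _ w.
exists (asg_val a); first by exists a => //; exact: Nn_dif_gen.
have -> : ((asg_val (a + b))^-1 * asg_val a)%g = (asg_val b)^-1%g.
  by rewrite -asg_valN -asg_valD opprD addrAC addNr add0r.
case: (oK) => _ _ Ki _; apply: Ki; rewrite val_dif; apply: open_normal_gdif => //.
by rewrite -expnD; apply: KN; rewrite leq_addr.
Qed.

(** * Coordinates of a model in the finite wreath products *)

Notation Zl := (Zl p). Notation Xl := (Xl p d). Notation Ml := (Ml p m d).

Lemma Zl_intr_eq0 n (c : int) : ((c%:~R : Zl n) == 0) = ((p ^ n.+1)%N%:Z %| c)%Z.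
Proof.
rewrite dvdzE absz_nat; case: c => k; first by rewrite -pmulrn Zl_natr_eq0.
by rewrite NegzE mulrNz oppr_eq0 -pmulrn Zl_natr_eq0 // abszN absz_nat.
Qed.
Lemma Zl_intr n (a : Zl n) : (nat_of_ord a)%:Z%:~R = a.
Proof. by rewrite -pmulrn Zl_natr. Qed.

Definition intlift n (f : Ml n) (z : Xl n) (j : 'I_m) : int := (nat_of_ord (f z j))%:Z.
Definition PsiG n (c : Xl n -> 'I_m -> int) : A := Psi actG genX aA (q' := q' n) c.
Arguments PsiG n c : clear implicits.

Lemma PsiG_congr n c c' : (forall z j, (c z j)%:~R = (c' z j)%:~R :> Zl n) ->
  Nn n (PsiG n c - PsiG n c').
Proof.
move=> E; rewrite /PsiG -PsiB; last exact: actGB.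
apply: (Nq_multiple actGB actGD); apply: (Psi_multiple actGB) => z j.
by rewrite -Zl_intr_eq0 intrB E subrr.
Qed.

Lemma PsiG_eq0 n c : Nn n (PsiG n c) -> forall z j, (c z j)%:~R = 0 :> Zl n.
Proof.
move=> Nc z j; rewrite -q'E in Nc; apply/eqP; rewrite Zl_intr_eq0 -q'E.
exact: (Psi_indep actGB actG0 actGD p_pr base_tf filtr_regular base_indep (q'E n) Nc).
Qed.

(** f is the coordinate vector of v in the free module A / [Nn n]; it exists by [Psi_gen] and is
    unique by [Psi_indep]. *)
Definition repB n (v : A) (f : Ml n) := Nn n (v - PsiG n (intlift f)).

Lemma repB_inj n v f g : repB v f -> @repB n v g -> f = g.
Proof.
move=> Nf Ng; apply/ffunP=> z; apply/ffunP=> j.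
have sN := Nn_submod n.
have : Nn n (PsiG n (fun z j => intlift f z j - intlift g z j)).
  rewrite /PsiG PsiB; last exact: actGB.
  have := smB sN Ng Nf; rewrite /repB /PsiG opprB addrC addrA subrK.
  by rewrite addrC.
by move/PsiG_eq0/(_ z j)/eqP; rewrite intrB !Zl_intr subr_eq0 => /eqP.
Qed.

Lemma repB_exists n v : exists f : Ml n, repB v f.
Proof.
have [c Nc] := Psi_gen actGB actG0 actGD p_pr base_gen (q'E n) v.
rewrite q'E in Nc.
exists [ffun z => [ffun j => (c z j)%:~R]]; rewrite /repB.
have -> : v - PsiG n (intlift [ffun z => [ffun j => (c z j)%:~R]]) = v - PsiG n c +
   (PsiG n c - PsiG n (intlift [ffun z => [ffun j => (c z j)%:~R]])) by rewrite addrA subrK.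
apply: (smD (Nn_submod n)) => //; apply: PsiG_congr => z j.
by rewrite /intlift !ffunE Zl_intr.
Qed.

Definition monG n (y : Xl n) : X := mon genX (q' := q' n) y.
Definition repX n (h : X) (y : Xl n) := exists u, h = monG y + u *+ (p ^ n.+1).

Lemma monG_comb n (y : Xl n) : monG y = comb aX (fun i => (nat_of_ord (y i))%:Z).
Proof. by []. Qed.

Lemma monG_congr n (y : Xl n) (c : 'I_d -> int) : (forall i, (c i)%:~R = y i) ->
  exists u, comb aX c = monG y + u *+ (p ^ n.+1).
Proof.
move=> E; have dv i : ((p ^ n.+1)%N%:Z %| c i - (nat_of_ord (y i))%:Z)%Z.
  by rewrite -Zl_intr_eq0 intrB E Zl_intr subrr.
exists (comb aX (fun i => ((c i - (nat_of_ord (y i))%:Z) %/ (p ^ n.+1)%N%:Z)%Z)).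
rewrite monG_comb pmulrn -comb_scale /comb -big_split; apply: eq_bigr => i _.
by rewrite /= divzK // mulrzBr addrC subrK.
Qed.

Lemma repX_inj n h (y z : Xl n) : repX h y -> repX h z -> y = z.
Proof.
move=> [u ->] [w E]; apply/ffunP=> i.
have : comb aX (fun i => (nat_of_ord (y i))%:Z - (nat_of_ord (z i))%:Z) = (w - u) *+ (p ^ n.+1).
  have -> : comb aX (fun i => (nat_of_ord (y i))%:Z - (nat_of_ord (z i))%:Z) = monG y - monG z.
    by rewrite !monG_comb /comb -sumrB; apply: eq_bigr => k _; rewrite mulrzBr.
  by rewrite mulrnBl; apply/eqP; rewrite subr_eq [X in _ == X]addrC addrA -E addrK.
by move/top_indep_exp/(_ i); rewrite -Zl_intr_eq0 intrB !Zl_intr subr_eq0 => /eqP.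
Qed.

Lemma repX_exists n h : exists y : Xl n, repX h y.
Proof.
have [c [u ->]] := top_gen_exp n.+1 h; exists [ffun i => (c i)%:~R].
have [|w ->] := @monG_congr n [ffun i => (c i)%:~R] c; first by move=> i; rewrite ffunE.
by exists (w + u); rewrite mulrnDl addrA.
Qed.

Lemma repB_add n u v (f g : Ml n) : repB u f -> repB v g -> repB (u + v) (f + g).
Proof.
have sN := Nn_submod n; move=> Nf Ng; rewrite /repB.
have -> : u + v - PsiG n (intlift (f + g)) = (u - PsiG n (intlift f)) + (v - PsiG n (intlift g)) +
    (PsiG n (fun z j => intlift f z j + intlift g z j) - PsiG n (intlift (f + g))).
  have -> : PsiG n (fun z j => intlift f z j + intlift g z j) = PsiG n (intlift f) + PsiG n (intlift g).
    apply/eqP; rewrite -subr_eq; apply/eqP; rewrite /PsiG -PsiB; last exact: actGB.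
    by apply: Psi_ext => z j; rewrite addrK.
  by rewrite (addrACA u) -opprD addrA subrK.
apply: (smD sN); first exact: (smD sN).
by apply: PsiG_congr => z j; rewrite intrD /intlift !Zl_intr !ffunE.
Qed.

Lemma repX_add n h k (y z : Xl n) : repX h y -> repX k z -> repX (h + k) (y + z).
Proof.
move=> [u ->] [w ->]; have [|t Et] := @monG_congr n (y + z) (fun i => (nat_of_ord (y i))%:Z + (nat_of_ord (z i))%:Z).
  by move=> i; rewrite intrD !Zl_intr ffunE.
exists (t + (u + w)); rewrite addrACA -mulrnDl [in RHS]mulrnDl [in RHS]addrA -Et; congr (_ + _).
by rewrite !monG_comb /comb -big_split; apply: eq_bigr => i _; rewrite mulrzDr.
Qed.

(** By [Nn_dif] h acts like the monomial of y. Monomials multiply by adding exponents modulo q,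
    which reindexes the sum by a translation. *)
Lemma repB_act n h v (y : Xl n) (f : Ml n) : repX h y -> repB v f -> repB (actG h v) (wshift y f).
Proof.
have sN := Nn_submod n; move=> [u ->] Nf; rewrite /repB.
have -> : actG (monG y + u *+ (p ^ n.+1)) v - PsiG n (intlift (wshift y f)) =
    actG (monG y) (dif (u *+ (p ^ n.+1)) v) + (actG (monG y) (v - PsiG n (intlift f)) +
    (actG (monG y) (PsiG n (intlift f)) - PsiG n (intlift (wshift y f)))).
  by rewrite actGD !actGB !addrA !subrK.
apply: (smD sN); first by apply: (smA sN); exact: Nn_dif.
apply: (smD sN); first exact: (smA sN).
rewrite /PsiG /Psi [X in _ - X](reindex_inj (addIr y)) /= act_sum; last exact: actGB.
rewrite -sumrB; apply: (@sm_sum _ _ _ _ _ _ _ _ sN) => z _.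
have -> : comb aA (intlift (wshift y f) (z + y)) = comb aA (intlift f z).
  by apply: eq_bigr => j _; rewrite /intlift ffunE addrK.
have H i : nat_of_ord ((z + y) i) = ((y i + z i) %% (q' n).+1)%N.
  by rewrite ffunE /= addnC.
have := act_mon_add actGB actG0 actGD genX (y := y) (z := z) (s := z + y) (comb aA (intlift f z)) H.
by rewrite q'E.
Qed.

Lemma Nn_step n v : Nn n.+1 v -> Nn n v.
Proof.
have sN := Nn_submod n; move=> [u [z [zz ->]]]; apply: (smD sN).
  apply: (Nq_multiple actGB actGD); exists (u *+ p).
  by rewrite -mulrnA mulnC -expnSr.
suff H k : (k <= d)%N -> forall z, zlevel actG genX (q' n.+1) k z -> Nn n z by exact: H zz.
elim: k {u z zz} => [|k IH] kd z; first by move=> ->; exact: (sm0 sN).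
rewrite zlevelS q'E => -[z' [w [/(IH (ltnW kd)) Nz' ->]]]; apply: (smD sN) => //.
have -> : genX k *+ (p ^ n.+2) = (genX k *+ p) *+ (p ^ n.+1) by rewrite -mulrnA -expnS.
exact: Nn_dif.
Qed.

Lemma monG_red n (y : Xl n.+1) : exists u, monG y = monG (@redX p d n y) + u *+ (p ^ n.+1).
Proof.
have := @monG_congr n (@redX p d n y) (fun i => (nat_of_ord (y i))%:Z).
by rewrite -monG_comb; apply => i; rewrite -pmulrn ffunE.
Qed.

Lemma repX_red n h (y : Xl n.+1) : repX h y -> repX h (@redX p d n y).
Proof.
move=> [u ->]; have [w ->] := monG_red y; exists (w + u *+ p).
by rewrite mulrnDl addrA -mulrnA -expnS.
Qed.

(** Modulo [Nn n] a monomial acts like its reduction, so the coefficients over one fibre are added;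
    this is the fibre sum in [redM]. *)
Lemma repB_red n v (f : Ml n.+1) : repB v f -> repB v (@redM p m d n f).
Proof.
have sN := Nn_submod n; move=> /Nn_step Nf; rewrite /repB.
rewrite -(subrK (PsiG n.+1 (intlift f)) v) -addrA; apply: (smD sN) => //.
pose c (z : Xl n) (j : 'I_m) := \sum_(y : Xl n.+1 | @redX p d n y == z) intlift f y j.
rewrite -(subrK (PsiG n c) (PsiG n.+1 (intlift f))) -addrA; apply: (smD sN); last first.
  apply: PsiG_congr => z j; rewrite /intlift Zl_intr /c ffunE sum_ffunE.
  rewrite (big_morph _ (intrD _) (mulr0z _)); apply: eq_bigr => y _.
  by rewrite -pmulrn ffunE.
have -> : PsiG n c = \sum_(y : Xl n.+1) actG (monG (@redX p d n y)) (comb aA (intlift f y)).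
  rewrite (partition_big (@redX p d n) xpredT) //=; apply: eq_bigr => z _.
  have -> : comb aA (c z) = \sum_(y : Xl n.+1 | @redX p d n y == z) comb aA (intlift f y).
    rewrite /comb exchange_big; apply: eq_bigr => j _.
    by rewrite /c (big_morph (fun k => aA j *~ k) (mulrzDr _) (mulr0z _)).
  rewrite act_sum; last exact: actGB.
  by apply: eq_bigr => y /eqP <-.
rewrite /PsiG /Psi -sumrB; apply: (@sm_sum _ _ _ _ _ _ _ _ sN) => y _.
rewrite -[mon _ _]/(monG y); have [u ->] := monG_red y; rewrite actGD -actGB.
by apply: (smA sN); exact: Nn_dif.
Qed.

Lemma parts_exists (g : G) : exists vh : A * X, g = (asg_val vh.1 * asg_val vh.2)%g.
Proof.
have [v [h [bv th ->]]] := ax_split axG g.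
by exists (asg_mk (B := baseG) bv, asg_mk (B := topG) th).
Qed.

Lemma parts_inj (v w : A) (h k : X) :
  (asg_val v * asg_val h)%g = (asg_val w * asg_val k)%g -> v = w /\ h = k.
Proof.
move=> E; have E' : asg_val (- w + v) = asg_val (k - h).
  rewrite !asg_valD !asg_valN; apply: (@mulgI _ (asg_val w)); apply: (@mulIg _ (asg_val h)).
  by rewrite mulVKg E -!mulgA mulVg mulg1.
have kh : k - h = 0.
  apply: asg_val_inj; apply: (ax_disjoint axG); last exact: (asg_valP (k - h)).
  by rewrite -E'; exact: (asg_valP (- w + v)).
split; last by apply/esym/eqP; rewrite -subr_eq0 kh.
by apply/eqP; rewrite -subr_eq0 addrC; apply/eqP/asg_val_inj; rewrite E' kh.
Qed.

Definition bpart g := (projT1 (cid (parts_exists g))).1.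
Definition tpart g := (projT1 (cid (parts_exists g))).2.
Lemma partsE g : g = (asg_val (bpart g) * asg_val (tpart g))%g.
Proof. exact: (projT2 (cid (parts_exists g))). Qed.

Lemma parts_mul g g' : bpart (g * g')%g = bpart g + actG (tpart g) (bpart g') /\
  tpart (g * g')%g = tpart g + tpart g'.
Proof.
apply: parts_inj; rewrite -partsE !asg_valD actGE {1}(partsE g) {1}(partsE g').
by rewrite !mulgA mulgVK.
Qed.

Definition coordB n g : Ml n := projT1 (cid (repB_exists n (bpart g))).
Definition coordX n g : Xl n := projT1 (cid (repX_exists n (tpart g))).
Lemma coordB_rep n g : repB (bpart g) (coordB n g).
Proof. exact: (projT2 (cid (repB_exists n (bpart g)))). Qed.
Lemma coordX_rep n g : repX (tpart g) (coordX n g).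
Proof. exact: (projT2 (cid (repX_exists n (tpart g)))). Qed.

Definition coord n g : discrete_topology (Ll p m d n) := (coordB n g, coordX n g).

Lemma coord_rep n g f y : repB (bpart g) f -> repX (tpart g) y -> coord n g = (f, y).
Proof.
move=> Bf Xy; congr (_, _); first exact: (repB_inj (coordB_rep n g) Bf).
exact: (repX_inj (coordX_rep n g) Xy).
Qed.

Lemma coord_mul n g g' : coord n (g * g')%g = wmul (coord n g) (coord n g').
Proof.
have [Eb Et] := parts_mul g g'; apply: coord_rep.
  rewrite Eb; apply: repB_add; first exact: coordB_rep.
  by apply: repB_act; [exact: coordX_rep | exact: coordB_rep].
by rewrite Et; apply: repX_add; exact: coordX_rep.
Qed.

Lemma coord_proj n g : wproj (coord n.+1 g) = coord n g.
Proof.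
by apply/esym/coord_rep; [apply: repB_red; exact: coordB_rep | apply: repX_red; exact: coordX_rep].
Qed.

(** The fibre is the product of a coset of [Nn n] in the base and a coset of the p^(n+1)-th powers
    in the top group, both closed. *)
Lemma closed_coord n (w : Ll p m d n) : closed [set g | coord n g = w]%classic.
Proof.
case: w => f y.
pose BS := ((fun g => asg_val (PsiG n (intlift f)) * g)%g @` (@asg_val _ baseG @` [set v | Nn n v]))%classic.
pose XS := ((fun g => asg_val (monG y) * g ^+ (p ^ n.+1))%g @` [set g | inX g])%classic.
have -> : ([set g | coord n g = (f, y)] =
   [set z | exists x y, [/\ BS x, XS y & z = (x * y)%g]])%classic.
  apply/seteqP; split=> [g /= Eg|_ [_ [_ [[_ [v Nv <-] <-] [h xh <-] ->]]]] /=.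
    have fE : coordB n g = f by rewrite -[f]/(f, y).1 -Eg.
    have yE : coordX n g = y by rewrite -[y]/(f, y).2 -Eg.
    exists (asg_val (bpart g)), (asg_val (tpart g)); split; last exact: partsE.
      have := coordB_rep n g; rewrite fE => Nv.
      exists (asg_val (bpart g - PsiG n (intlift f))); first by exists (bpart g - PsiG n (intlift f)).
      by rewrite -asg_valD addrC subrK.
    have := coordX_rep n g; rewrite yE => -[u ->].
    by exists (asg_val u); [exact: (asg_valP u) | rewrite asg_valD asg_valMn].
  set g := (_ * _)%g; pose h' : X := asg_mk (B := topG) xh.
  have [Eb Et] : bpart g = PsiG n (intlift f) + v /\ tpart g = monG y + h' *+ (p ^ n.+1).
    by apply: parts_inj; rewrite -partsE !asg_valD asg_valMn.
  apply: coord_rep; first by rewrite Eb /repB addrC addrA [- _ + _]addrC subrr add0r.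
  by rewrite Et; exists h'.
apply: closed_prod => //; apply: closed_image => //.
- by apply: continuous_mul; [exact: continuous_cst | exact: continuous_id].
- exact: closedN_Nn.
- apply: continuous_mul; first exact: continuous_cst.
  by apply: continuous_exp; exact: continuous_id.
- exact: closed_top.
Qed.

(** The complement of a fibre is a finite union of closed fibres. *)
Lemma continuous_coord n : continuous (coord n).
Proof.
move=> g U Ug; have {Ug} Ug : U (coord n g) by exact: nbhs_singleton Ug.
suff : nbhs g [set g' | coord n g' = coord n g]%classic.
  by apply: filterS => g' Eg'; rewrite /preimage /= Eg'.
apply: open_nbhs_nbhs; split => //; rewrite -[X in open X]setCK; apply: closed_openC.
have -> : (~` [set g' | coord n g' = coord n g] =
   \bigcup_(w in [set w : Ll p m d n | w <> coord n g]) [set g' | coord n g' = w])%classic.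
  by apply/seteqP; split=> [g' /= ne|g' [w /= ne Ew]]; [exists (coord n g') | rewrite /= Ew].
apply: closed_bigcup => [|w _]; [exact: finite_finset | exact: closed_coord].
Qed.

Lemma coord_mem g : ((fun n => coord n g) : Wprod p m d) \in @Wset p m d.
Proof. by apply/mem_set => n; exact: coord_proj. Qed.
Definition coords g : Wlim p m d := SigSub (coord_mem g).

Lemma coords_mul g g' : coords (g * g')%g = Wmul (coords g) (coords g').
Proof. by apply: val_inj; apply: functional_extensionality_dep => n; exact: coord_mul. Qed.

Lemma coords_continuous : continuous coords.
Proof.
apply: (@continuous_comp_initial _ _ _ (@set_val _ (@Wset p m d))) => g.
apply/cvg_sup => n U [B [[C oC <-] Cg] BU].
apply: filterS BU _; apply: (@continuous_coord n g C).
exact: open_nbhs_nbhs.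
Qed.

(** Equal coordinates put the difference of the base parts in every [Nn n] and make the difference
    of the top parts divisible by every p^n. *)
Lemma coords_inj : injective coords.
Proof.
move=> g g' E; have En n : coord n g = coord n g' by exact: (congr1 (fun w => val w n) E).
have Eb n : coordB n g = coordB n g' := congr1 fst (En n).
have Et n : coordX n g = coordX n g' := congr1 snd (En n).
have b0 : bpart g - bpart g' = 0.
  apply: Nn_separated => n; have sN := Nn_submod n.
  have := smB sN (coordB_rep n g) (coordB_rep n g'); rewrite Eb.
  by rewrite opprB addrA subrK.
have t0 : tpart g - tpart g' = 0.
  apply: top_divisible => -[|n]; first by exists (tpart g - tpart g'); rewrite expn0 mulr1n.
  have [u Eu] := coordX_rep n g; have [u' Eu'] := coordX_rep n g'; exists (u - u').
  by rewrite Eu Eu' Et opprD addrACA subrr add0r mulrnBl.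
rewrite (partsE g) (partsE g').
by move/eqP: b0; rewrite subr_eq0 => /eqP ->; move/eqP: t0; rewrite subr_eq0 => /eqP ->.
Qed.

Lemma coord_surj n w : exists g, coord n g = w.
Proof.
case: w => f y; exists (asg_val (PsiG n (intlift f)) * asg_val (monG y))%g.
set g := (_ * _)%g.
have [Eb Et] : bpart g = PsiG n (intlift f) /\ tpart g = monG y.
  by apply: parts_inj; rewrite -partsE.
apply: coord_rep; first by rewrite Eb /repB subrr; exact: (sm0 (Nn_submod n)).
by rewrite Et; exists 0; rewrite mul0rn addr0.
Qed.

(** The fibres over the entries of w are closed, nonempty and nested, so compactness gives a common
    point. *)
Lemma coords_surj w : exists g, coords g = w.
Proof.
have [cG _ _] := pG.
have [|||g Hg] := @compact_nested G cG (fun n => [set g | coord n g = val w n]%classic).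
- by move=> n; exact: closed_coord.
- by move=> n g /= E; rewrite -coord_proj E; exact: (set_valP w n).
- by move=> n; exact: coord_surj.
by exists g; apply: val_inj; apply: functional_extensionality_dep.
Qed.

Theorem model_iso : exists phi : G -> Wlim p m d, cont_iso_W phi.
Proof.
exists coords; split; [|exact: coords_continuous|exact: coords_mul].
have /choice[psi Hpsi] := coords_surj; exists psi => // g.
exact: coords_inj.
Qed.

End Model.

Theorem theorem2 (p m d : nat) :
  prime p -> (0 < m)%N -> (0 < d)%N ->
  exists sigma : gformula,
    [/\ sentence sigma,
        W_models p m d sigma &
        forall G : topGroupType, profinite G -> group_models G sigma ->
          exists phi : G -> Wlim p m d, cont_iso_W phi].
Proof.
move=> p_pr m_gt0 d_gt0; exists (wreath_sentence p m d); split.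
- exact: wreath_sentence_closed.
- by move=> e; apply/wreath_sentenceP => //; eexists; exact: Wlim_axioms.
move=> G pG /(_ (fun=> 1%g)) /(wreath_sentenceP p m_gt0 d_gt0) [e He].
exact: model_iso He.
Qed.
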